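(* The deformation complex of the identity map of operads $\mathsf{PreLie}\to\mathsf{PreLie}$ is acyclic; that is, $H_\bullet(\mathrm{Def}(\mathrm{id}\colon\mathsf{PreLie}\to\mathsf{PreLie}))=0$.
   Context: All vector spaces are over a field $\Bbbk$ of characteristic zero; chain complexes are homological (differential of degree $-1$); $s$ denotes suspension (degree $1$); the Koszul sign rule is used. $\mathsf{PreLie}$ is the operad of pre-Lie algebras: it is generated by one binary operation $a_1\triangleleft a_2$ (degree $0$, no symmetry) subject to $(a_1\triangleleft a_2)\triangleleft a_3-a_1\triangleleft(a_2\triangleleft a_3)=(a_1\triangleleft a_3)\triangleleft a_2-a_1\triangleleft(a_3\triangleleft a_2)$. Deformation complex: let $\mathcal{P}=\mathcal{T}(\mathcal{X})/(\mathcal{R})$ be a Koszul operad generated by $\mathcal{X}$ with quadratic relations $\mathcal{R}$, let $\mathcal{P}^{\text{¡}}$ be its Koszul dual cooperad (the quadratic cooperad cogenerated by $s\mathcal{X}$ with corelations $s^2\mathcal{R}$), and let $f\colon\mathcal{P}\to\mathcal{Q}$ be a map of operads (zero differentials). Put $$\mathrm{Hom}^{\mathbb{S}}(\mathcal{P}^{\text{¡}},\mathcal{Q})=\prod_{n\ge1}\mathrm{Hom}(\mathcal{P}^{\text{¡}}(n),\mathcal{Q}(n))^{\mathbb{S}_n}$$ (the arity one component, i.e. the counit of $\mathcal{P}^{\text{¡}}$, is not removed). The product $\phi\triangleleft\psi$ is computed by applying the infinitesimal decomposition map of $\mathcal{P}^{\text{¡}}$ (sum of all decompositions into two-vertex trees),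 applying $\phi$ to the root vertex and $\psi$ to the upper vertex, and composing in $\mathcal{Q}$; the bracket is $[\phi,\psi]=\phi\triangleleft\psi-(-1)^{|\phi||\psi|}\psi\triangleleft\phi$. Let $\alpha$ be the degree $-1$ element given by the composite $\mathcal{P}^{\text{¡}}\to s\mathcal{X}\to\mathcal{X}\to\mathcal{Q}$ of the projection onto cogenerators, desuspension, and $f|_{\mathcal{X}}$; it is a Maurer–Cartan element. Then $\mathrm{Def}(f\colon\mathcal{P}\to\mathcal{Q})=(\mathrm{Hom}^{\mathbb{S}}(\mathcal{P}^{\text{¡}},\mathcal{Q}),[-,-],d_\alpha)$ with $d_\alpha=[\alpha,-]$. *)

(* Defs.v *)
From HB Require Import structures.
From mathcomp Require Import all_boot all_order all_fingroup all_algebra boolp.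

Set Implicit Arguments.
Unset Strict Implicit.
Unset Printing Implicit Defensive.

Import GRing.Theory.
Local Open Scope ring_scope.

(* Conventions.  A symmetric operad (cooperad) is given by its values on all  *)
(* finite label sets A, with relabelling along bijections, and partial        *)
(* compositions (decompositions) indexed by the subset B of A of the labels   *)
(* carried by the upper vertex; the arity n component is the value at 'I_n,   *)
(* on which 'S_n acts by relabelling.                                         *)
(*                                                                            *)
(* The generators X are one binary operation of degree 0 without symmetry:    *)
(* X(2) is the regular representation of S_2, X(n) = 0 otherwise.  Hence a    *)
(* basis of T(X)(A) is given by planar binary trees whose leaves are labelled *)
(* bijectively by A, Node l r standing for the product of l and r.  The same  *)
(* trees form a basis of T^c(sX)(A): there the degree of a tree is its number *)
(* of vertices, and a tree stands for the tensor of its suspended vertices    *)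
(* taken in depth-first order (root, left subtree, right subtree).            *)

Inductive btree (A : Type) := Leaf of A | Node of btree A & btree A.

Section RawTrees.
Context {A : Type}.

Fixpoint leaves (t : btree A) : seq A :=
  match t with Leaf a => [:: a] | Node l r => leaves l ++ leaves r end.

Fixpoint vertices (t : btree A) : nat :=
  match t with Leaf _ => 0 | Node l r => (vertices l + vertices r).+1 end.

Fixpoint tbind {B : Type} (f : A -> btree B) (t : btree A) : btree B :=
  match t with Leaf a => f a | Node l r => Node (tbind f l) (tbind f r) end.

Definition tmap {B : Type} (f : A -> B) : btree A -> btree B :=
  tbind (fun a => Leaf (f a)).

Fixpoint tcode (t : btree A) : seq (option A) :=
  match t with
  | Leaf a => [:: Some a]
  | Node l r => None :: tcode l ++ tcode r
  end.

Definition tpush (o : option A) (st : seq (btree A)) : seq (btree A) :=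
  match o, st with
  | Some a, _ => Leaf a :: st
  | None, l :: r :: st' => Node l r :: st'
  | None, _ => [::]
  end.

Definition tdecode (w : seq (option A)) : option (btree A) :=
  ohead (foldr tpush [::] w).

Lemma foldr_tcode t st : foldr tpush st (tcode t) = t :: st.
Proof.
by elim: t st => [a|l IHl r IHr] st //=; rewrite foldr_cat IHr IHl.
Qed.

Lemma tcodeK : pcancel tcode tdecode.
Proof. by move=> t; rewrite /tdecode foldr_tcode. Qed.

Lemma size_tcode t : (size (tcode t)).+1 = (size (leaves t)).*2.
Proof.
elim: t => [a|l IHl r IHr] //=.
by rewrite !size_cat doubleD -IHl -IHr addSn addnS.
Qed.

End RawTrees.

HB.instance Definition _ (A : eqType) :=
  Equality.copy (btree A) (pcan_type (@tcodeK A)).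
HB.instance Definition _ (A : choiceType) :=
  Choice.copy (btree A) (pcan_type (@tcodeK A)).
HB.instance Definition _ (A : countType) :=
  Countable.copy (btree A) (pcan_type (@tcodeK A)).

Section LabelledTrees.
Variable A : finType.

Definition labelled (t : btree A) : bool :=
  uniq (leaves t) && [forall a, a \in leaves t].

Record ltree := LTree { tree_of :> btree A; ltreeP : labelled tree_of }.

HB.instance Definition _ := [isSub for tree_of].
HB.instance Definition _ := [Countable of ltree by <:].

Lemma size_ltcode (t : ltree) : (size (tcode t) <= #|A|.*2)%N.
Proof.
case/andP: (ltreeP t) => Ut /forallP At.
suff <- : size (leaves t) = #|A| by rewrite -size_tcode.
by rewrite -(card_uniqP Ut); apply: eq_card => a; rewrite At.
Qed.

Definition ltcode (t : ltree) : {bseq #|A|.*2 of option A} :=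
  Bseq (size_ltcode t).

Definition ltdecode (w : {bseq #|A|.*2 of option A}) : option ltree :=
  obind insub (tdecode w).

Lemma ltcodeK : pcancel ltcode ltdecode.
Proof. by move=> t; rewrite /ltdecode tcodeK /= valK. Qed.

HB.instance Definition _ : isFinite ltree := PCanIsFinite ltcodeK.

End LabelledTrees.

(* Decompositions into two-vertex trees: the upper vertex carries the labels  *)
(* in B, the root vertex carries the other labels and the hole None.          *)

Definition upper {A : finType} (B : {set A}) : finType := {x : A | x \in B}.

Definition lower {A : finType} (B : {set A}) : finType :=
  option {x : A | x \notin B}.

Section Grafting.
Variables (A : finType) (B : {set A}).

Definition fill (u : btree (upper B)) (o : lower B) : btree A :=
  if o is Some x then Leaf (val x) else tmap val u.

Definition graft (r : btree (lower B)) (u : btree (upper B)) : btree A :=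
  tbind (fill u) r.

Lemma leaves_tbind (A1 A2 : Type) (f : A1 -> btree A2) (t : btree A1) :
  leaves (tbind f t) = flatten [seq leaves (f a) | a <- leaves t].
Proof.
by elim: t => [a|l IHl r IHr] /=; rewrite ?cats0 // map_cat flatten_cat IHl IHr.
Qed.

Lemma leaves_tmap (A1 A2 : Type) (f : A1 -> A2) (t : btree A1) :
  leaves (tmap f t) = map f (leaves t).
Proof. by elim: t => [a|l IHl r IHr] //=; rewrite map_cat IHl IHr. Qed.

Lemma graft_labelled (r : ltree (lower B)) (u : ltree (upper B)) :
  labelled (graft r u).
Proof.
have /andP[Ur /forallP Ar] := ltreeP r; have /andP[Uu /forallP Au] := ltreeP u.
have fillE o : leaves (fill u o) =
    if o is Some x then [:: val x] else map val (leaves u).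
  by case: o => [x|] //=; rewrite leaves_tmap.
rewrite /labelled leaves_tbind; apply/andP; split; last first.
  apply/forallP => a; apply/flatten_mapP.
  have [aB|aB] := boolP (a \in B).
    exists None; rewrite ?Ar // fillE.
    by apply/mapP; exists (Sub a aB); rewrite ?Au.
  by exists (Some (Sub a aB)); rewrite ?Ar // fillE inE.
elim: (leaves r : seq (lower B)) Ur => [|o s IHs] //= /andP[os Us].
rewrite cat_uniq IHs // andbT fillE.
have -> : uniq (if o is Some x then [:: val x] else map val (leaves u)).
  by case: o {os} => // ; rewrite map_inj_uniq //; apply: val_inj.
apply/hasPn => a /flatten_mapP[o' o's]; rewrite fillE.
have {os o's} : o' != o by apply: contraNneq os => <-.
case: o' o => [x'|] [x|] //=.
- by rewrite !inE => xx' /eqP ->; apply: contraNneq xx' => /val_inj ->.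
- move=> _; rewrite inE => /eqP ->.
  by apply/mapP => -[y _ eqxy]; move: (valP x'); rewrite /= eqxy (valP y).
- move=> _ /mapP[y _ ->]; rewrite inE.
  by apply/eqP => eqyx; move: (valP x); rewrite /= -eqyx (valP y).
Qed.

Definition lgraft (r : ltree (lower B)) (u : ltree (upper B)) : ltree A :=
  LTree (graft_labelled r u).

End Grafting.

(* Number of vertices following the hole in depth-first order.                *)
Fixpoint after_hole {A : finType} {B : {set A}} (r : btree (lower B)) : nat :=
  match r with
  | Leaf _ => 0
  | Node l r' =>
      if (None : lower B) \in leaves l then after_hole l + vertices r'
      else after_hole r'
  end.

Section LinearAlgebra.
Variable k : fieldType.

Lemma spannedP (V : vectType k) (Q : V -> Prop) :
  exists U : {vspace V}, (forall x, Q x -> x \in U) /\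
    forall W : {vspace V}, (forall x, Q x -> x \in W) -> (U <= W)%VS.
Proof.
pose D d := `[< exists U : {vspace V},
                  \dim U = d /\ forall x, Q x -> x \in U >].
have exD : exists d, D d.
  exists (\dim {: V}); apply/asboolP; exists fullv.
  by split=> // x _; rewrite memvf.
have [d /asboolP[U [dimU QU]] minU] := ex_minnP exD.
exists U; split=> // W QW; apply/capv_idPl/eqP.
rewrite eqEdim capvSl dimU minU //; apply/asboolP; exists (U :&: W)%VS.
by split=> // x Qx; rewrite memv_cap QU ?QW.
Qed.

Definition spanned (V : vectType k) (Q : V -> Prop) : {vspace V} :=
  projT1 (cid (spannedP Q)).

(* The quotient V / U, realised on the complement of U in V.                  *)
Definition quotv (V : vectType k) (U : {vspace V}) : vectType k :=
  subvs_of (U^C)%VS.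

Definition classv (V : vectType k) (U : {vspace V}) (x : V) : quotv U :=
  vsproj (U^C)%VS (daddv_pi (U^C)%VS U x).

Definition reprv (V : vectType k) (U : {vspace V}) (y : quotv U) : V := vsval y.

Lemma reprvK (V : vectType k) (U : {vspace V}) :
  cancel (@reprv V U) (@classv V U).
Proof.
move=> y; rewrite /classv daddv_pi_id ?vsvalK ?subvsP //.
by rewrite capvC capv_compl.
Qed.

Lemma classv_eq0 (V : vectType k) (U : {vspace V}) (x : V) :
  (classv U x == 0) = (x \in U).
Proof.
have UC0 : (U^C :&: U = 0)%VS by rewrite capvC capv_compl.
have xE : daddv_pi (U^C) U x + daddv_pi U (U^C) x = x.
  by rewrite daddv_pi_add // addvC addv_complf memvf.
apply/eqP/idP => [x0|xU].
  have /(congr1 val) := x0; rewrite /= vsprojK ?memv_pi // => pi0.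
  by rewrite -xE pi0 add0r memv_pi.
rewrite /classv; have -> : daddv_pi (U^C) U x = 0; last by rewrite linear0.
apply/eqP; rewrite -memv0 -UC0 memv_cap memv_pi /=.
by rewrite -[X in X \in U](addrK (daddv_pi U (U^C) x)) xE rpredB ?memv_pi.
Qed.

(* The tensor product of two spaces of functions, as functions of two         *)
(* variables.                                                                 *)
Definition tensor (I J : finType) (a : {ffun I -> k^o}) (b : {ffun J -> k^o}) :
  {ffun I * J -> k^o} := [ffun p => a p.1 * b p.2].

Definition tensorv (I J : finType)
    (U : {vspace {ffun I -> k^o}}) (V : {vspace {ffun J -> k^o}}) :
  {vspace {ffun I * J -> k^o}} :=
  <<[seq tensor a b | a <- vbasis U, b <- vbasis V]>>%VS.

End LinearAlgebra.

Section Deformation.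
Variable k : fieldType.

(* The underlying S-module of T(X), and of T^c(sX).                           *)
Definition freeS (A : finType) : vectType k := {ffun ltree A -> k^o}.

(* The basis vector of a tree (0 if the labelling is not bijective).          *)
Definition tvec (A : finType) (t : btree A) : freeS A :=
  [ffun s : ltree A => (tree_of s == t)%:R].

Definition relabel (A A' : finType) (f : A -> A') (x : freeS A) : freeS A' :=
  \sum_(t : ltree A) x t *: tvec (tmap f t).

Definition fcomp (A : finType) (B : {set A})
    (x : freeS (lower B)) (y : freeS (upper B)) : freeS A :=
  \sum_(r : ltree (lower B)) \sum_(u : ltree (upper B))
    (x r * y u) *: tvec (graft r u).

(* Component along B of the infinitesimal decomposition map of T^c(sX): a     *)
(* tree of the form graft r u is sent to r (x) u, with the Koszul sign of     *)
(* moving the vertices of u past those vertices of r that follow the hole.    *)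
Definition fdec (A : finType) (B : {set A}) (x : freeS A) :
    {ffun ltree (lower B) * ltree (upper B) -> k^o} :=
  [ffun p : ltree (lower B) * ltree (upper B) =>
    (-1) ^+ (after_hole p.1 * vertices p.2) * x (lgraft p.1 p.2)].

Definition weight_part (w : nat) (A : finType) (x : freeS A) : freeS A :=
  [ffun t : ltree A => if vertices t == w then x t else 0].

Definition subfamily := forall A : finType, {vspace freeS A}.

Definition relabel_stable (S : subfamily) : Prop :=
  forall (A A' : finType) (f : A -> A'), bijective f ->
  forall x, x \in S A -> relabel f x \in S A'.

Definition operadic_ideal (J : subfamily) : Prop :=
  [/\ relabel_stable J,
      forall (A : finType) (B : {set A}) x y,
        x \in J (lower B) -> fcomp x y \in J A
    & forall (A : finType) (B : {set A}) x y,
        y \in J (upper B) -> fcomp x y \in J A].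

Definition ideal_gen (R : subfamily) : subfamily := fun A =>
  spanned (fun x : freeS A => forall J : subfamily, operadic_ideal J ->
    (forall A', (R A' <= J A')%VS) -> x \in J A).

Definition subcooperad (S : subfamily) : Prop :=
  relabel_stable S /\
  forall (A : finType) (B : {set A}) x,
    x \in S A -> fdec B x \in tensorv (S (lower B)) (S (upper B)).

(* The quadratic cooperad cogenerated by sX with corelations s^2 R: the       *)
(* largest subcooperad of T^c(sX) whose weight two part is contained in       *)
(* s^2 R.  With depth-first orientations s^2 acts on weight two trees         *)
(* without signs.                                                             *)
Definition corelated (R S : subfamily) : Prop :=
  forall (A : finType) x, x \in S A -> weight_part 2 x \in R A.

Definition quadratic_cooperad (R : subfamily) : subfamily := fun A =>
  spanned (fun x : freeS A => exists S : subfamily,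
    [/\ subcooperad S, corelated R S & x \in S A]).

(* The operad P = T(X)/(R), its Koszul dual cooperad, and Def(id : P -> P).   *)

Section QuadraticOperad.
Variable R : subfamily.

Definition operad (A : finType) : vectType k := quotv (ideal_gen R A).

Definition opclass (A : finType) (x : freeS A) : operad A :=
  classv (ideal_gen R A) x.

Definition oprelabel (A A' : finType) (f : A -> A') (x : operad A) :
  operad A' := opclass (relabel f (reprv x)).

Definition opcomp (A : finType) (B : {set A})
    (x : operad (lower B)) (y : operad (upper B)) : operad A :=
  opclass (fcomp (reprv x) (reprv y)).

Definition kdual (A : finType) : vectType k :=
  subvs_of (quadratic_cooperad R A).

Definition kdproj (A : finType) (x : freeS A) : kdual A :=
  vsproj (quadratic_cooperad R A) x.

Definition kdrelabel (A A' : finType) (f : A -> A') (x : kdual A) : kdual A' :=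
  kdproj (relabel f (vsval x)).

(* The factor n = 0 vanishes: kdual 'I_0 = 0, as every tree has a leaf.       *)
Definition cochain := forall n : nat, kdual 'I_n -> operad 'I_n.

(* Elements of degree d: kdual 'I_n is concentrated in degree n - 1 (trees    *)
(* with n leaves have n - 1 vertices) and operad 'I_n in degree 0.            *)
Definition Hom_S (d : int) (phi : cochain) : Prop :=
  [/\ forall n, linear (phi n),
      forall n (s : 'S_n) x, phi n (kdrelabel s x) = oprelabel s (phi n x)
    & forall n, - d != n%:Z - 1 -> forall x, phi n x = 0].

(* Extension of an equivariant map to all finite label sets.                  *)
Definition extend (phi : cochain) (A : finType) (x : kdual A) : operad A :=
  oprelabel enum_val (phi #|A| (kdrelabel enum_rank x)).

(* phi <| psi, for psi of degree e.  The decomposition of an element of the   *)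
(* Koszul dual cooperad is a sum of tensors of elements of that cooperad, so  *)
(* that (phi (x) psi) can be evaluated on it through any linear extensions of *)
(* phi and psi to T^c(sX), here the ones given by kdproj.                     *)
Definition preLie_prod (e : int) (phi psi : cochain) : cochain := fun n x =>
  \sum_(B : {set 'I_n})
    \sum_(p : ltree (lower B) * ltree (upper B))
      ((-1) ^+ (absz e * vertices p.1) * fdec B (vsval x) p) *:
        opcomp (extend phi (kdproj (tvec p.1)))
               (extend psi (kdproj (tvec p.2))).

Definition bracket (d e : int) (phi psi : cochain) : cochain := fun n x =>
  preLie_prod e phi psi x - (-1) ^+ absz (d * e) *: preLie_prod d psi phi x.

(* The projection onto cogenerators, followed by desuspension and X -> P.     *)
Definition MC_elt : cochain := fun n x => opclass (weight_part 1 (vsval x)).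

Definition Def_diff (d : int) (phi : cochain) : cochain :=
  bracket (-1) d MC_elt phi.

Definition Def_cycle (d : int) (phi : cochain) : Prop :=
  Hom_S d phi /\ forall n x, Def_diff d phi x = 0 :> operad 'I_n.

Definition Def_boundary (d : int) (phi : cochain) : Prop :=
  exists2 psi, Hom_S (d + 1) psi &
    forall n x, phi n x = Def_diff (d + 1) psi x.

End QuadraticOperad.

Definition preLie_relator (A : finType) (a1 a2 a3 : A) : freeS A :=
  let v := @Leaf A in
  (tvec (Node (Node (v a1) (v a2)) (v a3))
     - tvec (Node (v a1) (Node (v a2) (v a3))))
  - (tvec (Node (Node (v a1) (v a3)) (v a2))
     - tvec (Node (v a1) (Node (v a3) (v a2)))).

(* Nonzero only in arity 3, where a1, a2, a3 enumerate A.                     *)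
Definition preLie_rel : subfamily := fun A =>
  <<[seq preLie_relator p.1.1 p.1.2 p.2 | p : (A * A) * A]>>%VS.

End Deformation.

(* Main.v *)
(* The Koszul dual cooperad of PreLie has in arity n the basis omega_1, ...,   *)
(* omega_n, where omega_a is the signed sum of all trees with leftmost leaf a  *)
(* (it is dual to Perm).  Hence a cochain concentrated in arity n amounts to   *)
(* an element of PreLie(n) that is alternating in all labels but one, that is, *)
(* to an element of weight n, linear in x, of the free pre-Lie superalgebra    *)
(* on two odd generators x and y.  In these terms the differential is, up to   *)
(* sign, z |-> D z + (-1)^|z| z y - x z', where D is the odd derivation with   *)
(* D v = v y on generators and z' is z with x replaced by y.                   *)
(*   This complex is exact.  View monomials as rooted trees.  Contracting a    *)
(* root y is a homotopy from the identity to a map whose values on cycles have *)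
(* root x.  On trees with root x, removing the leaves y is an odd derivation   *)
(* whose graded commutator with the differential multiplies a tree by the      *)
(* number of its leaves, up to trees with fewer leaves; in characteristic      *)
(* zero this is invertible.                                                    *)

From HB Require Import structures.
Require Import Defs.
From mathcomp Require Import all_boot all_order all_fingroup all_algebra.
From mathcomp Require Import boolp generic_quotient ring zify.

Set Implicit Arguments.
Unset Strict Implicit.
Unset Printing Implicit Defensive.

Import GRing.Theory.
Local Open Scope ring_scope.

(** * Linear combinations in modules *)

(** The complex is made explicit in three translations. In the Koszul dual cooperad the coefficients
    of two trees with the same leftmost leaf agree up to the sign [orient], so there is one basis
    vector [omega a] for each label a ([quadratic_cooperad_omega]). The lower bound rests on
    [orient_graft]: decomposing along B changes orientations by a sign that depends on B only. The
    upper bound is an induction on the number of labels, since each rebracketing of a large tree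
    takes place inside a smaller factor of a decomposition ([rel_coef_moves]).

    By equivariance a cochain in arity n is determined by its value on one [omega a], an element of
    PreLie(n) alternating under the permutations that fix a. These elements correspond to elements
    of weight n, linear in x, of the free pre-Lie superalgebra on odd generators x (the leaf [true])
    and y (the leaf [false]): [realize] distributes labels with signs, [unrealize] forgets them, and
    both composites multiply by the order of the stabilizer of a ([unrealizeK], [realizeK]), which
    is invertible in characteristic zero.

    Under this dictionary the product of cochains is insertion into leaves ([product_formula]). The
    Maurer-Cartan element is represented by the product x y, and the differential of the deformation
    complex becomes [diff] up to sign ([Def_diff_represents]).

    It remains to see that [diff] is exact on the part linear in x ([diff_exact]). Monomials are
    read as combinations of rooted trees, a product grafting its right factor onto the vertices of
    its left factor, so that the leftmost leaf labels the root. A cycle z satisfies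
    [del z = X ** subst z], which [contract] kills. By [contract_del], subtracting
    [diff (contract z)] therefore removes all terms with root y. On words with root x the operator
    [prune] satisfies [diff_prune], where [laplacian] is triangular with respect to the number of
    childless vertices and has this positive number as its diagonal entry ([laplacian_filtered]).
    Induction on the filtration then gives a primitive ([rooted_exact]). *)

Section LinearExpressions.
Variables (k : fieldType) (V : lmodType k).

(** Reified linear combinations: two of them have the same value as soon as the coefficients of
    every atom agree, which reduces identities in a module to identities in [k]. *)
Inductive lexp :=
  | LVar of nat | LZero | LAdd of lexp & lexp | LOpp of lexp
  | LScale of k & lexp.

Fixpoint leval (env : seq V) (e : lexp) : V :=
  match e with
  | LVar i => env`_i
  | LZero => 0
  | LAdd a b => leval env a + leval env b
  | LOpp a => - leval env a
  | LScale c a => c *: leval env a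
  end.

Fixpoint lcoef (i : nat) (e : lexp) : k :=
  match e with
  | LVar j => if eqn j i then 1 else 0
  | LZero => 0
  | LAdd a b => lcoef i a + lcoef i b
  | LOpp a => - lcoef i a
  | LScale c a => c * lcoef i a
  end.

Lemma leval_coef env e :
  leval env e = \sum_(i < size env) lcoef i e *: env`_i.
Proof.
elim: e => [j||a IHa b IHb|a IHa|c a IHa] /=.
- have jE i : (if eqn j i then 1 else 0) *: env`_i
    = (if i == j then env`_i else 0).
    case: eqnP => [->|/eqP/negbTE]; rewrite ?eqxx ?scale1r //.
    by rewrite eq_sym => ->; rewrite scale0r.
  under eq_bigr do rewrite jE.
  rewrite -big_mkcond /=; have [lt_j|le_j] := ltnP j (size env).
    by rewrite (big_pred1 (Ordinal lt_j)).
  rewrite nth_default // big_pred0 // => i.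
  by apply/negbTE; rewrite neq_ltn (leq_trans (ltn_ord i) le_j).
- by rewrite big1 // => i _; rewrite scale0r.
- by rewrite IHa IHb -big_split; apply: eq_bigr => i _; rewrite scalerDl.
- by rewrite IHa -sumrN; apply: eq_bigr => i _; rewrite scaleNr.
- by rewrite IHa scaler_sumr; apply: eq_bigr => i _; rewrite scalerA.
Qed.

Fixpoint lcoefs_eq (n : nat) (a b : lexp) : Prop :=
  if n is n'.+1 then lcoef n' a = lcoef n' b /\ lcoefs_eq n' a b else True.

Lemma leval_eq env a b : lcoefs_eq (size env) a b -> leval env a = leval env b.
Proof.
move=> H; rewrite !leval_coef; apply: eq_bigr => -[i lt_i] _ /=; congr (_ *: _).
elim: (size env) H lt_i => [|n IH] //= [Hn H].
by rewrite ltnS leq_eqVlt => /orP[/eqP->|/(IH H)].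
Qed.

End LinearExpressions.

Ltac lmod_same x y :=
  match constr:(Set) with
  | _ => let _ := match constr:(Set) with _ => unify x y end in constr:(true)
  | _ => constr:(false)
  end.
Ltac lmod_lookup x env :=
  lazymatch env with
  | ?y :: ?env' =>
      lazymatch lmod_same x y with
      | true => constr:(0%N)
      | false => let n := lmod_lookup x env' in constr:(S n)
      end
  end.
Ltac lmod_mem x env :=
  lazymatch env with
  | ?y :: ?env' =>
      lazymatch lmod_same x y with
      | true => constr:(true)
      | false => lmod_mem x env'
      end
  | _ => constr:(false)
  end.
Ltac lmod_vars V t env :=
  lazymatch t with
  | @GRing.add _ ?a ?b => let env1 := lmod_vars V a env in lmod_vars V b env1
  | @GRing.opp _ ?a => lmod_vars V a env
  | @GRing.zero _ => env
  | @GRing.scale _ _ ?c ?a => lmod_vars V a env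
  | _ => lazymatch lmod_mem t env with
         | true => env
         | false => constr:(@cons V t env)
         end
  end.
Ltac lmod_reify k t env :=
  lazymatch t with
  | @GRing.add _ ?a ?b =>
      let e1 := lmod_reify k a env in let e2 := lmod_reify k b env in
      constr:(@LAdd k e1 e2)
  | @GRing.opp _ ?a => let e := lmod_reify k a env in constr:(@LOpp k e)
  | @GRing.zero _ => constr:(@LZero k)
  | @GRing.scale _ _ ?c ?a =>
      let e := lmod_reify k a env in constr:(@LScale k c e)
  | _ => let i := lmod_lookup t env in constr:(@LVar k i)
  end.

(* Decides equalities of linear combinations over [k], up to [ring] on the    *)
(* coefficients.                                                              *)
Ltac lmod k V :=
  lazymatch goal with
  | |- ?a = ?b =>
      let env0 := lmod_vars V a (@nil V) in
      let env := lmod_vars V b env0 in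
      let e1 := lmod_reify k a env in
      let e2 := lmod_reify k b env in
      refine (@leval_eq k V env e1 e2 _);
      cbn [size lcoefs_eq lcoef eqn]; repeat split; try ring
  end.

(** * Free pre-Lie algebras and superalgebras *)

Notation weight t := (size (leaves t)).

Definition context (A : Type) := seq (bool * btree A).

Fixpoint plug {A : Type} (c : context A) (t : btree A) : btree A :=
  match c with
  | [::] => t
  | (true, l) :: c' => Node l (plug c' t)
  | (false, r) :: c' => Node (plug c' t) r
  end.

Lemma plug_cat (A : Type) (c1 c2 : context A) (t : btree A) :
  plug (c1 ++ c2) t = plug c1 (plug c2 t).
Proof. by elim: c1 => [|[[] s] c1 IH] //=; rewrite IH. Qed.

Section PreLieFunctions.
Variables (k : fieldType) (A : Type) (e : k).

Definition assoc (W : lmodType k) (f : btree A -> W) (c : context A)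
    (t1 t2 t3 : btree A) : W :=
  f (plug c (Node (Node t1 t2) t3)) - f (plug c (Node t1 (Node t2 t3))).

(* [e = 1]: pre-Lie algebras; [e = -1]: pre-Lie superalgebras generated by    *)
(* odd elements, in which a monomial has the parity of its weight.            *)
Definition preLie_fun (W : lmodType k) (f : btree A -> W) : Prop :=
  forall c t1 t2 t3,
    assoc f c t1 t2 t3 = e ^+ (weight t2 * weight t3) *: assoc f c t1 t3 t2.

Definition fsum (W : lmodType k) (f : btree A -> W)
    (l : seq (k * btree A)) : W :=
  \sum_(p <- l) p.1 *: f p.2.

Lemma fsum_cat (W : lmodType k) (f : btree A -> W) l1 l2 :
  fsum f (l1 ++ l2) = fsum f l1 + fsum f l2.
Proof. by rewrite /fsum big_cat. Qed.

Definition fscale (a : k) (l : seq (k * btree A)) :=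
  [seq (a * p.1, p.2) | p <- l].

Lemma fsum_scale (W : lmodType k) (f : btree A -> W) a l :
  fsum f (fscale a l) = a *: fsum f l.
Proof.
rewrite /fsum big_map scaler_sumr; apply: eq_bigr => p _.
by rewrite scalerA.
Qed.

Lemma preLie_fun_linear (W W' : lmodType k) (f : btree A -> W)
    (g : {linear W -> W'}) : preLie_fun f -> preLie_fun (fun t => g (f t)).
Proof.
by move=> fP c t1 t2 t3; have:= fP c t1 t2 t3; rewrite /assoc -!linearB => ->; rewrite linearZ.
Qed.

Lemma preLie_fun_plug (W : lmodType k) (f : btree A -> W) c :
  preLie_fun f -> preLie_fun (fun t => f (plug c t)).
Proof. by move=> fP c' t1 t2 t3; rewrite /assoc -!plug_cat; apply: fP. Qed.

End PreLieFunctions.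

Section FreePreLie.
Local Open Scope quotient_scope.
Variables (k : fieldType) (A : choiceType) (e : k).

Notation formal := (seq (k * btree A)).

(** Formal sums are identified when no pre-Lie function separates them. The universal property of
    the quotient then holds by construction. *)
Definition feqv (l1 l2 : formal) : bool :=
  `[< forall (W : lmodType k) (f : btree A -> W),
        preLie_fun e f -> fsum f l1 = fsum f l2 >].

Lemma feqvP l1 l2 : reflect (forall (W : lmodType k) (f : btree A -> W),
  preLie_fun e f -> fsum f l1 = fsum f l2) (feqv l1 l2).
Proof. exact: asboolP. Qed.

Lemma feqv_refl : reflexive feqv.
Proof. by move=> l; apply/feqvP. Qed.
Lemma feqv_sym : symmetric feqv.
Proof. by move=> l1 l2; apply/feqvP/feqvP => H W f /H. Qed.
Lemma feqv_trans : transitive feqv.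
Proof.
by move=> l2 l1 l3 /feqvP H1 /feqvP H2; apply/feqvP => W f fP; rewrite H1 ?H2.
Qed.

Canonical feqv_equiv := EquivRel feqv feqv_refl feqv_sym feqv_trans.

Definition freePL := {eq_quot feqv_equiv}.

HB.instance Definition _ := Choice.on freePL.

Definition fpi (l : formal) : freePL := \pi_freePL l.

Lemma fpiP l1 l2 : (forall (W : lmodType k) (f : btree A -> W),
  preLie_fun e f -> fsum f l1 = fsum f l2) <-> fpi l1 = fpi l2.
Proof.
split=> [H|/eqmodP /feqvP //].
by apply/eqmodP/feqvP.
Qed.

Lemma fpi_repr (x : freePL) : fpi (repr x) = x.
Proof. exact: reprK. Qed.

Lemma fsum_repr (W : lmodType k) (f : btree A -> W) l :
  preLie_fun e f -> fsum f (repr (fpi l)) = fsum f l.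
Proof. by move: (fpi_repr (fpi l)) => /fpiP H /H. Qed.

Definition fpl_add (x y : freePL) := fpi (repr x ++ repr y).
Definition fpl_opp (x : freePL) := fpi (fscale (-1) (repr x)).
Definition fpl_scale (a : k) (x : freePL) := fpi (fscale a (repr x)).

Lemma fpl_addE l1 l2 : fpl_add (fpi l1) (fpi l2) = fpi (l1 ++ l2).
Proof. by apply/fpiP => W f fP; rewrite !fsum_cat !fsum_repr. Qed.
Lemma fpl_scaleE a l : fpl_scale a (fpi l) = fpi (fscale a l).
Proof. by apply/fpiP => W f fP; rewrite !fsum_scale !fsum_repr. Qed.

Lemma freePLW (P : freePL -> Prop) : (forall l, P (fpi l)) -> forall x, P x.
Proof. by move=> H x; rewrite -[x]fpi_repr. Qed.

Lemma fpl_addA : associative fpl_add.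
Proof.
elim/freePLW=> l1; elim/freePLW=> l2; elim/freePLW=> l3.
by rewrite !fpl_addE catA.
Qed.
Lemma fpl_addC : commutative fpl_add.
Proof.
elim/freePLW=> l1; elim/freePLW=> l2; rewrite !fpl_addE.
by apply/fpiP => W f fP; rewrite !fsum_cat addrC.
Qed.
Lemma fpl_add0 : left_id (fpi [::]) fpl_add.
Proof. by elim/freePLW=> l; rewrite fpl_addE. Qed.
Lemma fpl_addN : left_inverse (fpi [::]) fpl_opp fpl_add.
Proof.
elim/freePLW=> l; rewrite [fpl_opp _]fpl_scaleE fpl_addE.
by apply/fpiP => W f fP; rewrite fsum_cat fsum_scale scaleN1r addNr /fsum big_nil.
Qed.

HB.instance Definition _ := GRing.isZmodule.Build freePL
  fpl_addA fpl_addC fpl_add0 fpl_addN.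

Lemma fpl_scaleA a b x : fpl_scale a (fpl_scale b x) = fpl_scale (a * b) x.
Proof.
elim/freePLW: x => l; rewrite !fpl_scaleE; apply/fpiP => W f fP.
by rewrite !fsum_scale scalerA.
Qed.
Lemma fpl_scale1 : left_id 1 fpl_scale.
Proof.
elim/freePLW=> l; rewrite !fpl_scaleE; apply/fpiP => W f fP.
by rewrite !fsum_scale scale1r.
Qed.
Lemma fpl_scaleDr : right_distributive fpl_scale +%R.
Proof.
move=> a; elim/freePLW=> l1; elim/freePLW=> l2.
rewrite [fpi l1 + _]fpl_addE !fpl_scaleE [RHS]fpl_addE; apply/fpiP => W f fP.
by rewrite fsum_cat !fsum_scale fsum_cat scalerDr.
Qed.
Lemma fpl_scaleDl x : {morph fpl_scale^~ x : a b / a + b}.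
Proof.
move=> a b; elim/freePLW: x => l.
rewrite !fpl_scaleE [RHS]fpl_addE; apply/fpiP => W f fP.
by rewrite fsum_cat !fsum_scale scalerDl.
Qed.

HB.instance Definition _ := GRing.Zmodule_isLmodule.Build k freePL
  fpl_scaleA fpl_scale1 fpl_scaleDr fpl_scaleDl.

Definition freeMod : lmodType k := freePL.

Definition cls (t : btree A) : freeMod := fpi [:: (1, t)].

Lemma fpiE l : fpi l = \sum_(p <- l) p.1 *: cls p.2.
Proof.
elim: l => [|[a t] l IH]; first by rewrite big_nil.
rewrite big_cons -IH /= [a *: cls t]fpl_scaleE [RHS]fpl_addE.
apply/fpiP => W f fP; rewrite !fsum_cat fsum_scale /fsum !big_cons !big_nil /=.
by rewrite scale1r !addr0.
Qed.

Lemma freePL_ind (P : freeMod -> Prop) :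
  P 0 -> (forall a t x, P x -> P (a *: cls t + x)) -> forall x, P x.
Proof.
move=> P0 PD; elim/freePLW=> l; rewrite fpiE.
elim: l => [|p l IH]; rewrite ?big_nil ?big_cons //.
exact: PD.
Qed.

(** A relator is killed by every pre-Lie function, hence is equivalent to the empty sum. *)
Lemma cls_preLie : preLie_fun e cls.
Proof.
move=> c t1 t2 t3; rewrite /assoc.
set s1 := plug c _; set s2 := plug c _; set s3 := plug c _; set s4 := plug c _.
set a := e ^+ _.
have E b1 b2 b3 b4 : b1 *: cls s1 + b2 *: cls s2 + (b3 *: cls s3 + b4 *: cls s4)
    = fpi [:: (b1, s1); (b2, s2); (b3, s3); (b4, s4)].
  by rewrite fpiE !big_cons big_nil /= addr0 !addrA.
apply/eqP; rewrite -subr_eq0; apply/eqP.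
have <- : fpi [:: (1, s1); (-1, s2); (- a, s3); (a, s4)] = 0.
  apply/fpiP => W f fP; rewrite /fsum !big_cons !big_nil /= addr0.
  move: (fP c t1 t2 t3); rewrite /assoc -/s1 -/s2 -/s3 -/s4 -/a => H.
  rewrite addrA scale1r scaleN1r H scalerBr scaleNr.
  by rewrite [- (_ *: _) + _]addrC -[X in _ + X]opprB subrr.
by rewrite -E scale1r scaleN1r !scaleNr scalerBr opprB addrC [- _ + _]addrC addrC.
Qed.

Section Lift.
Variables (W : lmodType k) (f : btree A -> W).
Hypothesis fP : preLie_fun e f.

Definition flift (x : freeMod) : W := fsum f (repr x).

Lemma flift_pi l : flift (fpi l) = fsum f l.
Proof. exact: fsum_repr. Qed.

Lemma flift_linear : linear flift.
Proof.
move=> a; elim/freePLW=> l1; elim/freePLW=> l2.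
rewrite [a *: _]fpl_scaleE [_ + fpi l2]fpl_addE !flift_pi fsum_cat.
by rewrite fsum_scale.
Qed.

Lemma flift_cls t : flift (cls t) = f t.
Proof. by rewrite flift_pi /fsum big_seq1 scale1r. Qed.

Lemma exists_lift : exists g : {linear freeMod -> W}, forall t, g (cls t) = f t.
Proof.
pose m := GRing.isLinear.Build _ _ _ _ flift flift_linear.
by exists (HB.pack_for {linear freeMod -> W} flift m); apply: flift_cls.
Qed.

End Lift.

Definition lin_ext (W : lmodType k) (f : btree A -> W) (fP : preLie_fun e f) :
  {linear freeMod -> W} := projT1 (cid (exists_lift fP)).

Lemma lin_extE (W : lmodType k) (f : btree A -> W) (fP : preLie_fun e f) t :
  lin_ext fP (cls t) = f t.
Proof. by rewrite /lin_ext; case: cid. Qed.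

Lemma linear_ext (W : lmodType k) (f g : {linear freeMod -> W}) :
  (forall t, f (cls t) = g (cls t)) -> f =1 g.
Proof.
move=> H; elim/freePL_ind=> [|a t x IH]; first by rewrite !linear0.
by rewrite !linearP IH H.
Qed.

End FreePreLie.

Definition is_node (A : Type) (t : btree A) : bool :=
  if t is Node _ _ then true else false.

Lemma plug_node (A : Type) (c : context A) (l r : btree A) :
  is_node (plug c (Node l r)).
Proof. by case: c => [|[[] s] c]. Qed.

Lemma leaves_plug (A : Type) (c : context A) : exists p q : seq A,
  forall t, leaves (plug c t) = p ++ leaves t ++ q.
Proof.
elim: c => [|[[] s] c [p [q IH]]] /=; first by exists [::], [::] => t; rewrite cats0.
- by exists (leaves s ++ p), q => t; rewrite IH !catA.
- by exists p, (q ++ leaves s) => t; rewrite IH !catA.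
Qed.

Lemma weight_gt0 (A : Type) (t : btree A) : (0 < weight t)%N.
Proof. by elim: t => [a|l IHl r IHr] //=; rewrite size_cat addn_gt0 IHl. Qed.

(** * The pre-Lie product, homogeneous elements and recursively defined operators *)

Section Product.
Variables (k : fieldType) (A : choiceType) (e : k).
Notation Q := (freeMod A e).
Ltac lin := lmod k (freeMod A e).
Notation cls := (@cls k A e).

Lemma left_mul_preLie a : preLie_fun e (fun b => cls (Node a b)).
Proof. exact: (preLie_fun_plug [:: (true, a)] (@cls_preLie k A e)). Qed.

Definition left_mul a : {linear Q -> Q} := lin_ext (left_mul_preLie a).

Lemma right_mul_preLie b : preLie_fun e (fun a => left_mul a b).
Proof.
move=> c t1 t2 t3; rewrite /assoc.
elim/freePL_ind: b => [|x t b IH]; first by rewrite !linear0 ?oppr0 ?addr0 ?scaler0.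
rewrite !linearD !linearZ /= !lin_extE.
have := preLie_fun_plug [:: (false, t)] (@cls_preLie k A e) c t1 t2 t3.
rewrite /assoc /= => E.
move: E IH => /eqP; rewrite subr_eq => /eqP -> /eqP; rewrite subr_eq => /eqP ->.
by lin.
Qed.

Definition plmul (a b : Q) : Q := lin_ext (right_mul_preLie b) a.

Lemma mul_cls a b : plmul (cls a) (cls b) = cls (Node a b).
Proof. by rewrite /plmul !lin_extE. Qed.

Lemma plmulDl a a' b : plmul (a + a') b = plmul a b + plmul a' b.
Proof. exact: linearD. Qed.
Lemma plmulZl x a b : plmul (x *: a) b = x *: plmul a b.
Proof. exact: linearZ. Qed.
Lemma plmul0l b : plmul 0 b = 0.
Proof. exact: linear0. Qed.
Lemma plmulNl a b : plmul (- a) b = - plmul a b.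
Proof. exact: linearN. Qed.

Lemma plmulP a x b b' : plmul a (x *: b + b') = x *: plmul a b + plmul a b'.
Proof.
elim/freePL_ind: a => [|y t a IH]; first by rewrite !plmul0l scaler0 addr0.
rewrite !plmulDl !plmulZl IH /plmul !lin_extE linearP /=.
by lin.
Qed.
Lemma plmul0r a : plmul a 0 = 0.
Proof. by have := plmulP a (-1) 0 0; rewrite scaler0 addr0 scaleN1r addNr. Qed.
Lemma plmulDr a b b' : plmul a (b + b') = plmul a b + plmul a b'.
Proof. by have := plmulP a 1 b b'; rewrite !scale1r. Qed.
Lemma plmulZr x a b : plmul a (x *: b) = x *: plmul a b.
Proof. by have := plmulP a x b 0; rewrite plmul0r !addr0. Qed.
Lemma plmulNr a b : plmul a (- b) = - plmul a b.
Proof. by rewrite -scaleN1r plmulZr scaleN1r. Qed.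

Lemma bilinear_ext (F G : Q -> Q -> Q) :
  (forall b, linear (F^~ b)) -> (forall a, linear (F a)) ->
  (forall b, linear (G^~ b)) -> (forall a, linear (G a)) ->
  (forall t u, F (cls t) (cls u) = G (cls t) (cls u)) -> F =2 G.
Proof.
move=> Fl Fr Gl Gr H a b.
have F0 b' : F 0 b' = 0.
  by have := Fl b' (-1) 0 0; rewrite scaler0 addr0 scaleN1r addNr.
have G0 b' : G 0 b' = 0.
  by have := Gl b' (-1) 0 0; rewrite scaler0 addr0 scaleN1r addNr.
elim/freePL_ind: a => [|x t a IH]; first by rewrite F0 G0.
rewrite Fl Gl IH; congr (_ *: _ + _).
elim/freePL_ind: b {IH} => [|y u b IH].
  have := Fr (cls t) (-1) 0 0; rewrite scaler0 addr0 scaleN1r addNr => ->.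
  by have := Gr (cls t) (-1) 0 0; rewrite scaler0 addr0 scaleN1r addNr => ->.
by rewrite Fr Gr IH H.
Qed.

Definition spanned_by (P : pred (btree A)) (x : Q) : Prop :=
  exists2 l : seq (k * btree A), all (fun p => P p.2) l &
    x = \sum_(p <- l) p.1 *: cls p.2.

Lemma spanned_ind (P : pred (btree A)) (C : Q -> Prop) : C 0 ->
  (forall a t x, P t -> C x -> C (a *: cls t + x)) ->
  forall x, spanned_by P x -> C x.
Proof.
move=> C0 CD x [l Pl ->]; elim: l Pl => [|p l IH] /=; rewrite ?big_nil //.
by case/andP=> Pp Pl; rewrite big_cons; apply: CD => //; apply: IH.
Qed.

Lemma spanned0 (P : pred (btree A)) : spanned_by P 0.
Proof. by exists [::]; rewrite ?big_nil. Qed.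

Lemma spannedD (P : pred (btree A)) x y : spanned_by P x -> spanned_by P y -> spanned_by P (x + y).
Proof.
move=> [l1 P1 ->] [l2 P2 ->]; exists (l1 ++ l2); rewrite ?all_cat ?P1 //.
by rewrite big_cat.
Qed.

Lemma spannedZ (P : pred (btree A)) a x : spanned_by P x -> spanned_by P (a *: x).
Proof.
move=> [l P1 ->]; exists (fscale a l); first by rewrite all_map.
by rewrite big_map scaler_sumr; apply: eq_bigr => p _; rewrite scalerA.
Qed.

Lemma spannedN (P : pred (btree A)) x : spanned_by P x -> spanned_by P (- x).
Proof. by move=> xP; rewrite -scaleN1r; apply: spannedZ. Qed.

Lemma spannedB (P : pred (btree A)) x y : spanned_by P x -> spanned_by P y -> spanned_by P (x - y).
Proof. by move=> xP yP; apply/spannedD/spannedN. Qed.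

Lemma spanned_cls (P : pred (btree A)) t : P t -> spanned_by P (cls t).
Proof.
by move=> Pt; exists [:: (1, t)]; rewrite /= ?Pt // big_seq1 scale1r.
Qed.

Lemma spanned_linear (P P' : pred (btree A)) (f : {linear Q -> Q}) :
  (forall t, P t -> spanned_by P' (f (cls t))) ->
  forall x, spanned_by P x -> spanned_by P' (f x).
Proof.
move=> H; apply: spanned_ind => [|a t x Pt IH].
  by rewrite linear0; apply: spanned0.
by rewrite linearP; apply: spannedD => //; apply/spannedZ/H.
Qed.

Lemma spanned_sub (P P' : pred (btree A)) :
  (forall t, P t -> P' t) -> forall x, spanned_by P x -> spanned_by P' x.
Proof.
move=> H; apply: spanned_ind => [|a t x /H Pt IH]; first exact: spanned0.
by apply/spannedD/IH/spannedZ/spanned_cls.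
Qed.

Lemma spanned_mul (P P1 P2 : pred (btree A)) x y :
  (forall t u, P1 t -> P2 u -> P (Node t u)) ->
  spanned_by P1 x -> spanned_by P2 y -> spanned_by P (plmul x y).
Proof.
move=> H P1x P2y.
move: x P1x; apply: spanned_ind => [|a t z Pt IH]; first by rewrite plmul0l; apply: spanned0.
rewrite plmulDl plmulZl; apply/spannedD/IH/spannedZ.
move: y P2y {IH}; apply: spanned_ind => [|b u w Pu IH]; first by rewrite plmul0r; apply: spanned0.
by rewrite plmulP; apply/spannedD/IH/spannedZ; rewrite mul_cls; apply/spanned_cls/H.
Qed.

Lemma spannedT x : spanned_by predT x.
Proof.
elim/freePL_ind: x => [|a t x IH]; first exact: spanned0.
by apply/spannedD/IH/spannedZ/spanned_cls.
Qed.

Lemma linear_ext_in (P : pred (btree A)) (W : lmodType k)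
    (f g : {linear Q -> W}) :
  (forall t, P t -> f (cls t) = g (cls t)) ->
  forall x, spanned_by P x -> f x = g x.
Proof.
move=> H; apply: spanned_ind => [|a t x /H fg IH]; first by rewrite !linear0.
by rewrite !linearP fg IH.
Qed.

Definition homog (n : nat) : Q -> Prop := spanned_by (fun t => weight t == n).

Lemma homog_cls t : homog (weight t) (cls t).
Proof. exact: spanned_cls. Qed.

Lemma homog_mul n m x y : homog n x -> homog m y -> homog (n + m) (plmul x y).
Proof.
by apply: spanned_mul => t u /eqP <- /eqP <-; rewrite /= size_cat.
Qed.

Lemma mul_preLie x n y m z : homog n y -> homog m z ->
  plmul (plmul x y) z - plmul x (plmul y z)
  = e ^+ (n * m) *: (plmul (plmul x z) y - plmul x (plmul z y)).
Proof.
have expand (a : k) (p q r s p' q' r' s' : Q) :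
    p - q = e ^+ (n * m) *: (p' - q') -> r - s = e ^+ (n * m) *: (r' - s') ->
    a *: p + r - (a *: q + s)
    = e ^+ (n * m) *: (a *: p' + r' - (a *: q' + s')).
  move=> /eqP; rewrite subr_eq => /eqP -> /eqP; rewrite subr_eq => /eqP ->.
  by lin.
move=> yn zm; move: y yn; apply: spanned_ind => [|b u y /eqP un IHy].
  by rewrite ?(plmul0l, plmul0r) !subr0 scaler0.
rewrite !(plmulDl, plmulDr, plmulZl, plmulZr); apply: (@expand) => //.
move: z zm {y IHy}; apply: spanned_ind => [|c v z /eqP vm IHz].
  by rewrite ?(plmul0l, plmul0r) !subr0 scaler0.
rewrite !(plmulDl, plmulDr, plmulZl, plmulZr); apply: (@expand) => //.
elim/freePL_ind: x {z IHz} => [|a t x IHx].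
  by rewrite ?(plmul0l, plmul0r) !subr0 scaler0.
rewrite !(plmulDl, plmulZl); apply: (@expand) => //.
rewrite !mul_cls -un -vm; exact: (@cls_preLie k A e [::] t u v).
Qed.

(** A function defined by recursion on trees respects the relation in every context once it does so
    at the root and its value on a product is an expression, linear in [cls t] and [f t], in the
    factor t that varies. The four monomials of a relator are composite and of equal weight, so the
    coefficients may depend on the weight, and leaves may follow a different rule. *)
Lemma preLie_funP (f : btree A -> Q) :
  (forall t1 t2 t3, assoc f [::] t1 t2 t3
      = e ^+ (weight t2 * weight t3) *: assoc f [::] t1 t3 t2) ->
  (forall a n, exists c1 c2 u1 u2, forall t, is_node t -> weight t = n ->
     f (Node a t) = c1 *: cls t + c2 *: f t + plmul u1 (cls t) + plmul u2 (f t)) ->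
  (forall a n, exists u c2 u2, forall t, is_node t -> weight t = n ->
     f (Node t a) = plmul (cls t) u + plmul (f t) u2 + c2 *: cls t) ->
  preLie_fun e f.
Proof.
move=> f0 fl fr; elim=> [|[[] a] c IH] t1 t2 t3; first exact: f0.
all: have := IH t1 t2 t3; have := @cls_preLie k A e c t1 t2 t3.
all: have [p [q pq]] := leaves_plug c; rewrite /assoc /=.
all: set s1 := plug c _; set s2 := plug c _; set s3 := plug c _.
all: set s4 := plug c _; set s := e ^+ _.
all: have node1 : is_node s1 by apply: plug_node.
all: have node2 : is_node s2 by apply: plug_node.
all: have node3 : is_node s3 by apply: plug_node.
all: have node4 : is_node s4 by apply: plug_node.
all: have w2 : weight s2 = weight s1 by rewrite !pq !size_cat /= ?size_cat /= ?size_cat; lia.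
all: have w3 : weight s3 = weight s1 by rewrite !pq !size_cat /= ?size_cat /= ?size_cat; lia.
all: have w4 : weight s4 = weight s1 by rewrite !pq !size_cat /= ?size_cat /= ?size_cat; lia.
all: move/eqP; rewrite subr_eq => /eqP cE /eqP; rewrite subr_eq => /eqP fE.
- have [c1 [c2 [u1 [u2 H]]]] := fl a (weight s1).
  rewrite !H // cE fE !(plmulDr, plmulNr, plmulZr).
  by lin.
- have [u [c2 [u2 H]]] := fr a (weight s1).
  rewrite !H // cE fE !(plmulDl, plmulNl, plmulZl).
  by lin.
Qed.

(** The scalar is the same on the four monomials of a relator. This covers the parity, the weight
    and the projection onto a given root label. *)
Lemma diagonal_preLie (d : btree A -> k) :
  (forall c t1 t2 t3, d (plug c (Node t1 (Node t2 t3)))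
     = d (plug c (Node (Node t1 t2) t3))) ->
  (forall c t1 t2 t3, d (plug c (Node (Node t1 t3) t2))
     = d (plug c (Node (Node t1 t2) t3))) ->
  preLie_fun e (fun t => d t *: cls t).
Proof.
move=> d1 d2 c t1 t2 t3; have := @cls_preLie k A e c t1 t2 t3.
rewrite /assoc !d1 d2 -!scalerBr => ->.
by rewrite !scalerA mulrC.
Qed.

End Product.
Arguments plmul {k A e} a b.

(** * The differential on the free pre-Lie superalgebra on two odd generators *)

Lemma sign_cases (k : fieldType) (n : nat) :
  (-1) ^+ n = 1 :> k \/ (-1) ^+ n = -1 :> k.
Proof. by rewrite -signr_odd; case: odd; [right | left]. Qed.

Notation boolC := Datatypes_bool__canonical__choice_Choice.

Section SuperPreLie.
Variable k : fieldType.
Notation Q := (@freeMod k boolC (-1)).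
Ltac lin := change (Choice.sort boolC) with bool; lmod k (@freeMod k boolC (-1)).
Notation cls := (@cls k boolC (-1)).
Notation "a ** b" := (plmul a b) (at level 40, left associativity).
Notation X := (cls (Leaf true)).
Notation Y := (cls (Leaf false)).
Notation sg n := ((-1 : k) ^+ n).
Notation mulE := (plmulDl, plmulDr, plmulZl, plmulZr, plmulNl, plmulNr, plmul0l, plmul0r).

Lemma cls_node a b : cls (Node a b) = cls a ** cls b.
Proof. by rewrite mul_cls. Qed.

Lemma mul_linear_r (a : Q) : linear (plmul a).
Proof. by move=> x y z; rewrite plmulDr plmulZr. Qed.

Lemma size_plug (A : Type) c (t1 t2 t3 : btree A) :
  (weight (plug c (Node t1 (Node t2 t3))) = weight (plug c (Node (Node t1 t2) t3)))
  * (weight (plug c (Node (Node t1 t3) t2)) = weight (plug c (Node (Node t1 t2) t3))).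
Proof.
by have [p [q pq]] := leaves_plug c; split; rewrite !pq /= !size_cat /= ?size_cat; lia.
Qed.

Lemma parity_preLie : preLie_fun (-1) (fun t => sg (weight t) *: cls t).
Proof. by apply: diagonal_preLie => c t1 t2 t3; rewrite (size_plug c t1 t2 t3). Qed.
Definition parity : {linear Q -> Q} := lin_ext parity_preLie.
Lemma parity_cls t : parity (cls t) = sg (weight t) *: cls t.
Proof. exact: lin_extE. Qed.

Lemma parity_leaf v : parity (cls (Leaf v)) = - cls (Leaf v).
Proof. by rewrite parity_cls /= expr1 scaleN1r. Qed.

Lemma parity_mul a b : parity (a ** b) = parity a ** parity b.
Proof.
apply: (@bilinear_ext k boolC (-1) (fun a b => parity (a ** b))
  (fun a b => parity a ** parity b)) => [{}b|{}a|{}b|{}a|t u] /=.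
1-4: by move=> z u v; rewrite !(mulE, linearD, linearZ).
by rewrite mul_cls !parity_cls !mulE scalerA -exprD /= size_cat mul_cls.
Qed.

Lemma parityK : involutive parity.
Proof.
move=> a; apply: (@linear_ext k boolC (-1) _ (parity \o parity) idfun) => t /=.
rewrite parity_cls linearZ /= parity_cls scalerA.
by rewrite -expr2 sqrr_sign scale1r.
Qed.

Lemma degree_preLie : preLie_fun (-1) (fun t => (weight t)%:R *: cls t).
Proof. by apply: diagonal_preLie => c t1 t2 t3; rewrite (size_plug c t1 t2 t3). Qed.
Definition degree : {linear Q -> Q} := lin_ext degree_preLie.
Lemma degree_cls t : degree (cls t) = (weight t)%:R *: cls t.
Proof. exact: lin_extE. Qed.

Definition rmul (b : Q) : {linear Q -> Q} := lin_ext (right_mul_preLie b).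
Lemma rmulE b a : rmul b a = a ** b.
Proof. by []. Qed.

(** The super identity for b and the odd element y. Writing its sign with [parity] makes it valid
    for inhomogeneous b. *)
Lemma mulY_preLie a b :
  (a ** parity b) ** Y - a ** (parity b ** Y) = (a ** Y) ** b - a ** (Y ** b).
Proof.
elim/freePL_ind: b => [|c u b IH]; first by rewrite !(linear0, mulE).
rewrite !(linearD, linearZ) /= !mulE parity_cls !mulE.
move: IH => /eqP; rewrite subr_eq => /eqP ->.
have := @mul_preLie k boolC (-1) a _ _ _ _ (homog_cls (-1) u) (homog_cls (-1) (Leaf false)).
move=> /eqP; rewrite subr_eq muln1 => /eqP ->.
by case: (sign_cases k (weight u)) => ->; lin.
Qed.

Fixpoint deriv_tree (t : btree bool) : Q :=
  match t with
  | Leaf v => cls (Node t (Leaf false))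
  | Node a b => deriv_tree a ** cls b + sg (weight a) *: (cls a ** deriv_tree b)
  end.

Lemma homog_deriv_tree t : homog (weight t).+1 (deriv_tree t).
Proof.
elim: t => [v|a IHa b IHb] /=; first exact: (homog_cls _ (Node (Leaf v) (Leaf false))).
rewrite size_cat; apply: spannedD.
  by rewrite -addSn; apply: homog_mul => //; apply: homog_cls.
by apply: spannedZ; rewrite -addnS; apply: homog_mul => //; apply: homog_cls.
Qed.

Lemma deriv_preLie : preLie_fun (-1) deriv_tree.
Proof.
apply: preLie_funP => [a b c|a n|b n].
- rewrite /assoc /= !size_cat !cls_node !mulE.
  have := @mul_preLie k boolC (-1) (deriv_tree a) _ _ _ _ (homog_cls (-1) b) (homog_cls (-1) c).
  have := @mul_preLie k boolC (-1) (cls a) _ _ _ _ (homog_deriv_tree b) (homog_cls (-1) c).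
  have := @mul_preLie k boolC (-1) (cls a) _ _ _ _ (homog_cls (-1) b) (homog_deriv_tree c).
  rewrite mulnS mulSn !exprD.
  move=> /eqP; rewrite subr_eq => /eqP -> /eqP; rewrite subr_eq => /eqP ->.
  move=> /eqP; rewrite subr_eq => /eqP ->.
  case: (sign_cases k (weight b)) => ->; case: (sign_cases k (weight c)) => ->;
  case: (sign_cases k (weight b * weight c)) => ->;
  by lin.
- exists 0, 0, (deriv_tree a), (sg (weight a) *: cls a) => t _ _ /=.
  by rewrite mulE !scale0r !add0r.
- exists (sg n *: deriv_tree b), 0, (cls b) => t _ <- /=.
  by rewrite !mulE scale0r addr0 addrC.
Qed.

Definition deriv : {linear Q -> Q} := lin_ext deriv_preLie.
Lemma deriv_cls t : deriv (cls t) = deriv_tree t.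
Proof. exact: lin_extE. Qed.

Lemma deriv_mul a b : deriv (a ** b) = deriv a ** b + parity a ** deriv b.
Proof.
apply: (@bilinear_ext k boolC (-1) (fun a b => deriv (a ** b))
  (fun a b => deriv a ** b + parity a ** deriv b)) => [{}b|{}a|{}b|{}a|t u] /=.
1-4: by move=> z u v; rewrite !(mulE, linearD, linearZ) /=; lin.
by rewrite mul_cls !deriv_cls parity_cls /= mulE.
Qed.

(* The vertex splittings of a rooted tree whose upper vertex has a child.     *)
Lemma del_preLie : preLie_fun (-1) (fun t => deriv (cls t) + parity (cls t) ** Y).
Proof.
exact: (preLie_fun_linear (deriv \+ (rmul Y \o parity)) (@cls_preLie k boolC (-1))).
Qed.
Definition del : {linear Q -> Q} := lin_ext del_preLie.
Lemma delE a : del a = deriv a + parity a ** Y.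
Proof.
apply: (@linear_ext k boolC (-1) _ del (deriv \+ (rmul Y \o parity))) => t.
exact: lin_extE.
Qed.

Lemma del_leaf v : del (cls (Leaf v)) = 0.
Proof.
by rewrite delE deriv_cls parity_cls /= expr1 plmulZl scaleN1r mul_cls addrN.
Qed.

(** The part [deriv] is an odd derivation. Right multiplication by y fails to be one by the defect
    that [mulY_preLie] computes, which is the last term. *)
Lemma del_mul a b :
  del (a ** b) = del a ** b + parity a ** del b - parity a ** (Y ** b).
Proof.
rewrite !delE deriv_mul parity_mul !mulE.
have /eqP := mulY_preLie (parity a) b; rewrite subr_eq => /eqP ->.
by lin.
Qed.

Lemma del_leaf_mul v b :
  del (cls (Leaf v) ** b) = cls (Leaf v) ** (Y ** b) - cls (Leaf v) ** del b.
Proof.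
rewrite del_mul del_leaf parity_cls expr1 !mulE.
by lin.
Qed.

Lemma parity_deriv a : parity (deriv a) = - deriv (parity a).
Proof.
apply: (@linear_ext k boolC (-1) _ (parity \o deriv) (\- (deriv \o parity))) => /=.
elim=> [v|a' IHa b IHb]; first by rewrite parity_cls linearZ /= deriv_cls /= parity_cls /=; lin.
rewrite cls_node deriv_mul parity_mul deriv_mul linearD /= !parity_mul parityK IHa IHb.
by rewrite !mulE opprD.
Qed.

Lemma parity_del a : parity (del a) = - del (parity a).
Proof.
rewrite !delE linearD /= parity_mul parity_deriv parityK parity_cls expr1 !mulE.
by lin.
Qed.

(** Induction over products: the cross terms cancel because [del] anticommutes with [parity], and
    the corrections cancel because [del (Y ** b)] equals [Y ** (Y ** b) - Y ** del b]. *)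
Lemma del_del a : del (del a) = 0.
Proof.
apply: (@linear_ext k boolC (-1) _ (del \o del) \0) => /=.
elim=> [v|a' IHa b IHb] /=; first by rewrite del_leaf linear0.
rewrite cls_node del_mul linearB linearD /= !del_mul del_leaf parity_del !parityK IHa IHb.
rewrite parity_leaf ?mulE.
by lin.
Qed.

Definition erase (t : btree bool) : btree bool := tmap (fun _ => false) t.

Lemma tmap_plug (A B : Type) (f : A -> B) (c : context A) t :
  tmap f (plug c t) = plug [seq (p.1, tmap f p.2) | p <- c] (tmap f t).
Proof. by elim: c => [|[[] s] c IH] //=; rewrite /tmap /= -!/(tmap f _) IH. Qed.

Lemma erase_preLie : preLie_fun (-1) (fun t => cls (erase t)).
Proof.
move=> c t1 t2 t3; rewrite /assoc /erase !tmap_plug.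
have := @cls_preLie k boolC (-1) [seq (p.1, erase p.2) | p <- c]
  (erase t1) (erase t2) (erase t3).
by rewrite /assoc /erase !leaves_tmap !size_map.
Qed.
Definition subst : {linear Q -> Q} := lin_ext erase_preLie.
Lemma subst_cls t : subst (cls t) = cls (erase t).
Proof. exact: lin_extE. Qed.

Lemma subst_mul a b : subst (a ** b) = subst a ** subst b.
Proof.
apply: (@bilinear_ext k boolC (-1) (fun a b => subst (a ** b))
  (fun a b => subst a ** subst b)) => [{}b|{}a|{}b|{}a|t u] /=.
1-4: by move=> z u v; rewrite !(mulE, linearD, linearZ).
by rewrite mul_cls !subst_cls mul_cls.
Qed.

Lemma subst_leaf v : subst (cls (Leaf v)) = Y.
Proof. by rewrite subst_cls. Qed.

Lemma subst_subst a : subst (subst a) = subst a.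
Proof.
apply: (@linear_ext k boolC (-1) _ (subst \o subst) subst) => t /=.
by rewrite !subst_cls; congr (cls _); elim: t => [v|l IHl r IHr] //=; congr Node.
Qed.

Lemma subst_parity a : subst (parity a) = parity (subst a).
Proof.
apply: (@linear_ext k boolC (-1) _ (subst \o parity) (parity \o subst)) => t /=.
by rewrite parity_cls linearZ /= subst_cls parity_cls leaves_tmap size_map.
Qed.

Lemma subst_deriv a : subst (deriv a) = deriv (subst a).
Proof.
apply: (@linear_ext k boolC (-1) _ (subst \o deriv) (deriv \o subst)) => /=.
elim=> [v|a' IHa b IHb].
  by rewrite subst_cls !deriv_cls /= cls_node subst_mul !subst_leaf mul_cls.
rewrite cls_node deriv_mul linearD /= !subst_mul deriv_mul IHa IHb.
by rewrite subst_parity.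
Qed.

Lemma subst_del a : subst (del a) = del (subst a).
Proof.
by rewrite !delE linearD /= subst_mul subst_deriv subst_parity subst_leaf.
Qed.

Lemma diff_preLie : preLie_fun (-1)
  (fun t => (del \- (left_mul (-1) (Leaf true) \o subst)) (cls t)).
Proof. exact: (preLie_fun_linear _ (@cls_preLie k boolC (-1))). Qed.
Definition diff : {linear Q -> Q} := lin_ext diff_preLie.
Lemma diffE a : diff a = del a - X ** subst a.
Proof.
rewrite (@linear_ext k boolC (-1) _ diff
  (del \- (left_mul (-1) (Leaf true) \o subst))) => [|t].
  by rewrite /= /plmul lin_extE.
exact: lin_extE.
Qed.

(** Since [subst] commutes with [del] and sends x to y, the two terms produced by
    [del (X ** subst a)] are cancelled by those of [X ** subst (diff a)]. *)
Lemma diff_diff a : diff (diff a) = 0.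
Proof.
rewrite !diffE !linearB /= del_del del_leaf_mul subst_mul subst_leaf.
rewrite subst_subst subst_del !mulE.
by lin.
Qed.

End SuperPreLie.

(** * Exactness of the part linear in [x] *)

Fixpoint lmost (A : Type) (t : btree A) : A :=
  match t with Leaf a => a | Node l _ => lmost l end.

Lemma leaves_lmost (A : Type) (t : btree A) :
  leaves t = lmost t :: behead (leaves t).
Proof. by elim: t => [a|l IHl r IHr] //=; rewrite IHl. Qed.

Section Homotopies.
Variable k : fieldType.
Notation Q := (@freeMod k boolC (-1)).
Ltac lin := change (Choice.sort boolC) with bool; lmod k (@freeMod k boolC (-1)).
Notation cls := (@cls k boolC (-1)).
Notation "a ** b" := (plmul a b) (at level 40, left associativity).
Notation X := (cls (Leaf true)).
Notation Y := (cls (Leaf false)).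
Notation sg n := ((-1 : k) ^+ n).
Notation mulE := (plmulDl, plmulDr, plmulZl, plmulZr, plmulNl, plmulNr, plmul0l, plmul0r).
Notation parity := (parity k).
Notation degree := (degree k).
Notation del := (del k).
Notation diff := (diff k).
Notation subst := (subst k).

Lemma spanned_node_mul a b : spanned_by (@is_node bool) (a ** b : Q).
Proof. by apply: (spanned_mul (P1 := predT) (P2 := predT)); last exact: spannedT; first by []; exact: spannedT. Qed.

Lemma spanned_node_del a : spanned_by (@is_node bool) (del a).
Proof.
rewrite delE; apply: spannedD; last exact: spanned_node_mul.
elim/freePL_ind: a => [|c t a IH]; first by rewrite linear0; apply: spanned0.
rewrite linearP; apply/spannedD/IH/spannedZ; rewrite deriv_cls.
case: t => [v|l r] /=; first exact: spanned_cls.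
by apply: spannedD; rewrite -?plmulZl; apply: spanned_node_mul.
Qed.

(* [y] with a single subtree [b] is contracted to [b].                        *)
Fixpoint contract_tree (t : btree bool) : Q :=
  match t with
  | Leaf _ => 0
  | Node a b =>
      match a with
      | Leaf true => 0
      | Leaf false => cls b
      | Node _ _ => contract_tree a ** cls b
      end
  end.

Lemma contract_preLie : preLie_fun (-1) contract_tree.
Proof.
apply: preLie_funP => [a b c|a n|b n].
- rewrite /assoc; case: a => [[]|a1 a2] /=; rewrite ?cls_node ?mulE ?subrr ?scaler0 //.
  by apply: mul_preLie; apply: homog_cls.
- case: a => [[]|a1 a2].
  + by exists 0, 0, 0, 0 => t _ _; rewrite /= ?mulE !scale0r !addr0.
  + by exists 1, 0, 0, 0 => t _ _; rewrite /= ?mulE !scale0r scale1r !addr0.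
  + exists 0, 0, (contract_tree (Node a1 a2)), 0 => t _ _ /=.
    by rewrite ?mulE !scale0r !addr0 add0r.
- exists 0, 0, (cls b) => -[v|t1 t2] // _ _ /=.
  by rewrite ?mulE !scale0r !addr0 add0r.
Qed.
Definition contract : {linear Q -> Q} := lin_ext contract_preLie.
Lemma contract_cls t : contract (cls t) = contract_tree t.
Proof. exact: lin_extE. Qed.

Lemma contract_X b : contract (X ** b) = 0.
Proof.
elim/freePL_ind: b => [|c t b IH]; rewrite !mulE ?linear0 //.
by rewrite linearP /= IH mul_cls contract_cls scaler0 addr0.
Qed.

Lemma contract_Y b : contract (Y ** b) = b.
Proof.
elim/freePL_ind: b => [|c t b IH]; rewrite !mulE ?linear0 //.
by rewrite linearP /= IH mul_cls contract_cls.
Qed.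

(** For composite a the contraction takes place inside a. A leaf behaves differently:
    [contract (Y ** b)] is b although [contract Y] is zero. *)
Lemma contract_mul a b : spanned_by (@is_node bool) a ->
  contract (a ** b) = contract a ** b.
Proof.
apply: (linear_ext_in (f := contract \o rmul b) (g := rmul b \o contract)).
move=> [//|l r] _ /=; rewrite /rmul -!/(plmul _ _).
elim/freePL_ind: b => [|c t b IH]; first by rewrite !mulE linear0.
by rewrite !mulE linearD linearZ /= IH mul_cls !contract_cls.
Qed.

Lemma parity_contract a : parity (contract a) = - contract (parity a).
Proof.
apply: (@linear_ext k boolC (-1) _ (parity \o contract) (\- (contract \o parity))) => /=.
elim=> [v|[[]|l r] IHa b IHb] /=; rewrite !parity_cls linearZ /= !contract_cls /=.
- by rewrite linear0 scaler0 oppr0.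
- by rewrite linear0 scaler0 oppr0.
- by rewrite parity_cls exprS; lin.
- move: IHa; rewrite parity_mul parity_cls !parity_cls linearZ /= !contract_cls => -> /=.
  by rewrite !mulE !size_cat !exprD scalerA; lin.
Qed.

Lemma lmost_plug (A : Type) c (t1 t2 : btree A) :
  lmost t1 = lmost t2 -> lmost (plug c t1) = lmost (plug c t2).
Proof. by elim: c => [|[[] s] c IH] //= /IH. Qed.

Lemma rooted_Y_preLie : preLie_fun (-1) (fun t => (~~ lmost t)%:R *: cls t).
Proof.
by apply: diagonal_preLie => c t1 t2 t3; congr (~~ _)%:R; apply: lmost_plug.
Qed.
Definition rooted_Y : {linear Q -> Q} := lin_ext rooted_Y_preLie.
Lemma rooted_Y_cls t : rooted_Y (cls t) = (~~ lmost t)%:R *: cls t.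
Proof. exact: lin_extE. Qed.

(** Induction on the left factor. At the bottom, contracting [del (Y ** b)] gives [Y ** b - del b]
    and the second term contributes [del b]; with root x everything vanishes. For a composite left
    factor both operators act compatibly with the product, and the remaining terms cancel. *)
Lemma contract_del a : spanned_by (@is_node bool) a ->
  contract (del a) + del (contract a) = rooted_Y a.
Proof.
apply: (linear_ext_in (f := (contract \o del) \+ (del \o contract)) (g := rooted_Y)).
elim=> [//|l IHl r _] _ /=.
case: l IHl => [[] _|l1 l2 IHl]; rewrite cls_node.
- rewrite del_leaf_mul linearB /= !contract_X -cls_node rooted_Y_cls /=.
  by rewrite (linear0 del) scale0r; lin.
- rewrite del_leaf_mul linearB /= !contract_Y -cls_node rooted_Y_cls /=.
  by rewrite scale1r cls_node; lin.
- have pn : spanned_by (@is_node bool) (parity (cls (Node l1 l2))).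
    by rewrite parity_cls; apply/spannedZ/spanned_cls.
  have dn := spanned_node_del (cls (Node l1 l2)).
  rewrite contract_mul; last exact: spanned_cls.
  rewrite !del_mul linearB linearD /= !contract_mul //.
  have /eqP := IHl isT; rewrite addrC eq_sym -subr_eq /= => /eqP IH.
  rewrite parity_contract !mulE; move: IH; rewrite !rooted_Y_cls /= => <-.
  by rewrite [in RHS]mul_cls rooted_Y_cls !mulE cls_node /=; lin.
Qed.

(** Relators involve composite monomials only, so the coefficient of a single leaf is well
    defined. *)
Lemma Y_coef_preLie : preLie_fun (-1) (fun t => (t == Leaf false)%:R : k^o).
Proof.
have H c (l r : btree bool) : (plug c (Node l r) == Leaf false) = false.
  by apply/eqP => E; have := plug_node c l r; rewrite E.
by move=> c t1 t2 t3; rewrite /assoc !H subrr scaler0.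
Qed.
Definition Y_coef : {linear Q -> k^o} := lin_ext Y_coef_preLie.
Lemma Y_coef_cls t : Y_coef (cls t) = (t == Leaf false)%:R.
Proof. exact: lin_extE. Qed.

(* The derivation sending [y] to a formal element [e] with [e a = 0] and      *)
(* [a e = |a| a]: it removes the leaves of the rooted trees.                  *)
Fixpoint prune_tree (t : btree bool) : Q :=
  match t with
  | Leaf _ => 0
  | Node a b => prune_tree a ** cls b +
      sg (weight a) *: (cls a ** prune_tree b
        + ((b == Leaf false)%:R * (weight a)%:R) *: cls a)
  end.

Lemma homog_prune_tree t : homog (weight t).-1 (prune_tree t).
Proof.
elim: t => [v|a IHa b IHb] /=; first exact: spanned0.
have := weight_gt0 a; have := weight_gt0 b; rewrite size_cat => b0 a0.
apply: spannedD.
  have -> : (weight a + weight b).-1 = ((weight a).-1 + weight b)%N by lia.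
  by apply: homog_mul => //; apply: homog_cls.
apply/spannedZ/spannedD.
  have -> : (weight a + weight b).-1 = (weight a + (weight b).-1)%N by lia.
  by apply: homog_mul => //; apply: homog_cls.
case: (eqVneq b (Leaf false)) => [->|_]; last by rewrite mul0r scale0r; apply: spanned0.
by rewrite addn1; apply/spannedZ/homog_cls.
Qed.

(** The formal element is compatible with the relations because right multiplication by it, the
    weight operator, is a derivation, which is the pre-Lie identity for that element. *)
Lemma prune_preLie : preLie_fun (-1) prune_tree.
Proof.
apply: preLie_funP => [a b c|a n|b n].
- have gb := weight_gt0 b; have gc := weight_gt0 c.
  rewrite /assoc /= !size_cat !cls_node !mulE.
  have := mul_preLie (prune_tree a) (homog_cls (-1) b) (homog_cls (-1) c).
  have := mul_preLie (cls a) (homog_prune_tree b) (homog_cls (-1) c).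
  have := mul_preLie (cls a) (homog_cls (-1) b) (homog_prune_tree c).
  have Eb : (-1 : k) ^+ ((weight b).-1 * weight c)
      = (-1) ^+ (weight b * weight c) * (-1) ^+ weight c.
    by rewrite -[in RHS](prednK gb) mulSn exprD mulrAC -expr2 sqrr_sign mul1r.
  have Ec : (-1 : k) ^+ (weight b * (weight c).-1)
      = (-1) ^+ (weight b * weight c) * (-1) ^+ weight b.
    by rewrite -[in RHS](prednK gc) mulnS exprD mulrAC -expr2 sqrr_sign mul1r.
  rewrite Eb Ec !exprD !natrD.
  move=> /eqP; rewrite subr_eq => /eqP -> /eqP; rewrite subr_eq => /eqP ->.
  move=> /eqP; rewrite subr_eq => /eqP ->.
  case: (eqVneq b (Leaf false)) => [->|_]; case: (eqVneq c (Leaf false)) => [->|_];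
  rewrite /= ?muln1 ?mul1n ?expr1;
  case: (sign_cases k (weight a)) => ->;
  try (case: (sign_cases k (weight b)) => ->);
  try (case: (sign_cases k (weight c)) => ->);
  try (case: (sign_cases k (weight b * weight c)) => ->);
  by lin.
- exists 0, 0, (prune_tree a), (sg (weight a) *: cls a) => t nt _ /=.
  have -> : (t == Leaf false) = false by apply/eqP => tE; rewrite tE in nt.
  by rewrite ?mulE mulr0n mul0r; lin.
- exists (sg n *: prune_tree b), (sg n * (b == Leaf false)%:R * n%:R), (cls b).
  by move=> t _ <- /=; rewrite ?mulE; lin.
Qed.
Definition prune : {linear Q -> Q} := lin_ext prune_preLie.
Lemma prune_cls t : prune (cls t) = prune_tree t.
Proof. exact: lin_extE. Qed.

Lemma prune_mul a b : prune (a ** b) =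
  prune a ** b + parity a ** prune b + Y_coef b *: parity (degree a).
Proof.
apply: (@bilinear_ext k boolC (-1) (fun a b => prune (a ** b)) (fun a b =>
  prune a ** b + parity a ** prune b + Y_coef b *: parity (degree a)))
  => [{}b|{}a|{}b|{}a|t u] /=.
1-4: by move=> z u v; rewrite !(mulE, linearD, linearZ) /=; try rewrite ?scalerDl -?scalerA; lin.
rewrite mul_cls !prune_cls parity_cls Y_coef_cls degree_cls linearZ /= parity_cls !mulE.
by lin.
Qed.

End Homotopies.

(** * The Laplacian of pruning and the exactness of the differential *)

Section Exactness.
Variable k : fieldType.
Notation Q := (@freeMod k boolC (-1)).
Ltac lin := change (Choice.sort boolC) with bool; lmod k (@freeMod k boolC (-1)).
Notation cls := (@cls k boolC (-1)).
Notation "a ** b" := (plmul a b) (at level 40, left associativity).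
Notation X := (cls (Leaf true)).
Notation Y := (cls (Leaf false)).
Notation sg n := ((-1 : k) ^+ n).
Notation mulE := (plmulDl, plmulDr, plmulZl, plmulZr, plmulNl, plmulNr, plmul0l, plmul0r).
Notation parity := (parity k).
Notation degree := (degree k).
Notation del := (del k).
Notation diff := (diff k).
Notation subst := (subst k).
Notation prune := (prune k).
Notation contract := (contract k).
Notation rooted_Y := (rooted_Y k).
Notation Y_coef := (Y_coef k).

Lemma laplacian_preLie :
  preLie_fun (-1) (fun t => ((prune \o del) \+ (del \o prune)) (cls t)).
Proof. exact: (preLie_fun_linear _ (@cls_preLie k boolC (-1))). Qed.
Definition laplacian : {linear Q -> Q} := lin_ext laplacian_preLie.
Lemma laplacianE a : laplacian a = prune (del a) + del (prune a).
Proof.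
by rewrite (@linear_ext k boolC (-1) _ laplacian ((prune \o del) \+ (del \o prune)))
  // => t; apply: lin_extE.
Qed.

Lemma parity_degree a : parity (degree a) = degree (parity a).
Proof.
apply: (@linear_ext k boolC (-1) _ (parity \o degree) (degree \o parity)) => t /=.
by rewrite degree_cls parity_cls !linearZ /= parity_cls degree_cls; lin.
Qed.

Lemma Y_coef_node a : spanned_by (@is_node bool) a -> Y_coef a = 0.
Proof.
apply: (linear_ext_in (f := Y_coef) (g := \0)) => -[v|l r] // _.
by rewrite Y_coef_cls; case: eqP.
Qed.

Lemma Y_coef_parity a : Y_coef (parity a) = - Y_coef a.
Proof.
apply: (@linear_ext k boolC (-1) _ (Y_coef \o parity) (\- Y_coef)) => t /=.
rewrite parity_cls linearZ /= Y_coef_cls.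
by case: eqP => [->|_]; rewrite ?scaler0 ?oppr0 // expr1 scaleN1r.
Qed.

Lemma parity_prune a : parity (prune a) = - prune (parity a).
Proof.
apply: (@linear_ext k boolC (-1) _ (parity \o prune) (\- (prune \o parity))) => /=.
elim=> [v|a' IHa b IHb].
  by rewrite parity_leaf linearN /= prune_cls /= (linear0 parity); lin.
rewrite cls_node parity_mul !prune_mul !linearD linearZ /= !parity_mul !parityK.
by rewrite IHa IHb -parity_degree !parityK Y_coef_parity !mulE; lin.
Qed.

Lemma degree_leaf v : degree (cls (Leaf v)) = cls (Leaf v).
Proof. by rewrite degree_cls scale1r. Qed.

Lemma degree_mul a b : degree (a ** b) = degree a ** b + a ** degree b.
Proof.
apply: (@bilinear_ext k boolC (-1) (fun a b => degree (a ** b))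
  (fun a b => degree a ** b + a ** degree b)) => [{}b|{}a|{}b|{}a|t u] /=.
1-4: by move=> z u v; rewrite !(mulE, linearD, linearZ) /=; lin.
by rewrite mul_cls !degree_cls !mulE /= size_cat natrD mul_cls scalerDl.
Qed.

Lemma degree_del a : degree (del a) = del (degree a) + del a.
Proof.
apply: (@linear_ext k boolC (-1) _ (degree \o del) (del \o degree \+ del)) => /=.
elim=> [v|a' IHa b IHb] /=.
  by rewrite degree_cls linearZ /= !del_leaf linear0; lin.
rewrite cls_node [in LHS]del_mul linearB linearD /= !degree_mul.
rewrite IHa IHb degree_leaf (linearD del) /= !del_mul -!parity_degree !mulE.
by lin.
Qed.

Lemma laplacian_leaf v : laplacian (cls (Leaf v)) = 0.
Proof. by rewrite laplacianE del_leaf prune_cls /= !linear0; lin. Qed.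

(** The commutator of two odd derivations is a derivation, up to the defects of [del] and [prune].
    When b is y, pruning the correction term of [del] leaves [a ** Y], and [del (parity a)] appears
    because [del] raises by one the weight that [prune] records. *)
Lemma laplacian_mul a b : laplacian (a ** b) =
  laplacian a ** b + a ** laplacian b + Y_coef b *: (a ** Y - del (parity a)).
Proof.
rewrite !laplacianE del_mul (linearB prune) (linearD prune) /= !prune_mul.
rewrite !(linearD del) (linearZ_LR del) /= !del_mul !parityK ?parity_del ?parity_prune ?parityK.
rewrite (Y_coef_node (spanned_node_del b)) (Y_coef_node (spanned_node_mul Y b)).
rewrite parity_leaf [prune Y]prune_cls /= degree_leaf degree_del.
rewrite !linearD /= !parity_del.
rewrite parity_leaf !mulE.
by lin.
Qed.

(** The root is never pruned, whereas an x elsewhere would become a removable y after the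
    substitution; hence x is allowed in the first position only. *)
Lemma prune_subst t : ~~ has id (behead (leaves t)) ->
  prune (subst (cls t)) = subst (prune (cls t)).
Proof.
elim: t => [v|a IHa b IHb] H.
  by rewrite subst_cls !prune_cls /= linear0.
have [Ha Hb] : ~~ has id (behead (leaves a)) /\ ~~ has id (leaves b).
  by move: H; rewrite /= leaves_lmost /= has_cat negb_or => /andP[].
have Hb' : ~~ has id (behead (leaves b)).
  by move: Hb; rewrite leaves_lmost /= negb_or => /andP[].
have bE : erase b = b.
  elim: b Hb {H IHb Hb'} => [[]|l IHl r IHr] //=; rewrite has_cat negb_or => /andP[Hl Hr].
  by rewrite /erase /tmap /= -!/(tmap _ _) -!/(erase _) IHl ?IHr.
rewrite cls_node subst_mul !prune_mul IHa // IHb // !linearD linearZ /= !subst_mul.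
rewrite !subst_parity [in Y_coef (subst _)]subst_cls bE; congr (_ + _ *: parity _).
rewrite subst_cls !degree_cls linearZ /= subst_cls.
by rewrite /erase leaves_tmap size_map.
Qed.

Lemma prune_X b : prune (X ** b) = - (X ** prune b) - Y_coef b *: X.
Proof.
rewrite prune_mul prune_cls /= degree_leaf !parity_leaf !mulE.
by lin.
Qed.

(** The two terms with [subst] cancel, since [prune] anticommutes with left multiplication by x on
    combinations of composite monomials. *)
Lemma diff_prune t : is_node t -> ~~ has id (behead (leaves t)) ->
  diff (prune (cls t)) + prune (diff (cls t)) = laplacian (cls t).
Proof.
move=> nt Ht; rewrite !diffE linearB /= prune_X prune_subst //.
rewrite Y_coef_node; last by rewrite subst_cls; apply: spanned_cls; case: t nt {Ht}.
by rewrite laplacianE; lin.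
Qed.

(** Here n counts the letters y after the first one, so the weight is n + 1. *)
Definition rooted (v : bool) (n : nat) (t : btree bool) : bool :=
  leaves t == v :: nseq n false.

Lemma rooted_node v n a b : rooted v n (Node a b) -> exists n1 n2,
  [/\ rooted v n1 a, rooted false n2 b & n = (n1 + n2).+1].
Proof.
rewrite /rooted => /eqP /= H.
exists (weight a).-1, (weight b).-1.
move: H; rewrite [leaves a]leaves_lmost [leaves b]leaves_lmost /= => -[-> H].
have Hs : n = (size (behead (leaves a)) + size (behead (leaves b))).+1.
  by have := congr1 size H; rewrite size_cat /= size_nseq => <-; rewrite addnS.
have /all_pred1P : all (pred1 false) (behead (leaves a) ++ lmost b :: behead (leaves b)).
  by rewrite H; apply/all_pred1P; rewrite size_nseq.
have : all (pred1 false) (behead (leaves a) ++ lmost b :: behead (leaves b)).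
  by rewrite H; apply/all_pred1P; rewrite size_nseq.
rewrite all_cat /= => /and3P[/all_pred1P Ha /eqP -> /all_pred1P Hb] _.
by rewrite {1}Ha {1}Hb !eqxx.
Qed.

Lemma rootedN v n1 n2 a b : rooted v n1 a -> rooted false n2 b ->
  rooted v (n1 + n2).+1 (Node a b).
Proof.
rewrite /rooted => /eqP Ha /eqP Hb /=; rewrite Ha Hb /=; apply/eqP; congr (_ :: _).
by rewrite -[RHS]/(nseq (n1 + n2).+1 false) -addnS nseqD.
Qed.

Lemma rooted_tail v n t : rooted v n t -> ~~ has id (behead (leaves t)).
Proof. by move=> /eqP ->; rewrite has_nseq andbF. Qed.

(* The number of leaves, as vertices without children, of the leading rooted  *)
(* tree of a monomial.                                                        *)
Fixpoint rank (t : btree bool) : nat :=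
  match t with
  | Leaf _ => 1
  | Node a b => if is_node a then (rank a + rank b)%N else rank b
  end.

Lemma rank_gt0 t : (0 < rank t)%N.
Proof. by elim: t => [v|a IHa b IHb] //=; case: ifP => _ //; rewrite addn_gt0 IHa. Qed.

Lemma rank_node_le a b : (rank (Node a b) <= rank a + rank b)%N.
Proof. by rewrite /=; case: ifP => _ //; apply: leq_addl. Qed.

Definition filtered v n p : Q -> Prop :=
  spanned_by (fun t => rooted v n t && (rank t <= p)%N).

Lemma filtered_cls v n t : rooted v n t -> filtered v n (rank t) (cls t).
Proof. by move=> Ht; apply: spanned_cls; rewrite Ht /=. Qed.

Lemma filtered_le v n p p' a : (p <= p')%N -> filtered v n p a -> filtered v n p' a.
Proof.
move=> le_p; apply: spanned_sub => t /andP[-> H] /=; exact: leq_trans H le_p.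
Qed.

Lemma filtered_mul v n1 n2 p1 p2 a b :
  filtered v n1 p1 a -> filtered false n2 p2 b ->
  filtered v (n1 + n2).+1 (p1 + p2) (a ** b).
Proof.
apply: spanned_mul => t u /andP[Ht pt] /andP[Hu pu].
rewrite rootedN //=; apply: leq_trans (rank_node_le t u) _; exact: leq_add.
Qed.

Lemma filtered_leaf_mul v n p b :
  filtered false n p b -> filtered v n.+1 p (cls (Leaf v) ** b).
Proof.
move=> Hb; apply: (spanned_mul (P1 := fun t => t == Leaf v)) Hb; last exact: spanned_cls.
move=> t u /eqP -> /andP[Hu pu]; rewrite /= pu andbT.
by rewrite -[n]add0n; apply: rootedN => //; apply: eqxx.
Qed.

Lemma filtered_parity v n p a : filtered v n p a -> filtered v n p (parity a).
Proof.
apply: spanned_linear => t Ht; rewrite parity_cls; exact/spannedZ/spanned_cls.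
Qed.

(** The inserted vertex y always has a child, so the number of childless vertices does not grow. *)
Lemma filtered_del v n t : rooted v n t -> filtered v n.+1 (rank t) (del (cls t)).
Proof.
elim: t v n => [u|a IHa b IHb] v n; first by rewrite del_leaf => _; apply: spanned0.
move=> /rooted_node [n1 [n2 [Ha Hb ->]]]; rewrite cls_node /=.
have Hyb : filtered false n2.+1 (rank b) (Y ** cls b).
  exact/filtered_leaf_mul/filtered_cls.
case: a IHa Ha => [u|a1 a2] IHa Ha.
  have -> : u = v by move: Ha => /eqP[].
  have -> : n1 = 0%N by move: Ha => /eqP[_]; case: n1.
  by rewrite del_leaf_mul; apply: spannedB; apply/filtered_leaf_mul => //; apply: IHb.
rewrite del_mul; set a := Node a1 a2 in IHa Ha *.
apply: spannedB; first apply: spannedD.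
- by rewrite -addSn; apply: filtered_mul; [apply: IHa | apply: filtered_cls].
- rewrite -addnS; apply: filtered_mul; last exact: IHb.
  exact/filtered_parity/filtered_cls.
- rewrite -addnS; apply: filtered_mul => //; exact/filtered_parity/filtered_cls.
Qed.

(** By [laplacian_mul] the diagonal entries add up over the factors. A factor y contributes
    [a ** Y], that is one more childless vertex, while [del (parity a)] has rank at most that of
    a. *)
Lemma laplacian_filtered v n t : rooted v n.+1 t ->
  filtered v n.+1 (rank t).-1 (laplacian (cls t) - (rank t)%:R *: cls t).
Proof.
elim: t v n => [u|a IHa b IHb] v n; first by move=> /eqP[].
move=> /rooted_node [n1 [n2 [Ha Hb [->]]]]; rewrite cls_node laplacian_mul.
(* Either b is the single vertex y and the extra term of [laplacian_mul] is present, or b is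
   composite and the induction hypothesis applies to it. *)
have yb : b = Leaf false \/ exists m, n2 = m.+1 /\ Y_coef (cls b) = 0.
  case: b Hb {IHb} => [u /eqP[-> _]|b1 b2 Hb]; [by left | right].
  have [m1 [m2 [_ _ ->]]] := rooted_node Hb.
  by exists (m1 + m2)%N; split=> //; rewrite Y_coef_node //; apply: spanned_cls.
case: a IHa Ha => [u|a1 a2] IHa Ha.
  have -> : u = v by move: Ha => /eqP[].
  have -> : n1 = 0%N by move: Ha => /eqP[_]; case: n1.
  rewrite laplacian_leaf !mulE add0r add0n /=; case: yb => [->|[m [mE ->]]].
    rewrite laplacian_leaf Y_coef_cls eqxx parity_leaf linearN /= del_leaf mulE.
    by rewrite [X in filtered _ _ _ X](_ : _ = 0); [apply: spanned0 | lin].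
  rewrite mE in Hb *; have := filtered_leaf_mul v (IHb _ _ Hb).
  by rewrite !mulE scale0r addr0.
set a := Node a1 a2 in IHa Ha *.
have [m1 m1E] : exists m1, n1 = m1.+1.
  by have [m1 [m2 [_ _ ->]]] := rooted_node Ha; exists (m1 + m2)%N.
rewrite m1E in Ha *; have {}IHa := IHa _ _ Ha.
have a0 := rank_gt0 a; have b0 := rank_gt0 b.
rewrite -[rank (Node a b)]/(rank a + rank b)%N.
case: yb => [bE|[m [mE Yb]]].
  have -> : n2 = 0%N by move: Hb; rewrite bE => /eqP[]; case: n2.
  rewrite bE laplacian_leaf Y_coef_cls eqxx !mulE addn0 [rank (Leaf false)]/= addn1 succnK.
  rewrite [X in filtered _ _ _ X](_ : _ =
    (laplacian (cls a) - (rank a)%:R *: cls a) ** Y - del (parity (cls a))).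
    apply: spannedB.
      rewrite -[m1.+1]addn0; apply: filtered_le (filtered_mul IHa (filtered_cls _)).
        by rewrite /= addn1 prednK.
      exact: eqxx.
    rewrite -[del _]opprK -parity_del; apply/spannedN/filtered_parity.
    exact: filtered_del.
  by rewrite !mulE -natr1 mulr1n; lin.
rewrite mE in Hb *; have {}IHb := IHb _ _ Hb.
rewrite [X in filtered _ _ _ X](_ : _ =
  (laplacian (cls a) - (rank a)%:R *: cls a) ** cls b +
  cls a ** (laplacian (cls b) - (rank b)%:R *: cls b)).
  apply: spannedD.
    by apply: filtered_le (filtered_mul IHa (filtered_cls Hb)); lia.
  by apply: filtered_le (filtered_mul (filtered_cls Ha) IHb); lia.
by rewrite Yb !mulE natrD; lin.
Qed.

Lemma rooted_prune v n t : rooted v n.+1 t -> spanned_by (rooted v n) (prune (cls t)).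
Proof.
elim: t v n => [u|a IHa b IHb] v n; first by move=> /eqP[].
move=> /rooted_node [n1 [n2 [Ha Hb [->]]]]; rewrite cls_node prune_mul.
have sa : spanned_by (rooted v n1) (parity (cls a)).
  by rewrite parity_cls; apply/spannedZ/spanned_cls.
apply: spannedD; first apply: spannedD.
- case: n1 Ha {sa} => [|n1] Ha.
    case: a Ha {IHa} => [u _|a1 a2 /rooted_node[? [? []]]//].
    by rewrite prune_cls mulE; apply: spanned0.
  apply: (spanned_mul (P1 := rooted v n1) (P2 := rooted false n2)).
  + by move=> t u; apply: rootedN.
  + exact: IHa.
  + exact: spanned_cls.
- case: n2 Hb => [|n2] Hb.
    case: b Hb {IHb} => [u _|b1 b2 /rooted_node[? [? []]]//].
    by rewrite prune_cls mulE; apply: spanned0.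
  rewrite addnS; apply: (spanned_mul (P1 := rooted v n1) (P2 := rooted false n2)) => //.
  + by move=> t u; apply: rootedN.
  + exact: IHb.
- rewrite Y_coef_cls; case: (eqVneq b (Leaf false)) => [bE|_]; last first.
    by rewrite scale0r; apply: spanned0.
  have -> : n2 = 0%N by move: Hb; rewrite bE => /eqP[]; case: n2.
  by rewrite addn0 degree_cls linearZ; do 2!apply: spannedZ.
Qed.

Definition one_X (n : nat) (t : btree bool) : bool :=
  (weight t == n) && (count_mem true (leaves t) == 1%N).

Lemma rooted_one_X n t : rooted true n t -> one_X n.+1 t.
Proof.
by rewrite /rooted /one_X => /eqP -> /=; rewrite size_nseq count_nseq mul0n !eqxx.
Qed.

Hypothesis char0 : [pchar k] =i pred0.

Lemma spanned_pred0 z : spanned_by (pred0 : pred (btree bool)) (z : Q) -> z = 0.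
Proof. by move: z; apply: spanned_ind. Qed.

Lemma diff_prune_rooted n z : spanned_by (rooted true n.+1) z ->
  diff (prune z) + prune (diff z) = laplacian z.
Proof.
apply: (linear_ext_in (f := (diff \o prune) \+ (prune \o diff)) (g := laplacian)).
move=> t Ht; apply: diff_prune; last exact: rooted_tail Ht.
by case: t Ht => // v /eqP[].
Qed.

(* The Laplacian is triangular for the rank filtration, with the ranks as     *)
(* diagonal entries.                                                          *)
Lemma rooted_exact p n z : filtered true n.+1 p z -> diff z = 0 ->
  exists2 z', spanned_by (rooted true n) z' & z = diff z'.
Proof.
elim: p z => [|p IH] z Hz dz.
  exists 0; rewrite ?linear0; first exact: spanned0.
  apply: spanned_pred0.
  by apply: spanned_sub Hz => t; rewrite leqNgt rank_gt0 andbF.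
have Rz : spanned_by (rooted true n.+1) z by apply: spanned_sub Hz => t /andP[].
(* The Laplacian of a cycle is a boundary. Subtracting [p.+1] times z thus leaves a cycle, of rank
   at most p by triangularity, to which the induction applies. *)
have dpz : diff (prune z) = laplacian z.
  by rewrite -(diff_prune_rooted Rz) dz linear0 addr0.
have Spz : spanned_by (rooted true n) (prune z).
  by apply: spanned_linear Rz => t; apply: rooted_prune.
have c0 : p.+1%:R != 0 :> k by move/pcharf0P: char0 => ->.
have [||z1 Sz1 z1E] := IH (laplacian z - p.+1%:R *: z).
- move: z Hz {dz Rz dpz Spz}; apply: spanned_ind => [|a t x /andP[Rt le_t] Hx].
    by rewrite linear0 scaler0 subrr; apply: spanned0.
  have -> : laplacian (a *: cls t + x) - p.+1%:R *: (a *: cls t + x)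
      = a *: (laplacian (cls t) - p.+1%:R *: cls t) + (laplacian x - p.+1%:R *: x).
    by rewrite linearD linearZ /=; lin.
  apply/spannedD/Hx/spannedZ; have := laplacian_filtered Rt.
  move: le_t; rewrite leq_eqVlt => /orP[/eqP -> //|lt_t Ht].
  have -> : laplacian (cls t) - p.+1%:R *: cls t =
      (laplacian (cls t) - (rank t)%:R *: cls t) + ((rank t)%:R - p.+1%:R) *: cls t.
    by lin.
  apply: spannedD; first by apply: filtered_le Ht; lia.
  by apply/spannedZ/spanned_cls; rewrite Rt -ltnS.
- by rewrite linearB linearZ /= -dpz diff_diff dz scaler0 subrr.
exists (p.+1%:R^-1 *: (prune z - z1)); first exact/spannedZ/spannedB.
rewrite linearZ linearB /= dpz -z1E opprB addrC subrK.
by rewrite scalerA mulVf // scale1r.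
Qed.

Lemma contract_one_X n t : one_X n t -> spanned_by (one_X n.-1) (contract (cls t)).
Proof.
rewrite contract_cls => /andP[/eqP <- /eqP Ht].
suff : spanned_by (fun u => ((weight u).+1 == weight t) &&
    (count_mem true (leaves u) == count_mem true (leaves t))) (contract_tree k t).
  by apply: spanned_sub => u /andP[/eqP <- /eqP E]; rewrite /one_X E Ht !eqxx.
elim: t {Ht} => [v|a IHa b IHb] /=; first exact: spanned0.
case: a IHa => [[]|a1 a2] IHa; first exact: spanned0.
  by apply: spanned_cls; rewrite /= ?add0n !eqxx.
apply: spanned_mul IHa (spanned_cls _ (P := pred1 b) (eqxx b)).
move=> t u /andP[/eqP Et /eqP Ct] /eqP ->.
move: (Node a1 a2) Et Ct => a Et Ct.
by rewrite /= !size_cat -Et !count_cat Ct !eqxx.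
Qed.

(** In weight at least two, z is moved by a boundary to words with root x, where [rooted_exact]
    concludes. In weights zero and one the only cycle is zero. *)
Lemma diff_exact n z : spanned_by (one_X n) z -> diff z = 0 ->
  exists2 z', spanned_by (one_X n.-1) z' & z = diff z'.
Proof.
case: n => [|[|n]] Hz dz.
- exists 0; rewrite ?linear0; first exact: spanned0.
  apply: spanned_pred0.
  by apply: spanned_sub Hz => t /andP[/eqP H]; have := weight_gt0 t; rewrite H.
- exists 0; rewrite ?linear0; first exact: spanned0.
  have [c zE] : exists c, z = c *: X.
    move: z Hz {dz}; apply: spanned_ind => [|a t _ Ht [c ->]].
      by exists 0; rewrite scale0r.
    exists (a + c); rewrite scalerDl; congr (_ *: cls _ + _).
    case: t Ht => [[] // /andP[] //|l r /andP[/eqP /= + _]]; rewrite size_cat.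
    by have := weight_gt0 l; have := weight_gt0 r; case: size => // m; case: size => // m'; rewrite addnS.
  (* The differential of x is the negative of x y, and pruning it gives x back, so the scalar c
     vanishes. *)
  have := congr1 prune dz; rewrite zE linearZ /= diffE del_leaf subst_leaf sub0r.
  rewrite linearZ linearN /= prune_X Y_coef_cls eqxx [prune Y]prune_cls /= linear0 mulE.
  by rewrite oppr0 sub0r opprK scale1r.
(* By [contract_del] this removes the terms of z with root y; the new term [X ** subst (contract z)]
   has root x. *)
pose w := z - diff (contract z).
have nz : spanned_by (@is_node bool) z.
  by apply: spanned_sub Hz => -[v /andP[/eqP]|l r].
have Cz : spanned_by (one_X n.+1) (contract z).
  by apply: spanned_linear Hz => t; apply: contract_one_X.
have wE : w = z - rooted_Y z + X ** subst (contract z).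
  rewrite /w diffE -(contract_del nz).
  have -> : contract (del z) = 0.
    have := congr1 contract dz; rewrite diffE linearB /= contract_X (linear0 contract).
    by rewrite subr0.
  by lin.
have Xw : filtered true n.+1 n.+2 w.
  suff : spanned_by (rooted true n.+1) w.
    apply: spanned_sub => t Rt; rewrite Rt /=.
    have -> : n.+2 = weight t by move/eqP: Rt => ->; rewrite /= size_nseq.
    elim: t {Rt} => [//|a IHa b IHb] /=; rewrite size_cat; case: ifP => _.
      exact: leq_add.
    exact: leq_trans IHb (leq_addl _ _).
  rewrite wE; apply: spannedD.
    move: z Hz {w dz nz Cz wE}; apply: spanned_ind => [|a t x /andP[/eqP wt /eqP ct] Hx].
      by rewrite linear0 subrr; apply: spanned0.
    have -> : a *: cls t + x - rooted_Y (a *: cls t + x)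
        = a *: (cls t - rooted_Y (cls t)) + (x - rooted_Y x).
      by rewrite linearD linearZ /=; lin.
    apply/spannedD/Hx/spannedZ; rewrite rooted_Y_cls.
    move: ct wt; rewrite /rooted [leaves t]leaves_lmost /=.
    case E: (lmost t) => /= ct wt; last by rewrite scale1r subrr; apply: spanned0.
    rewrite scale0r subr0; apply: spanned_cls.
    rewrite [leaves t]leaves_lmost E; apply/eqP; congr (_ :: _).
    have -> : behead (leaves t) = nseq (size (behead (leaves t))) false.
      apply/all_pred1P/allP => -[] //= tin.
      by move: ct => []; move/count_memPn; rewrite tin.
    by case: wt => ->.
  move: (contract z) Cz; apply: spanned_ind => [|a t x /andP[/eqP wt _] Hx].
    by rewrite linear0 mulE; apply: spanned0.
  rewrite linearP /= plmulP; apply/spannedD/Hx/spannedZ.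
  rewrite subst_cls mul_cls; apply: spanned_cls; rewrite /rooted /=.
  apply/eqP; congr (_ :: _); rewrite leaves_tmap -[RHS]/(nseq n.+1 false) -wt.
  by elim: (leaves t) => [|b s IHs] //=; rewrite IHs.
have dw : diff w = 0 by rewrite linearB /= diff_diff dz subrr.
have [z' Rz' z'E] := rooted_exact Xw dw.
exists (contract z + z').
  by apply: spannedD => //; apply: spanned_sub Rz' => t; apply: rooted_one_X.
by rewrite linearD /= -z'E addrC subrK.
Qed.

End Exactness.

(** * Signs and orientations *)

(** Adjacent transpositions connect all rearrangements of a word. *)
Lemma swap_invariant_perm (A : eqType) (T : Type) (F : seq A -> T) :
  (forall p x y q, F (p ++ x :: y :: q) = F (p ++ y :: x :: q)) ->
  forall s s', perm_eq s s' -> F s = F s'.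
Proof.
move=> FP s; elim: s F FP => [|x s IH] F FP s' ss'.
  by rewrite perm_sym in ss'; move/perm_nilP: ss' => ->.
have xs' : x \in s' by rewrite -(perm_mem ss') mem_head.
case/splitPr: xs' ss' => p q ss'.
have sE : perm_eq s (p ++ q).
  rewrite -(perm_cons x); apply: perm_trans ss' _.
  by rewrite -[x :: q]cat1s perm_catCA.
rewrite (IH (fun w => F (x :: w)) _ (p ++ q)) //; last first.
  by move=> p' y z q'; apply: (FP (x :: p')).
elim/last_ind: p q {sE ss'} => [//|p y IHp] q.
by rewrite !cat_rcons IHp FP.
Qed.

Section WordSigns.
Variable k : fieldType.

Section OneAlphabet.
Variable A : finType.

Fixpoint inversions (s : seq A) : nat :=
  if s is x :: s' then
    (count (fun y => enum_rank y < enum_rank x)%N s' + inversions s')%N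
  else 0.

(** The sign of s relative to the enumeration order of the alphabet. As in an exterior algebra, a
    repeated letter gives 0. *)
Definition wsign (s : seq A) : k :=
  if uniq s then (-1) ^+ inversions s else 0.

Lemma wsign_swap p x y q : wsign (p ++ x :: y :: q) = - wsign (p ++ y :: x :: q).
Proof.
have pE : perm_eq (p ++ x :: y :: q) (p ++ y :: x :: q).
  by rewrite perm_cat2l -[x :: y :: q]/([:: x; y] ++ q) -[y :: x :: q]/([:: y; x] ++ q)
             perm_cat2r (perm_catC [:: x]).
rewrite /wsign (perm_uniq pE); case: ifP => [U|_]; last by rewrite oppr0.
rewrite -[RHS]mulN1r -exprS -signr_odd -[RHS]signr_odd /=; congr ((-1) ^+ (nat_of_bool _)).
elim: p U {pE} => [|z p IH] /=.
  rewrite inE negb_or -andbA => /and4P[yx _ _ _].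
  have yxr : (enum_rank y == enum_rank x :> nat) = false.
    by apply/negbTE; apply: contra yx => /eqP/val_inj/enum_rank_inj ->.
  rewrite !oddD; case: ltngtP yxr => //= _ _; by case: (odd _); case: (odd _); case: (odd _).
move=> /andP[_ /IH E]; rewrite !oddD E addbN; congr (~~ (odd _ (+) _)).
by rewrite !count_cat /=; lia.
Qed.

Lemma wsign_sqr s : uniq s -> wsign s * wsign s = 1.
Proof. by rewrite /wsign => ->; rewrite -expr2 sqrr_sign. Qed.

Lemma wsign_block p b c q :
  wsign (p ++ b ++ c ++ q) = (-1) ^+ (size b * size c) * wsign (p ++ c ++ b ++ q).
Proof.
have step x p' c' q' : wsign (p' ++ x :: c' ++ q')
    = (-1) ^+ size c' * wsign (p' ++ c' ++ x :: q').
  elim: c' p' => [|y c' IH] p' /=; first by rewrite mul1r.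
  rewrite wsign_swap -cat_rcons IH cat_rcons exprS mulN1r mulNr.
  by [].
elim: b p q => [|x b IH] p q /=; first by rewrite mul1r.
by rewrite -cat_rcons IH cat_rcons step mulrA -exprD mulSn addnC.
Qed.

End OneAlphabet.

(* Alternating functions of a full word are proportional to its sign.         *)
Lemma alternating_wsign (A : finType) (f : seq A -> k) s s' :
  (forall p x y q, f (p ++ x :: y :: q) = - f (p ++ y :: x :: q)) ->
  perm_eq s s' -> f s * wsign s = f s' * wsign s'.
Proof.
move=> fP; apply: (@swap_invariant_perm _ _ (fun s => f s * wsign s)) => p x y q.
by rewrite fP wsign_swap mulrNN.
Qed.

Lemma wsign_map (A A' : finType) (f : A -> A') s : bijective f ->
  perm_eq s (enum A) ->
  wsign (map f s) = wsign (map f (enum A)) * wsign (enum A) * wsign s.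
Proof.
move=> fB sE.
have Us : uniq s by rewrite (perm_uniq sE) enum_uniq.
rewrite -(@alternating_wsign _ (fun s => wsign (map f s)) s) //.
  by rewrite -mulrA wsign_sqr // mulr1.
by move=> p x y q; rewrite !map_cat /= wsign_swap.
Qed.

End WordSigns.

Lemma weight_vertices (A : Type) (t : btree A) : weight t = (vertices t).+1.
Proof. by elim: t => [a|l IHl r IHr] //=; rewrite size_cat IHl IHr addSn addnS. Qed.

Lemma vertices_tmap (A B : Type) (f : A -> B) t : vertices (tmap f t) = vertices t.
Proof. by elim: t => [a|l IHl r IHr] //=; rewrite IHl IHr. Qed.

Lemma tmap_comp (A B C : Type) (g : B -> C) (f : A -> B) t :
  tmap g (tmap f t) = tmap (g \o f) t.
Proof. by elim: t => [a|l IHl r IHr] //=; congr Node. Qed.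

Lemma eq_tmap (A B : Type) (f g : A -> B) : f =1 g -> tmap f =1 tmap g.
Proof. by move=> fg; elim=> [a|l IHl r IHr] /=; [rewrite /tmap /= fg | congr Node]. Qed.

Lemma tmap_id (A : Type) (f : A -> A) t : f =1 id -> tmap f t = t.
Proof. by move=> fid; elim: t => [a|l IHl r IHr] /=; [rewrite /tmap /= fid | congr Node]. Qed.

Lemma lmost_tmap (A B : Type) (f : A -> B) t : lmost (tmap f t) = f (lmost t).
Proof. by elim: t => [a|l IHl r IHr]. Qed.

Lemma lmost_in (A : eqType) (t : btree A) : lmost t \in leaves t.
Proof. by rewrite leaves_lmost mem_head. Qed.

Lemma labelled_perm (A : finType) (t : btree A) :
  labelled t = perm_eq (leaves t) (enum A).
Proof.
apply/andP/idP => [[U /forallP H]|P].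
  by apply: uniq_perm => // [|x]; rewrite ?enum_uniq // H mem_enum.
split; first by rewrite (perm_uniq P) enum_uniq.
by apply/forallP => a; rewrite (perm_mem P) mem_enum.
Qed.

Definition outer {A : finType} (B : {set A}) : finType := {x : A | x \notin B}.

Section Orientation.
Variable k : fieldType.

(* The sign comparing the depth-first order of the vertices of a tree with    *)
(* the order of its leaves other than the leftmost one, a vertex [Node l r]   *)
(* corresponding to the leftmost leaf of [r].                                 *)
Fixpoint shape_sign (A : Type) (t : btree A) : k :=
  match t with
  | Leaf _ => 1
  | Node l r => (-1) ^+ vertices l * shape_sign l * shape_sign r
  end.

Lemma shape_sign_tmap (A B : Type) (f : A -> B) t : shape_sign (tmap f t) = shape_sign t.
Proof. by elim: t => [a|l IHl r IHr] //=; rewrite -!/(tmap f _) IHl IHr vertices_tmap. Qed.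

Lemma shape_sign_sqr (A : Type) (t : btree A) : shape_sign t * shape_sign t = 1.
Proof.
elim: t => [a|l IHl r IHr] /=; first by rewrite mulr1.
case: (sign_cases k (vertices l)) => ->; rewrite ?(mulN1r, mul1r) ?mulNr ?mulrN ?opprK;
by rewrite mulrACA IHl IHr mulr1.
Qed.

End Orientation.

(** The first factor passes from the depth-first order of the vertices to the order of the leaves,
    the second from the word of leaves to the fixed order of the labels. The product is the sign of
    t in [omega]. *)
HB.lock Definition orient (k : fieldType) (A : finType) (t : btree A) : k :=
  shape_sign k t * wsign k (leaves t).

(* The comparison of the orders of [A], of [B] and of its complement.         *)
HB.lock Definition shuffle_sign (k : fieldType) (A : finType) (B : {set A}) : k :=
  let s := enum (outer B) in
  let v := enum (upper B) in
  wsign k (map val v ++ map val s) * wsign k ((None : lower B) :: map Some s)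
  * wsign k v.

Section Orientation.
Variable k : fieldType.
Notation orient := (orient k).
Notation shape_sign := (shape_sign k).

Lemma orient_sqr (A : finType) (t : ltree A) : orient t * orient t = 1.
Proof.
have /andP[U _] := ltreeP t.
by rewrite orient.unlock mulrACA shape_sign_sqr wsign_sqr ?mulr1.
Qed.

Section Graft.
Variables (A : finType) (B : {set A}).
Notation shuffle_sign := (shuffle_sign k B).
Implicit Types (r : btree (lower B)) (u : btree (upper B)).

Lemma graft_no_hole r u : None \notin leaves r -> exists p : seq (outer B),
  [/\ leaves r = map Some p, leaves (graft r u) = map val p,
      shape_sign (graft r u) = shape_sign r & vertices (graft r u) = vertices r].
Proof.
elim: r => [[x|]|l IHl r IHr] //=.
  by move=> _; exists [:: x].
rewrite mem_cat negb_or => /andP[/IHl [p [-> El Sl Vl]] /IHr [q [-> Er Sr Vr]]].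
exists (p ++ q); rewrite !map_cat -!/(graft _ _).
by rewrite -El -Er Sl Sr Vl Vr.
Qed.

(** The sign identity compares two ways of moving u to the end: its vertices past the vertices of r
    that follow the hole, and the corresponding leaves past the leaves of r to the right of the
    hole. *)
Lemma graft_hole r u : uniq (leaves r) -> None \in leaves r ->
  exists p q : seq (outer B),
  [/\ leaves r = map Some p ++ None :: map Some q,
      leaves (graft r u) = map val p ++ map val (leaves u) ++ map val q,
      shape_sign (graft r u) * (-1) ^+ (after_hole r * vertices u)
        = shape_sign r * shape_sign u * (-1) ^+ (size q * vertices u)
    & vertices (graft r u) = (vertices r + vertices u)%N].
Proof.
elim: r => [[x|]|l IHl r IHr] //=.
  move=> _ _; exists [::], [::]; split=> //=; rewrite ?leaves_tmap ?cats0 //.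
    by rewrite shape_sign_tmap mul1r.
  by rewrite vertices_tmap.
rewrite cat_uniq => /and3P[Ul /hasPn lr Ur]; rewrite mem_cat.
rewrite -!/(graft _ _); case: ifP => [Nl _|Nl /= Nr].
  have Nr : None \notin leaves r by apply/negP => /lr; rewrite /= Nl.
  have [p [q [El Gl Sl Vl]]] := IHl Ul Nl.
  have [q' [Er Gr Sr Vr]] := graft_no_hole u Nr.
  exists p, (q ++ q'); rewrite El Er Gl Gr Sr Vl Vr; split; try by rewrite !map_cat -!catA.
    have wr : size q' = (vertices r).+1 by rewrite -weight_vertices Er size_map.
    rewrite size_cat wr !mulnDl mulSn !exprD.
    transitivity ((-1) ^+ vertices l * (-1) ^+ vertices u *
      (shape_sign (graft l u) * (-1) ^+ (after_hole l * vertices u)) *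
      shape_sign r * (-1) ^+ (vertices r * vertices u)); first by ring.
    rewrite Sl.
    by ring.
  by rewrite addSn addnAC.
have {}Nl : None \notin leaves l by rewrite Nl.
have [p [q [Er Gr Sr Vr]]] := IHr Ur Nr.
have [p' [El Gl Sl Vl]] := graft_no_hole u Nl.
exists (p' ++ p), q; rewrite El Er Gl Gr Sl Vl Vr; split; try by rewrite !map_cat -!catA.
  by rewrite -!mulrA Sr; ring.
by rewrite addSn addnA.
Qed.

Lemma uniq_lower_word (s : seq (outer B)) :
  uniq s -> uniq ((None : lower B) :: map Some s).
Proof.
move=> Us; rewrite /= map_inj_uniq ?Us ?andbT; last by move=> ? ? [].
by apply/mapP => -[].
Qed.

(** After the blocks are moved to the front, both sides alternate in the letters of v and in those
    of the complement, so their ratio depends on B only. *)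
Lemma wsign_shuffle (p q : seq (outer B)) (v : seq (upper B)) :
  perm_eq v (enum (upper B)) -> perm_eq (p ++ q) (enum (outer B)) ->
  wsign k (map val p ++ map val v ++ map val q) =
  shuffle_sign * (-1) ^+ (size p * (size v).+1)
  * wsign k (map Some p ++ (None : lower B) :: map Some q) * wsign k v.
Proof.
move=> vE pqE.
have := wsign_block k [::] (map val p) (map val v) (map val q); rewrite !cat0s => ->.
have := wsign_block k [::] (map Some p) [:: None : lower B] (map Some q).
rewrite !cat0s => ->; rewrite -!map_cat !size_map /= muln1.
have Us : uniq (p ++ q) by rewrite (perm_uniq pqE) enum_uniq.
have Uv : uniq v by rewrite (perm_uniq vE) enum_uniq.
set s := p ++ q in pqE Us *.
pose F (v : seq (upper B)) (s : seq (outer B)) := wsign k (map val v ++ map val s)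
  * wsign k ((None : lower B) :: map Some s) * wsign k v.
have Fv s' p1 x y q1 : F (p1 ++ x :: y :: q1) s' = F (p1 ++ y :: x :: q1) s'.
  rewrite /F !map_cat /= -!catA /= wsign_swap [X in _ * X]wsign_swap.
  by rewrite mulNr mulrNN.
have Fs v' p1 x y q1 : F v' (p1 ++ x :: y :: q1) = F v' (p1 ++ y :: x :: q1).
  rewrite /F !map_cat /= catA wsign_swap -catA.
  by rewrite -cat_cons wsign_swap mulrNN.
(* The product [F] is invariant under swaps in either word, so it may be evaluated on the
   enumerations. *)
have -> : shuffle_sign = F v s.
  rewrite shuffle_sign.unlock -[LHS]/(F (enum (upper B)) (enum (outer B))).
  rewrite -(swap_invariant_perm (F := F^~ _) (Fv _) vE).
  by rewrite -(swap_invariant_perm (Fs v) pqE).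
rewrite /F.
rewrite mulnS exprD.
have := wsign_sqr k Uv; have := wsign_sqr k (uniq_lower_word Us).
set a := wsign k _; set b := wsign k v; set c := wsign k _ => aa bb.
have pp : (-1) ^+ size p * (-1) ^+ size p = 1 :> k by rewrite -expr2 sqrr_sign.
transitivity ((-1) ^+ (size p * size v) * c * ((-1) ^+ size p * (-1) ^+ size p) * (a * a) * (b * b)).
  by rewrite pp aa bb !mulr1.
by ring.
Qed.

Lemma leaves_lower (r : ltree (lower B)) : None \in leaves r.
Proof. by have /andP[_ /forallP] := ltreeP r. Qed.

Lemma perm_outer (r : ltree (lower B)) (p q : seq (outer B)) :
  leaves r = map Some p ++ None :: map Some q -> perm_eq (p ++ q) (enum (outer B)).
Proof.
move=> Er; have /andP[Ur /forallP Ar] := ltreeP r; apply: uniq_perm; rewrite ?enum_uniq //.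
  have : uniq (map (@Some (outer B)) (p ++ q)).
    apply: subseq_uniq Ur; rewrite Er map_cat; apply: cat_subseq => //.
    exact: subseq_cons.
  by rewrite map_inj_uniq // => x y [].
move=> x; rewrite mem_enum inE; have := Ar (Some x).
by rewrite Er !mem_cat inE /= -!/(mem _) !mem_map //; move=> ? ? [].
Qed.

Lemma vertices_upper (u : ltree (upper B)) : (vertices u).+1 = #|B|.
Proof.
have := ltreeP u; rewrite labelled_perm => /perm_size; rewrite weight_vertices -cardE => ->.
by rewrite card_sig; apply: eq_card => x; rewrite inE.
Qed.

Lemma vertices_lower (r : ltree (lower B)) : vertices r = (#|A| - #|B|)%N.
Proof.
have := ltreeP r; rewrite labelled_perm => /perm_size; rewrite weight_vertices -cardE.
rewrite card_option => -[->]; rewrite card_sig.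
by rewrite -(cardC (mem B)) addKn; apply: eq_card => x; rewrite !inE.
Qed.

(** The left side carries the Koszul sign of [fdec]. On the right, apart from the orientations of r
    and u, only quantities determined by B remain, as the numbers of vertices are fixed by the
    cardinals of A and B. This makes the oriented sums closed under decomposition. *)
Lemma orient_graft (r : ltree (lower B)) (u : ltree (upper B)) :
  (-1) ^+ (after_hole r * vertices u) * orient (graft r u) =
  shuffle_sign * (-1) ^+ (vertices r * vertices u) * orient r * orient u.
Proof.
have /andP[Ur _] := ltreeP r; have := ltreeP r; have := ltreeP u.
rewrite !labelled_perm => Pu Pr.
have [p [q [Er Eg Es _]]] := graft_hole u Ur (leaves_lower r).
have vr : vertices r = (size p + size q)%N.
  have := weight_vertices r; rewrite Er size_cat /= !size_map addnS => -[->] //.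
have Ppq := perm_outer Er.
rewrite orient.unlock Eg Er wsign_shuffle // weight_vertices vr.
rewrite !mulnS !mulnDl !exprD [(-1) ^+ size p * (_ * _)]mulrA -expr2 sqrr_sign mul1r.
set w := wsign _ _; set w' := wsign _ _.
transitivity (shuffle_sign * (-1) ^+ (size p * vertices u) * w * w' *
  (shape_sign (graft r u) * (-1) ^+ (after_hole r * vertices u))); first by ring.
by rewrite Es; ring.
Qed.

Lemma lmost_graft (r : btree (lower B)) (u : btree (upper B)) : lmost (graft r u) =
  if lmost r is Some x then val x else val (lmost u).
Proof. by elim: r => [[x|]|l IHl r IHr] //=; rewrite -/(tmap val u) lmost_tmap. Qed.

End Graft.
End Orientation.

(** * The Koszul dual cooperad *)

Lemma scale_regularE (k : fieldType) (a b : k) : a *: (b : k^o) = a * b :> k.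
Proof. by []. Qed.

Section Spans.
Variable k : fieldType.

Lemma span_ind (V : vectType k) (S : seq V) (Q : V -> Prop) : Q 0 ->
  (forall a v w, v \in S -> Q w -> Q (a *: v + w)) ->
  forall x, x \in <<S>>%VS -> Q x.
Proof.
move=> Q0 QD x xS; rewrite (coord_span (X := in_tuple S) xS).
elim/big_rec: _ => [//|i w _ Qw]; apply: QD => //; exact: mem_nth.
Qed.

Lemma vspace_ind (V : vectType k) (U : {vspace V}) (Q : V -> Prop) : Q 0 ->
  (forall a v w, v \in vbasis U -> Q w -> Q (a *: v + w)) ->
  forall x, x \in U -> Q x.
Proof. by move=> Q0 QD x; rewrite -(span_basis (vbasisP U)); apply: span_ind. Qed.

Section Tensors.
Variables (I J : finType) (U : {vspace {ffun I -> k^o}}) (V : {vspace {ffun J -> k^o}}).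

Lemma tensor_slice_l x j : x \in tensorv U V -> [ffun i => x (i, j)] \in U.
Proof.
move: x; apply: span_ind => [|a v w /allpairsP[[u u'] [/= uU uV ->]] wU].
  rewrite (_ : [ffun _ => _] = 0) ?mem0v //; apply/ffunP => i; rewrite !ffunE //.
rewrite (_ : [ffun _ => _] = (a * u' j) *: u + [ffun i => w (i, j)]).
  by rewrite memvD // memvZ // vbasis_mem.
by apply/ffunP => i; rewrite !ffunE /= !scale_regularE mulrAC mulrA.
Qed.

Lemma tensor_slice_r x i : x \in tensorv U V -> [ffun j => x (i, j)] \in V.
Proof.
move: x; apply: span_ind => [|a v w /allpairsP[[u u'] [/= uU uV ->]] wU].
  rewrite (_ : [ffun _ => _] = 0) ?mem0v //; apply/ffunP => j; rewrite !ffunE //.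
rewrite (_ : [ffun _ => _] = (a * u i) *: u' + [ffun j => w (i, j)]).
  by rewrite memvD // memvZ // vbasis_mem.
by apply/ffunP => j; rewrite !ffunE /= !scale_regularE mulrA.
Qed.

Lemma tensor_mem u v : u \in U -> v \in V -> tensor u v \in tensorv U V.
Proof.
move=> uU vV; move: u uU; apply: vspace_ind => [|a u u' uU IH].
  by rewrite (_ : tensor _ _ = 0) ?mem0v //; apply/ffunP => p; rewrite !ffunE mul0r.
rewrite (_ : tensor _ _ = a *: tensor u v + tensor u' v).
  apply: rpredD IH; apply: rpredZ; move: v vV; apply: vspace_ind => [|b v v' vV IH].
    by rewrite (_ : tensor _ _ = 0) ?mem0v //; apply/ffunP => p; rewrite !ffunE mulr0.
  rewrite (_ : tensor _ _ = b *: tensor u v + tensor u v').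
    by apply: rpredD IH; apply/rpredZ/memv_span/allpairsP; exists (u, v).
  by apply/ffunP => p; rewrite !ffunE !scale_regularE mulrDr mulrCA.
by apply/ffunP => p; rewrite !ffunE !scale_regularE mulrDl mulrA.
Qed.

End Tensors.
End Spans.

Lemma tmap_inj (A B : Type) (f : A -> B) : injective f -> injective (tmap f).
Proof.
move=> fI; elim=> [a|l IHl r IHr] [b|l' r'] //=; first by case=> /fI ->.
by case=> /IHl -> /IHr ->.
Qed.

Lemma labelled_tmap (A A' : finType) (f : A -> A') (t : btree A) :
  bijective f -> labelled t -> labelled (tmap f t).
Proof.
move=> [g fK gK] /andP[U /forallP H]; apply/andP; rewrite leaves_tmap.
split; first by rewrite map_inj_uniq //; apply: can_inj fK.
by apply/forallP => a; apply/mapP; exists (g a); rewrite ?gK.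
Qed.

Definition lmap (A A' : finType) (f : A -> A') (fB : bijective f) (t : ltree A) :
  ltree A' := LTree (labelled_tmap fB (ltreeP t)).

Section Relabel.
Variable k : fieldType.

Lemma tvecE (A : finType) (t s : ltree A) : tvec k t s = (s == t)%:R.
Proof. by rewrite ffunE. Qed.

Lemma freeS_sum (A : finType) (x : freeS k A) : x = \sum_t x t *: tvec k t.
Proof.
apply/ffunP => s; rewrite sum_ffunE (bigD1 s) //= big1 ?addr0.
  by rewrite ffunE tvecE eqxx scale_regularE mulr1.
move=> t ts; rewrite ffunE tvecE eq_sym (negbTE ts) scale_regularE mulr0 //.
Qed.

Lemma relabel_linear (A A' : finType) (f : A -> A') : linear (@relabel k A A' f).
Proof.
move=> a x y; rewrite /relabel scaler_sumr -big_split /=; apply: eq_bigr => t _.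
by rewrite !ffunE scalerDl scalerA.
Qed.

Lemma relabel_tvec (A A' : finType) (f : A -> A') (t : ltree A) :
  relabel f (tvec k t) = tvec k (tmap f t).
Proof.
rewrite /relabel (bigD1 t) //= big1 ?addr0 ?tvecE ?eqxx ?scale1r // => s st.
by rewrite tvecE (negbTE st) scale0r.
Qed.

Lemma relabelE (A A' : finType) (f : A -> A') (fB : bijective f) (x : freeS k A) t :
  relabel f x (lmap fB t) = x t.
Proof.
rewrite /relabel sum_ffunE (bigD1 t) //= big1 ?addr0.
  by rewrite !ffunE /= eqxx scale_regularE mulr1.
move=> s st; rewrite !ffunE /= (inj_eq (tmap_inj (bij_inj fB))).
by rewrite -[tree_of t == s]/(t == s) eq_sym (negbTE st) scaler0.
Qed.

Lemma lmap_surj (A A' : finType) (f : A -> A') (fB : bijective f) (s : ltree A') :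
  exists t, s = lmap fB t.
Proof.
have [g fK gK] := fB; have gB : bijective g by exists f.
exists (lmap gB s); apply: val_inj => /=.
by rewrite tmap_comp tmap_id.
Qed.

End Relabel.

Section Omega.
Variable k : fieldType.

(* The generators of the Koszul dual cooperad, dual to the basis of the       *)
(* operad Perm.                                                               *)
Definition omega (A : finType) (a : A) : freeS k A :=
  [ffun t : ltree A => if lmost t == a then orient k t else 0].

Definition omega_span (A : finType) : {vspace freeS k A} :=
  <<[seq omega a | a <- enum A]>>%VS.

Lemma omega_mem (A : finType) (a : A) : omega a \in omega_span A.
Proof. by apply/memv_span/map_f; rewrite mem_enum. Qed.

Lemma omega_spanP (A : finType) (x : freeS k A) : x \in omega_span A <->
  exists c : A -> k, forall t, x t = c (lmost t) * orient k t :> k.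
Proof.
split.
  move: x; apply: span_ind => [|a v w /mapP[b _ ->] [c wE]].
    by exists (fun _ => 0) => t; rewrite ffunE mul0r.
  exists (fun i => a * (i == b)%:R + c i) => t; rewrite !ffunE wE mulrDl.
  by congr (_ + _); rewrite scale_regularE; case: eqP; rewrite ?mulr1 // !mulr0 mul0r.
move=> [c xE]; have -> : x = \sum_a c a *: omega a.
  apply/ffunP => t; rewrite sum_ffunE (bigD1 (lmost t)) //= big1 ?addr0.
    by rewrite !ffunE eqxx xE.
  by move=> a at_; rewrite !ffunE eq_sym (negbTE at_) scaler0.
by apply: rpred_sum => a _; apply/rpredZ/omega_mem.
Qed.

Lemma omega_span_eq (A : finType) (x : freeS k A) : x \in omega_span A ->
  forall t t' : ltree A, lmost t = lmost t' ->
  @GRing.mul k (x t) (orient k t) = @GRing.mul k (x t') (orient k t').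
Proof.
by move=> /omega_spanP[c xE] t t' E; rewrite !xE -!mulrA !orient_sqr E.
Qed.

Lemma orient_tmap (A A' : finType) (f : A -> A') : bijective f ->
  exists2 c : k, c * c = 1 & forall t : ltree A, orient k (tmap f t) = c * orient k t.
Proof.
move=> fB; exists (wsign k (map f (enum A)) * wsign k (enum A)).
  have U : uniq (map f (enum A)) by rewrite map_inj_uniq ?enum_uniq //; apply: bij_inj.
  by rewrite mulrACA !wsign_sqr ?mulr1 ?enum_uniq.
move=> t; rewrite orient.unlock shape_sign_tmap leaves_tmap (wsign_map _ fB); first by ring.
by have := ltreeP t; rewrite labelled_perm.
Qed.

Lemma relabel_omega (A A' : finType) (f : A -> A') a : bijective f ->
  forall c : k, (forall t : ltree A, orient k (tmap f t) = c * orient k t) ->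
  c *: relabel f (omega a) = omega (f a).
Proof.
move=> fB c cE; apply/ffunP => s; have [t ->] := lmap_surj fB s.
rewrite ffunE relabelE !ffunE /= lmost_tmap (inj_eq (bij_inj fB)) cE.
by case: ifP; rewrite ?scaler0.
Qed.

Lemma omega_relabel_stable : relabel_stable omega_span.
Proof.
move=> A A' f fB x; have [c cc cE] := orient_tmap fB.
move: x; apply: span_ind => [|a v w /mapP[b _ ->] wW].
  by rewrite /relabel big1 ?mem0v // => t _; rewrite ffunE scale0r.
rewrite relabel_linear; apply: rpredD => //; apply: rpredZ.
have -> : relabel f (omega b) = c *: omega (f b).
  by rewrite -(relabel_omega b fB cE) scalerA cc scale1r.
exact/rpredZ/omega_mem.
Qed.

Lemma fdecE (A : finType) (B : {set A}) (x : freeS k A) (r : ltree (lower B))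
    (u : ltree (upper B)) :
  fdec B x (r, u) = @GRing.mul k ((-1) ^+ (after_hole r * vertices u)) (x (lgraft r u)).
Proof. by rewrite ffunE. Qed.

(** Coefficients multiplied by orientations are preserved by the decomposition along B up to one
    common sign, so equalities between them can be checked on the factors. *)
Lemma fdec_orient (A : finType) (B : {set A}) (x : freeS k A) (r : ltree (lower B))
    (u : ltree (upper B)) :
  @GRing.mul k (x (lgraft r u)) (orient k (lgraft r u)) =
  shuffle_sign k B * (-1) ^+ ((#|A| - #|B|) * #|B|.-1) *
  (@GRing.mul k (@GRing.mul k (fdec B x (r, u)) (orient k r)) (orient k u)).
Proof.
rewrite fdecE -(vertices_lower r) -(vertices_upper u) succnK.
have := orient_graft k r u.
have : (-1) ^+ (after_hole r * vertices u) * (-1) ^+ (after_hole r * vertices u) = 1 :> k.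
  by rewrite -expr2 sqrr_sign.
rewrite [lgraft r u]lock; set s := (-1) ^+ _; set y := x _ : k => ss E.
transitivity (y * s * (s * orient k (graft r u))).
  by rewrite mulrA -[y * s * s]mulrA ss mulr1 -lock.
by rewrite E; ring.
Qed.

Lemma fdec_omega (A : finType) (B : {set A}) (a : A) r u :
  fdec B (omega a) (r, u) = shuffle_sign k B * (-1) ^+ ((#|A| - #|B|) * #|B|.-1) *
    (if lmost (graft r u) == a then orient k r * orient k u else 0) :> k.
Proof.
rewrite fdecE ffunE /=; case: ifP => _; last by rewrite !mulr0.
rewrite orient_graft -(vertices_lower r) -(vertices_upper u) succnK.
by rewrite !mulrA.
Qed.

(** The leftmost leaf of a graft is that of r, unless the latter is the hole, in which case it is
    that of u. This is dual to the composition of the operad Perm. *)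
Lemma omega_subcooperad : subcooperad omega_span.
Proof.
split=> [|A B x]; first exact: omega_relabel_stable.
move: x; apply: span_ind => [|c v w /mapP[a _ ->] wW].
  by rewrite (_ : fdec _ _ = 0) ?mem0v //; apply/ffunP => p; rewrite !ffunE mulr0.
rewrite (_ : fdec _ _ = c *: fdec B (omega a) + fdec B w); last first.
  by apply/ffunP => p; rewrite !ffunE !scale_regularE mulrDr; congr (_ + _); ring.
apply: rpredD wW; apply: rpredZ; set e := shuffle_sign k B * (-1) ^+ ((#|A| - #|B|) * #|B|.-1).
(* If a lies in B, the hole must be leftmost in r and a leftmost in u. Otherwise a is leftmost in r
   and the leftmost leaf of u is free, which gives the sum over all labels of B. *)
have [aB|aB] := boolP (a \in B).
  rewrite (_ : fdec _ _ = e *: tensor (omega None) (omega (Sub a aB))).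
    by apply/rpredZ/tensor_mem; apply: omega_mem.
  apply/ffunP => -[r u]; rewrite fdec_omega !ffunE scale_regularE; congr (_ * _).
  rewrite lmost_graft /=; case: (lmost r) => [x|] /=.
    have xB : val x \notin B := valP x.
    by rewrite mul0r; case: eqP => // xa; move: xB; rewrite /= xa aB.
  by rewrite -[X in X == _]/(val (lmost u)) -(inj_eq val_inj) SubK; case: ifP; rewrite ?mulr0.
rewrite (_ : fdec _ _ = e *: \sum_(c : upper B) tensor (omega (Some (Sub a aB))) (omega c)).
  by apply/rpredZ/rpred_sum => b _; apply: tensor_mem; apply: omega_mem.
apply/ffunP => -[r u]; rewrite fdec_omega !ffunE scale_regularE; congr (_ * _).
rewrite sum_ffunE (bigD1 (lmost u)) //= big1 ?addr0; last first.
  by move=> b bu; rewrite !ffunE /= [lmost u == b]eq_sym (negbTE bu) mulr0.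
rewrite !ffunE /= eqxx lmost_graft; case: (lmost r) => [x|] /=.
  have -> : (Some x == Some (Sub a aB)) = (val x == a).
    by rewrite -[LHS]/(x == Sub a aB) -val_eqE SubK.
  by case: ifP; rewrite ?mul0r.
have uB : val (lmost u) \in B := valP (lmost u).
by rewrite mul0r; case: eqP => // ua; move: uB; rewrite /= ua (negbTE aB).
Qed.

End Omega.

(** * Normal forms of trees under rebracketing *)

Section Combs.
Variables (A : eqType) (T : Type).

Definition comb (t : btree A) (s : seq A) : btree A :=
  foldl (fun t b => Node t (Leaf b)) t s.

Lemma comb_plug s : exists c, forall t, comb t s = plug c t.
Proof.
elim: s => [|b s [c IH]]; first by exists [::].
by exists (rcons c (false, Leaf b)) => t; rewrite /= IH -cats1 plug_cat.
Qed.

Variable f : btree A -> T.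
Hypothesis frot : forall c t1 t2 t3,
  f (plug c (Node (Node t1 t2) t3)) = f (plug c (Node t1 (Node t2 t3))).
Hypothesis fswap : forall c t1 t2 t3,
  f (plug c (Node (Node t1 t2) t3)) = f (plug c (Node (Node t1 t3) t2)).

Lemma plug_node_comb c t b s : f (plug c (Node t (comb (Leaf b) s))) = f (plug c (comb t (b :: s))).
Proof.
elim/last_ind: s c => [//|s z IH] c.
rewrite -rcons_cons /comb !foldl_rcons -frot -/(comb _ _).
have := IH (rcons c (false, Leaf z)).
by rewrite -cats1 !plug_cat.
Qed.

(** Rotations alone turn a tree into the left comb on the same word of leaves. *)
Lemma plug_comb c t : f (plug c t) = f (plug c (comb (Leaf (lmost t)) (behead (leaves t)))).
Proof.
elim: t c => [//|l IHl r IHr] c.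
have := IHl (rcons c (false, r)); rewrite -cats1 !plug_cat /= => ->.
set l' := comb _ _.
have := IHr (rcons c (true, l')); rewrite -cats1 !plug_cat /= => ->.
rewrite plug_node_comb /l' /comb -foldl_cat; congr (f (plug c (foldl _ _ _))).
by rewrite [leaves l]leaves_lmost [leaves r]leaves_lmost.
Qed.

(** Once both trees are left combs, swaps permute all leaves but the first arbitrarily. *)
Lemma lmost_determines t t' : lmost t = lmost t' -> perm_eq (leaves t) (leaves t') ->
  f t = f t'.
Proof.
move=> E P; rewrite -[t]/(plug [::] t) -[t']/(plug [::] t').
rewrite plug_comb [RHS]plug_comb E /=.
apply: (swap_invariant_perm (F := fun s => f (comb (Leaf (lmost t')) s))).
  move=> p x y q; rewrite /comb !foldl_cat /= -!/(comb _ _).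
  by have [c cE] := comb_plug q; rewrite !cE; apply: fswap.
by move: P; rewrite [leaves t]leaves_lmost [leaves t']leaves_lmost E perm_cons.
Qed.

End Combs.

Lemma tree_lift (A A' : eqType) (g : A' -> A) (t : btree A) :
  (forall a, a \in leaves t -> exists a', g a' = a) -> exists t', tmap g t' = t.
Proof.
elim: t => [a|l IHl r IHr] H.
  by have [|a' <-] := H a; rewrite ?mem_head //; exists (Leaf a').
have [|l' <-] := IHl; first by move=> a al; apply: H; rewrite mem_cat al.
have [|r' <-] := IHr; first by move=> a ar; apply: H; rewrite mem_cat ar orbT.
by exists (Node l' r').
Qed.

Definition map_context (A B : Type) (f : A -> B) (c : context A) : context B :=
  [seq (p.1, tmap f p.2) | p <- c].

Lemma leaves_plug_map (A : eqType) (c : context A) : exists p q : seq A,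
  [/\ forall t, leaves (plug c t) = p ++ leaves t ++ q,
      forall (B : Type) (f : A -> B) t,
        leaves (plug (map_context f c) t) = map f p ++ leaves t ++ map f q
    & forall x, x \in c -> {subset leaves x.2 <= p ++ q}].
Proof.
elim: c => [|[b s] c [p [q [IH1 IH2 IH3]]]] /=.
  by exists [::], [::]; split=> // [t|B f t]; rewrite /= cats0.
exists (if b then leaves s ++ p else p), (if b then q else q ++ leaves s).
case: b; split=> [t|B f t|x]; rewrite /= -?/(map_context f c) ?IH1 ?IH2 ?leaves_tmap ?map_cat ?catA //.
- rewrite inE => /orP[/eqP -> a /= H|xc a /(IH3 _ xc)]; first by rewrite !mem_cat H.
  by rewrite !mem_cat => /orP[] ->; rewrite ?orbT.
- rewrite inE => /orP[/eqP -> a /= H|xc a /(IH3 _ xc)]; first by rewrite !mem_cat H !orbT.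
  by rewrite !mem_cat => /orP[] ->; rewrite ?orbT.
Qed.

(** * Subtrees of a labelled tree as graftings *)

Section Splitting.
Variables (A : finType) (B : {set A}).

(** The root factor obtained by collapsing the hole of c to one label. A label of c in B would also
    become [None], so the intended contexts avoid B. *)
Definition hole_context (c : context A) : btree (lower B) :=
  plug (map_context insub c) (Leaf None).

Lemma fill_insub (u : btree (upper B)) t : {in leaves t, forall a, a \notin B} ->
  graft (tmap insub t : btree (lower B)) u = t.
Proof.
rewrite /graft; elim: t => [a|l IHl r IHr] H /=.
  by rewrite insubT ?H ?mem_head.
rewrite IHl ?IHr // => a al; apply: H; rewrite mem_cat al ?orbT //.
Qed.

Lemma graft_hole_context c (u : btree (upper B)) :
  (forall p, p \in c -> {in leaves p.2, forall a, a \notin B}) ->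
  graft (hole_context c) u = plug c (tmap val u).
Proof.
rewrite /graft /hole_context; elim: c => [//|[b s] c IH] H.
have Hs : {in leaves s, forall a, a \notin B} by apply: (H (b, s)); rewrite mem_head.
have Hc p : p \in c -> {in leaves p.2, forall a, a \notin B}.
  by move=> pc; apply: H; rewrite inE pc orbT.
by case: b H => _ /=; rewrite -/(map_context _ _) IH // -/(graft _ _) fill_insub.
Qed.

Lemma exists_graft c u : labelled (plug c u) -> B = [set a in leaves u] ->
  exists (r : ltree (lower B)) (u' : ltree (upper B)),
  [/\ tmap val u' = u, tree_of r = hole_context c & plug c u = graft r u'].
Proof.
move=> L BE; have /andP[U /forallP H] := L.
have mB x : (x \in B) = (x \in leaves u) by rewrite BE inE.
have [p [q [E1 E2 E3]]] := leaves_plug_map c.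
rewrite E1 in U H; rewrite uniq_catCA cat_uniq in U.
case/and3P: U => Uu /hasPn pqu Upq.
have pqB a : a \in p ++ q -> a \notin B by rewrite mB => /pqu.
have [|u' u'E] := @tree_lift A (upper B) val u.
  by move=> a; rewrite -mB => aB; exists (Sub a aB); rewrite SubK.
have Lu : labelled u'.
  apply/andP; split; first by rewrite -(map_inj_uniq val_inj) -leaves_tmap u'E.
  by apply/forallP => a; rewrite -(mem_map val_inj) -leaves_tmap u'E -mB; apply: valP.
have iI s : (forall a, a \in s -> a \notin B) -> map (@Some (outer B)) (pmap insub s) = map insub s.
  elim: s => [//|a s IH] Hs /=; rewrite insubT ?Hs ?mem_head //= => aB.
  by rewrite IH // => b bs; apply: Hs; rewrite inE bs orbT.
have Er : leaves (hole_context c) = map (@Some (outer B)) (pmap insub p)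
    ++ None :: map Some (pmap insub q).
  by rewrite /hole_context E2 !iI // => a ap; apply: pqB; rewrite mem_cat ap ?orbT.
have Lr : labelled (hole_context c).
  apply/andP; rewrite Er; split.
    rewrite -cat1s uniq_catCA cat1s -map_cat -pmap_cat; apply: uniq_lower_word.
    exact: pmap_sub_uniq.
  apply/forallP => -[a|]; rewrite mem_cat inE /= ?orbT //.
  rewrite !mem_map; try by move=> ? ? [].
  rewrite !mem_pmap_sub; have aB : val a \notin B := valP a.
  by have := H (val a); rewrite !mem_cat -mB (negbTE aB).
exists (LTree Lr), (LTree Lu); split=> //=; rewrite graft_hole_context ?u'E //.
by move=> x xc a ax; apply: pqB; apply: E3 xc a ax.
Qed.

End Splitting.

(** * The corelations in arity three *)

Section Cogenerators.
Variable k : fieldType.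

Lemma weight_part_linear w (A : finType) : linear (@weight_part k w A).
Proof.
by move=> a x y; apply/ffunP => t; rewrite !ffunE; case: ifP; rewrite ?scaler0 ?addr0.
Qed.

Lemma vertices_ltree (A : finType) (t : ltree A) : (vertices t).+1 = #|A|.
Proof.
have := ltreeP t; rewrite labelled_perm => /perm_size.
by rewrite weight_vertices -cardE.
Qed.

Lemma tree3 (A : Type) (t : btree A) : vertices t = 2 -> exists a b c,
  t = Node (Node (Leaf a) (Leaf b)) (Leaf c) \/ t = Node (Leaf a) (Node (Leaf b) (Leaf c)).
Proof.
case: t => [//|[a|[a|? ?] [b|? ?]] [c|[b'|? ?] [c'|? ?]]] //=; rewrite ?addnS ?addSn //.
- by move=> _; exists a, b', c'; right.
- by move=> _; exists a, b, c; left.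
Qed.

Lemma leaf_eq (A : eqType) (a b : A) : (Leaf a == Leaf b) = (a == b).
Proof. by apply/eqP/eqP => [[]|->]. Qed.
Lemma node_eq (A : eqType) (l r l' r' : btree A) :
  (Node l r == Node l' r') = (l == l') && (r == r').
Proof. by apply/eqP/andP => [[-> ->]|[/eqP -> /eqP ->]]. Qed.
Lemma leaf_node (A : eqType) (a : A) (l r : btree A) : (Leaf a == Node l r) = false.
Proof. by apply/eqP. Qed.
Lemma node_leaf (A : eqType) (a : A) (l r : btree A) : (Node l r == Leaf a) = false.
Proof. by apply/eqP. Qed.

(** With three labels, the trees with leftmost leaf a are exactly the four terms of the relator, and
    the orientations give their signs. *)
Lemma omega3 (A : finType) (a b c : A) : enum A =i [:: a; b; c] -> uniq [:: a; b; c] ->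
  omega k a = - wsign k [:: a; b; c] *: preLie_relator k a b c.
Proof.
move=> Ai U; apply/ffunP => t.
have P : perm_eq (leaves t) [:: a; b; c].
  have := ltreeP t; rewrite labelled_perm => H; apply: perm_trans H _.
  by apply: uniq_perm; rewrite ?enum_uniq.
have v2 : vertices t = 2.
  by have := weight_vertices t; rewrite (perm_size P) => -[].
have W : wsign k [:: a; c; b] = - wsign k [:: a; b; c] by rewrite (wsign_swap k [:: a] c b [::]).
rewrite !ffunE scale_regularE orient.unlock.
move: U P; have [x [y [z [->|->]]]] := tree3 v2; rewrite !(node_eq, leaf_eq, leaf_node, node_leaf) /=;
rewrite !inE !(andbF, andbT) => /andP[/norP[ab ac] bc] P.
all: have xi : x \in [:: a; b; c] by rewrite -(perm_mem P) mem_head.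
all: have yi : y \in [:: a; b; c] by rewrite -(perm_mem P) !inE eqxx orbT.
all: have zi : z \in [:: a; b; c] by rewrite -(perm_mem P) !inE eqxx !orbT.
all: have : uniq [:: x; y; z] by rewrite (perm_uniq P) /= !inE (negbTE ab) (negbTE ac) bc.
all: rewrite /= !inE andbT => /andP[/norP[xy xz] yz].
all: case: (eqVneq x a) => [xa|xa] /=; last by rewrite ?subr0 ?mulr0.
all: move: yi zi xy xz; rewrite !inE xa eq_sym => yi zi /negbTE ya /negbTE za.
all: move: yi zi; rewrite ya [z == a]eq_sym za /= => /orP[] /eqP yE /orP[] /eqP zE.
all: subst; rewrite ?eqxx // in yz *.
all: rewrite ?eqxx ?(negbTE bc) ?[c == b]eq_sym ?(negbTE bc) /= ?W; ring.
Qed.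

Lemma omega_corelated : corelated (@preLie_rel k) (@omega_span k).
Proof.
move=> A x; move: x; apply: span_ind => [|c v w /mapP[a _ ->] wR].
  by rewrite (_ : weight_part _ _ = 0) ?mem0v //; apply/ffunP => t; rewrite !ffunE; case: ifP.
rewrite weight_part_linear; apply: rpredD => //; apply: rpredZ.
have [A3|A3] := eqVneq #|A| 3; last first.
  rewrite (_ : weight_part _ _ = 0) ?mem0v //; apply/ffunP => t; rewrite !ffunE.
  case: eqP => // vt; have := vertices_ltree t; rewrite vt => E.
  by rewrite -E eqxx in A3.
have -> : weight_part 2 (omega k a) = omega k a.
  apply/ffunP => t; rewrite !ffunE; case: eqP => // vt.
  by case: vt; have := vertices_ltree t; rewrite A3 => -[].
have [b [c' bc]] : exists b c', perm_eq (enum A) [:: a; b; c'].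
  have aA : a \in enum A by rewrite mem_enum.
  have := perm_to_rem aA; have := cardE A; rewrite A3 => E P.
  have : size (rem a (enum A)) = 2 by rewrite size_rem // -E.
  by case: (rem a (enum A)) P => [//|b [//|c' [|//]]] P _; exists b, c'.
rewrite (@omega3 A a b c'); last 2 first.
- exact: perm_mem bc.
- by rewrite -(perm_uniq bc) enum_uniq.
by apply/rpredZ/memv_span/mapP; exists ((a, b), c'); rewrite ?mem_enum.
Qed.

End Cogenerators.

(** * The upper bound for subcooperads with the given corelations *)

Section UpperBound.
Variable k : fieldType.

(** The coefficient normalized by the orientation, extended by 0 to raw trees that are not labelled
    bijectively. Membership in [omega_span] means that it depends on the leftmost leaf only. *)
Definition rel_coef (A : finType) (x : freeS k A) (t : btree A) : k :=
  if insub t is Some t' then @GRing.mul k (x t') (orient k t') else 0.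

Lemma rel_coefE (A : finType) (x : freeS k A) (t : ltree A) :
  rel_coef x t = @GRing.mul k (x t) (orient k t).
Proof. by rewrite /rel_coef valK. Qed.

Lemma rel_coef_unlabelled (A : finType) (x : freeS k A) (t : btree A) :
  ~~ labelled t -> rel_coef x t = 0.
Proof. by move=> tN; rewrite /rel_coef insubN. Qed.

Lemma rel_coef_omega (A : finType) (x : freeS k A) : x \in omega_span k A ->
  forall t t', perm_eq (leaves t) (leaves t') -> lmost t = lmost t' ->
  rel_coef x t = rel_coef x t'.
Proof.
move=> xW t t' P E; have [tL|tL] := boolP (labelled t); last first.
  have tL' : ~~ labelled t' by rewrite labelled_perm -(permPl P) -labelled_perm.
  by rewrite !rel_coef_unlabelled.
have tL' : labelled t' by rewrite labelled_perm -(permPl P) -labelled_perm.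
rewrite -[t]/(tree_of (LTree tL)) -[t']/(tree_of (LTree tL')) !rel_coefE.
exact: omega_span_eq.
Qed.

Lemma omega_span_rel_coef (A : finType) (x : freeS k A) :
  (forall t t' : ltree A, lmost t = lmost t' -> rel_coef x t = rel_coef x t') ->
  x \in omega_span k A.
Proof.
move=> H; apply/omega_spanP.
exists (fun a => if [pick t : ltree A | lmost t == a] is Some t then rel_coef x t else 0).
move=> t; case: pickP => [t' /eqP /H ->|/(_ t)]; last by rewrite eqxx.
by rewrite rel_coefE -mulrA orient_sqr mulr1.
Qed.

Lemma tvec_unlabelled (A : finType) (t : btree A) : ~~ labelled t -> tvec k t = 0.
Proof.
move=> tN; apply/ffunP => s; rewrite !ffunE; case: eqP => // st.
by move: (ltreeP s); rewrite st (negbTE tN).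
Qed.

Lemma preLie_relator_omega (A : finType) (a b c : A) :
  preLie_relator k a b c \in omega_span k A.
Proof.
have [L|L] := boolP (labelled (Node (Node (Leaf a) (Leaf b)) (Leaf c))).
  have P := L; rewrite labelled_perm in P.
  have U : uniq [:: a; b; c] by case/andP: L.
  have -> : preLie_relator k a b c = - wsign k [:: a; b; c] *: omega k a.
    rewrite (@omega3 k A a b c) //; last by move=> z; rewrite -(perm_mem P).
    by rewrite scalerA mulrNN wsign_sqr // scale1r.
  exact/rpredZ/omega_mem.
have T t : perm_eq (leaves t) [:: a; b; c] -> tvec k t = 0.
  by move=> P; apply: tvec_unlabelled; move: L; rewrite !labelled_perm -(permPl P).
have acb : perm_eq [:: a; c; b] [:: a; b; c] by rewrite perm_cons (perm_catC [:: c] [:: b]).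
by rewrite /preLie_relator !T ?subrr ?mem0v.
Qed.

Section Moves.
Variables (S : subfamily k) (A : finType) (x : freeS k A).
Hypotheses (SC : subcooperad S) (xS : x \in S A).
Hypothesis IH : forall A' : finType, (#|A'| < #|A|)%N ->
  forall x' : freeS k A', x' \in S A' -> x' \in omega_span k A'.

(** Slices of the decomposition lie in the subcooperad on fewer labels, where the induction
    hypothesis lets r and u be replaced by any trees with the same leftmost leaf. *)
Lemma rel_coef_graft (B : {set A}) (r r' : ltree (lower B)) (u u' : ltree (upper B)) :
  (1 < #|B| < #|A|)%N -> lmost r = lmost r' -> lmost u = lmost u' ->
  rel_coef x (graft r u) = rel_coef x (graft r' u').
Proof.
move=> /andP[B1 BA] rE uE.
rewrite -[graft r u]/(tree_of (lgraft r u)) -[graft r' u']/(tree_of (lgraft r' u')).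
rewrite !rel_coefE !fdec_orient; congr (_ * _).
have dS := (SC.2 A B x xS).
have Sl v := IH (A' := lower B) _ (tensor_slice_l v dS).
have Su s := IH (A' := upper B) _ (tensor_slice_r s dS).
have cl : (#|lower B| < #|A|)%N.
  rewrite card_option card_sig; move: B1; rewrite -(cardC B).
  have <- : #|[predC B]| = #|[pred x | x \notin B]| by apply: eq_card.
  by case: #|B| => [|[|m]] // _; rewrite !addSn !ltnS leq_addl.
have cu : (#|upper B| < #|A|)%N.
  by rewrite card_sig (_ : #|_| = #|B|) //; apply: eq_card => a; rewrite inE.
have := omega_span_eq (Sl cl u) rE; rewrite !ffunE => ->.
have := omega_span_eq (Su cu r') uE; rewrite !ffunE => E.
by rewrite mulrAC E mulrAC.
Qed.

Lemma rel_coef_plug c c' u u' : labelled (plug c u) -> labelled (plug c' u') ->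
  perm_eq (leaves u) (leaves u') -> (1 < weight u < #|A|)%N -> lmost u = lmost u' ->
  (forall B : {set A}, lmost (hole_context B c) = lmost (hole_context B c')) ->
  rel_coef x (plug c u) = rel_coef x (plug c' u').
Proof.
move=> L L' P wu uE cE; set B := [set a in leaves u].
have BE' : B = [set a in leaves u'].
  by apply/setP => a; rewrite !inE (perm_mem P).
have [r [v [vE rE ->]]] := exists_graft L (erefl B).
have [r' [v' [vE' rE' ->]]] := exists_graft L' BE'.
apply: rel_coef_graft.
- have -> // : #|B| = weight u.
  rewrite cardsE; apply/card_uniqP.
  have [p [q pq]] := leaves_plug c; have /andP[] := L; rewrite pq.
  by rewrite uniq_catCA cat_uniq => /andP[].
- by rewrite rE rE'; apply: cE.
- by apply: val_inj; have := uE; rewrite -vE -vE' !lmost_tmap.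
Qed.

(** Three labels are governed by the corelations. With more labels the move happens inside the upper
    or the root factor of a proper decomposition. *)
Lemma rel_coef_moves : corelated (@preLie_rel k) S -> forall c t1 t2 t3,
  rel_coef x (plug c (Node (Node t1 t2) t3)) = rel_coef x (plug c (Node t1 (Node t2 t3))) /\
  rel_coef x (plug c (Node (Node t1 t2) t3)) = rel_coef x (plug c (Node (Node t1 t3) t2)).
Proof.
move=> SR c t1 t2 t3.
have P1 : perm_eq (leaves (Node (Node t1 t2) t3)) (leaves (Node t1 (Node t2 t3))).
  by rewrite /= catA.
have P2 : perm_eq (leaves (Node (Node t1 t2) t3)) (leaves (Node (Node t1 t3) t2)).
  by rewrite /= -!catA perm_cat2l perm_catC.
have PP t t' : perm_eq (leaves t) (leaves t') -> labelled (plug c t) = labelled (plug c t').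
  have [p [q pq]] := leaves_plug c; move=> P; rewrite !labelled_perm !pq.
  by apply: permPl; rewrite perm_cat2l perm_cat2r.
have [L|L] := boolP (labelled (plug c (Node (Node t1 t2) t3))); last first.
  by rewrite !rel_coef_unlabelled // -?(PP _ _ P1) -?(PP _ _ P2).
have L1 := L; rewrite (PP _ _ P1) in L1; have L2 := L; rewrite (PP _ _ P2) in L2.
have wA : weight (plug c (Node (Node t1 t2) t3)) = #|A|.
  by move: L; rewrite labelled_perm cardE => /perm_size.
have w1 := weight_gt0 t1; have w2 := weight_gt0 t2; have w3 := weight_gt0 t3.
have [p [q pq]] := leaves_plug c.
have [A3|A3] := eqVneq #|A| 3.
  have xW : x \in omega_span k A.
    suff <- : weight_part 2 x = x.
      have RW : (preLie_rel k A <= omega_span k A)%VS.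
        by apply/span_subvP => v /mapP[[[a b] d] _ ->]; apply: preLie_relator_omega.
      exact/(subvP RW)/SR.
    apply/ffunP => t; rewrite ffunE; have := vertices_ltree t.
    by rewrite A3 => -[->].
  have Pc t t' : perm_eq (leaves t) (leaves t') -> perm_eq (leaves (plug c t)) (leaves (plug c t')).
    by move=> P; rewrite !pq perm_cat2l perm_cat2r.
  by split; apply: rel_coef_omega => //; try exact: Pc; apply: lmost_plug.
have A4 : (3 < #|A|)%N.
  by rewrite ltn_neqAle eq_sym A3 -wA pq /= !size_cat; lia.
(* A nonempty context leaves a label outside, so the rebracketed subtree itself is a proper upper
   factor. *)
have [c0|c0] := posnP (size c); last first.
  have wu : (1 < weight (Node (Node t1 t2) t3) < #|A|)%N.
    rewrite -wA /= !size_cat; apply/andP; split; first by lia.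
    case: c c0 {L L1 L2 PP wA pq} => [//|[b s] c] _; have ws := weight_gt0 s.
    have [p' [q' pq']] := leaves_plug c.
    by case: b; rewrite /= !size_cat pq' /= !size_cat; lia.
  by split; apply: rel_coef_plug.
(* At the root, one of the three subtrees is composite since there are more than three labels.
   Collapsing it to a label moves the rebracketing into the root factor. *)
have cE := size0nil c0.
rewrite cE in L L1 L2 wA *; rewrite /= !size_cat in wA.
have [w1'|w1'] := ltnP 1 (weight t1).
  have wu : (1 < weight t1 < #|A|)%N by rewrite w1' -wA /=; lia.
  split.
    by apply: (@rel_coef_plug [:: (false, t3); (false, t2)] [:: (false, Node t2 t3)] t1 t1).
  by apply: (@rel_coef_plug [:: (false, t3); (false, t2)] [:: (false, t2); (false, t3)] t1 t1).
have [w2'|w2'] := ltnP 1 (weight t2).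
  have wu : (1 < weight t2 < #|A|)%N by rewrite w2' -wA /=; lia.
  split.
    by apply: (@rel_coef_plug [:: (false, t3); (true, t1)] [:: (true, t1); (false, t3)] t2 t2).
  by apply: (@rel_coef_plug [:: (false, t3); (true, t1)] [:: (true, Node t1 t3)] t2 t2).
have wu : (1 < weight t3 < #|A|)%N.
  by move: A4; rewrite -wA; lia.
split.
  by apply: (@rel_coef_plug [:: (true, Node t1 t2)] [:: (true, t1); (true, t2)] t3 t3).
by apply: (@rel_coef_plug [:: (true, Node t1 t2)] [:: (false, t2); (true, t1)] t3 t3).
Qed.

End Moves.

Lemma subcooperad_omega (S : subfamily k) : subcooperad S -> corelated (@preLie_rel k) S ->
  forall A : finType, (S A <= omega_span k A)%VS.
Proof.
move=> SC SR A; move: {2}#|A|.+1 (ltnSn #|A|) => n.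
elim: n A => [//|n IHn] A An; apply/subvP => x xS.
have IH (A' : finType) : (#|A'| < #|A|)%N -> forall x' : freeS k A', x' \in S A' -> x' \in omega_span k A'.
  by move=> lt_A' x'; apply/subvP/IHn; apply: leq_trans lt_A' _; rewrite -ltnS.
apply: omega_span_rel_coef => t t' E.
apply: lmost_determines => //; last first.
  have := ltreeP t; have := ltreeP t'; rewrite !labelled_perm => P' P.
  by apply: perm_trans P _; rewrite perm_sym.
- by move=> c t1 t2 t3; have [] := rel_coef_moves SC xS IH SR c t1 t2 t3.
- by move=> c t1 t2 t3; have [] := rel_coef_moves SC xS IH SR c t1 t2 t3.
Qed.

Lemma spannedE (V : vectType k) (Q : V -> Prop) (x : V) : Q x -> x \in spanned Q.
Proof. by move=> Qx; rewrite /spanned; case: cid => U [H H'] /=; apply: H. Qed.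

Lemma spanned_subv (V : vectType k) (Q : V -> Prop) (W : {vspace V}) :
  (forall x, Q x -> x \in W) -> (spanned Q <= W)%VS.
Proof. by move=> QW; rewrite /spanned; case: cid => U [H H'] /=; apply: H'. Qed.

Lemma quadratic_cooperad_omega (A : finType) :
  quadratic_cooperad (@preLie_rel k) A = omega_span k A.
Proof.
apply/eqP; rewrite eqEsubv; apply/andP; split.
  apply: spanned_subv => x [S [SC SR xS]].
  exact: (subvP (subcooperad_omega SC SR A)).
apply/subvP => x xW; apply: spannedE; exists (omega_span k); split=> //.
- exact: omega_subcooperad.
- exact: omega_corelated.
Qed.

End UpperBound.

(** * The pre-Lie operad *)

Section ClosedPredicates.
Variables (k : fieldType) (V : vectType k).

(** A subspace of maximal dimension inside Q contains all of Q, since a vector of Q outside it would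
    enlarge it. *)
Lemma vspace_of_closed (Q : V -> Prop) :
  Q 0 -> (forall a x y, Q x -> Q y -> Q (a *: x + y)) ->
  exists U : {vspace V}, forall x, x \in U <-> Q x.
Proof.
move=> Q0 QD.
pose D d := `[< exists U : {vspace V}, \dim U = d /\ forall x, x \in U -> Q x >].
have exD : exists d, D d.
  exists 0%N; apply/asboolP; exists 0%VS; rewrite dimv0; split=> // x.
  by rewrite memv0 => /eqP ->.
have ubD d : D d -> (d <= \dim {: V})%N.
  by move=> /asboolP[U [<- _]]; apply/dimvS/subvf.
have [d /asboolP[U [dU UQ]] maxU] := ex_maxnP exD ubD.
exists U => x; split=> [/UQ //|Qx]; apply/idPn => xU.
have /maxU : D (\dim (U + <[x]>)%VS).
  apply/asboolP; exists (U + <[x]>)%VS; split=> // y /memv_addP[u uU [v /vlineP[a ->] ->]].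
  by rewrite addrC; apply: QD => //; apply: UQ.
rewrite -dU leqNgt => /negP; apply.
rewrite ltn_neqAle dimvS ?addvSl // andbT; apply/eqP => dE.
have : (U == U + <[x]>)%VS by rewrite eqEdim addvSl dE leqnn.
move=> /eqP E; case/negP: xU; rewrite E; apply: subvP (addvSr _ _) _ (memv_line x).
Qed.

End ClosedPredicates.

Section Composition.
Variable k : fieldType.

Lemma fcomp_linear_l (A : finType) (B : {set A}) (y : freeS k (upper B)) :
  linear (fun x : freeS k (lower B) => fcomp x y).
Proof.
move=> a x x'; rewrite /fcomp scaler_sumr -big_split /=; apply: eq_bigr => r _.
rewrite scaler_sumr -big_split /=; apply: eq_bigr => u _.
by rewrite !ffunE scale_regularE mulrDl scalerDl -mulrA scalerA.
Qed.

Lemma fcomp_linear_r (A : finType) (B : {set A}) (x : freeS k (lower B)) :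
  linear (fun y : freeS k (upper B) => fcomp x y).
Proof.
move=> a y y'; rewrite /fcomp scaler_sumr -big_split /=; apply: eq_bigr => r _.
rewrite scaler_sumr -big_split /=; apply: eq_bigr => u _.
by rewrite !ffunE scale_regularE mulrDr scalerDl scalerA mulrCA.
Qed.

Lemma fcomp_tvec (A : finType) (B : {set A}) (r : ltree (lower B)) (u : ltree (upper B)) :
  fcomp (tvec k r) (tvec k u) = tvec k (graft r u).
Proof.
rewrite /fcomp (bigD1 r) //= [X in _ + X]big1 ?addr0; last first.
  move=> s sr; rewrite big1 // => v _.
  by rewrite tvecE (negbTE sr) mul0r scale0r.
rewrite (bigD1 u) //= [X in _ + X]big1 ?addr0.
  by rewrite !tvecE !eqxx mulr1 scale1r.
by move=> v vu; rewrite [X in _ * X]tvecE (negbTE vu) mulr0 scale0r.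
Qed.

Definition context_relator (A : finType) (c : context A) (t1 t2 t3 : btree A) : freeS k A :=
  (tvec k (plug c (Node (Node t1 t2) t3)) - tvec k (plug c (Node t1 (Node t2 t3))))
  - (tvec k (plug c (Node (Node t1 t3) t2)) - tvec k (plug c (Node t1 (Node t3 t2)))).

Lemma linear_relator (V W : lmodType k) (f : V -> W) (a b c d : V) : linear f ->
  f ((a - b) - (c - d)) = (f a - f b) - (f c - f d).
Proof.
move=> fL; have fB x y : f (x - y) = f x - f y.
  by rewrite addrC -scaleN1r fL scaleN1r addrC.
by rewrite !fB.
Qed.

Section Ideals.
Variable J : subfamily k.
Hypotheses (JI : operadic_ideal J) (RJ : forall A, (preLie_rel k A <= J A)%VS).

Lemma perm_labelled (A : finType) (t t' : btree A) :
  perm_eq (leaves t) (leaves t') -> labelled t = labelled t'.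
Proof. by move=> P; rewrite !labelled_perm; apply: permPl. Qed.

Lemma perm_plug (A : eqType) (c : context A) (t t' : btree A) :
  perm_eq (leaves t) (leaves t') -> perm_eq (leaves (plug c t)) (leaves (plug c t')).
Proof.
by have [p [q pq]] := leaves_plug c; rewrite !pq perm_cat2l perm_cat2r.
Qed.

Section Perms.
Variables (A : eqType) (t1 t2 t3 : btree A).
Lemma perm_leaves_rot : perm_eq (leaves (Node (Node t1 t2) t3)) (leaves (Node t1 (Node t2 t3))).
Proof. by rewrite /= catA. Qed.
Lemma perm_leaves_swap : perm_eq (leaves (Node (Node t1 t2) t3)) (leaves (Node (Node t1 t3) t2)).
Proof. by rewrite /= -!catA perm_cat2l perm_catC. Qed.
Lemma perm_leaves_rot_swap : perm_eq (leaves (Node (Node t1 t2) t3)) (leaves (Node t1 (Node t3 t2))).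
Proof. by rewrite /= -!catA perm_cat2l perm_catC. Qed.
End Perms.

(* Grafting at a fixed subtree transports the relators.                       *)
Lemma relator_lower (A : finType) (t1 t2 t3 u : btree A) (c1 c2 c3 c4 : context A) :
  labelled (Node (Node t1 t2) t3) ->
  (forall B : {set A}, exists s1 s2 s3 : btree (lower B),
    [/\ hole_context B c1 = Node (Node s1 s2) s3,
        hole_context B c2 = Node s1 (Node s2 s3),
        hole_context B c3 = Node (Node s1 s3) s2
      & hole_context B c4 = Node s1 (Node s3 s2)]) ->
  plug c1 u = Node (Node t1 t2) t3 -> plug c2 u = Node t1 (Node t2 t3) ->
  plug c3 u = Node (Node t1 t3) t2 -> plug c4 u = Node t1 (Node t3 t2) ->
  (forall s1 s2 s3 : btree (lower [set a in leaves u]),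
     labelled (Node (Node s1 s2) s3) -> context_relator [::] s1 s2 s3 \in J _) ->
  context_relator [::] t1 t2 t3 \in J A.
Proof.
move=> L H E1 E2 E3 E4 HJ; set B := [set a in leaves u] in HJ *.
have L1 : labelled (plug c1 u) by rewrite E1.
have L2 : labelled (plug c2 u) by rewrite E2 -(perm_labelled (perm_leaves_rot _ _ _)).
have L3 : labelled (plug c3 u) by rewrite E3 -(perm_labelled (perm_leaves_swap _ _ _)).
have L4 : labelled (plug c4 u) by rewrite E4 -(perm_labelled (perm_leaves_rot_swap _ _ _)).
have [s1 [s2 [s3 [h1 h2 h3 h4]]]] := H B.
have [r1 [u1 [uE1 rE1 g1]]] := exists_graft L1 (erefl B).
have [r2 [u2 [uE2 rE2 g2]]] := exists_graft L2 (erefl B).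
have [r3 [u3 [uE3 rE3 g3]]] := exists_graft L3 (erefl B).
have [r4 [u4 [uE4 rE4 g4]]] := exists_graft L4 (erefl B).
have uI (v w : ltree (upper B)) : tmap val v = u -> tmap val w = u -> v = w.
  by move=> vE wE; apply/val_inj/(tmap_inj val_inj); rewrite vE wE.
rewrite (uI _ _ uE2 uE1) in g2; rewrite (uI _ _ uE3 uE1) in g3; rewrite (uI _ _ uE4 uE1) in g4.
rewrite /context_relator /= -E1 -E2 -E3 -E4 g1 g2 g3 g4 -!fcomp_tvec.
rewrite -(@linear_relator _ _ (fun x : freeS k (lower B) => fcomp x (tvec k u1))); last exact: fcomp_linear_l.
have [_ + _] := JI; apply; rewrite rE1 rE2 rE3 rE4 h1 h2 h3 h4.
by apply: HJ; rewrite -h1 -rE1; apply: ltreeP.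
Qed.

(** Induction on the number of labels: a composite argument is collapsed to one label, and the
    relator is a smaller relator composed with that argument. With three leaves it is a
    generator. *)
Lemma root_relator_ideal (A : finType) (t1 t2 t3 : btree A) :
  labelled (Node (Node t1 t2) t3) -> context_relator [::] t1 t2 t3 \in J A.
Proof.
move: {2}#|A|.+1 (ltnSn #|A|) => n.
elim: n A t1 t2 t3 => [//|n IH] A t1 t2 t3 An L.
have lowerA (u : btree A) (c : context A) : plug c u = Node (Node t1 t2) t3 -> (1 < weight u)%N ->
    (#|lower [set a in leaves u]| < n)%N.
  move=> E wu; have L' := L; rewrite -E in L'.
  have [r [v [_ _ _]]] := exists_graft L' (erefl [set a in leaves u]).
  have := vertices_lower r; have := vertices_ltree r => <- ->.
  have := max_card (mem [set a in leaves u]).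
  have -> : #|[set a in leaves u]| = weight u.
    rewrite cardsE; apply/card_uniqP; have [p [q pq]] := leaves_plug c.
    by move: L' => /andP[]; rewrite pq uniq_catCA cat_uniq => /andP[].
  by move: An wu; clear; lia.
have [w1|w1] := ltnP 1 (weight t1).
  apply: (@relator_lower _ _ _ _ t1 [:: (false, t3); (false, t2)] [:: (false, Node t2 t3)]
     [:: (false, t2); (false, t3)] [:: (false, Node t3 t2)]) => // [B|s1 s2 s3].
    by exists (Leaf None), (tmap insub t2), (tmap insub t3).
  by apply: IH; apply: (lowerA t1 [:: (false, t3); (false, t2)]).
have [w2|w2] := ltnP 1 (weight t2).
  apply: (@relator_lower _ _ _ _ t2 [:: (false, t3); (true, t1)] [:: (true, t1); (false, t3)]
     [:: (true, Node t1 t3)] [:: (true, t1); (true, t3)]) => // [B|s1 s2 s3].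
    by exists (tmap insub t1), (Leaf None), (tmap insub t3).
  by apply: IH; apply: (lowerA t2 [:: (false, t3); (true, t1)]).
have [w3|w3] := ltnP 1 (weight t3).
  apply: (@relator_lower _ _ _ _ t3 [:: (true, Node t1 t2)] [:: (true, t1); (true, t2)]
     [:: (false, t2); (true, t1)] [:: (true, t1); (false, t2)]) => // [B|s1 s2 s3].
    by exists (tmap insub t1), (tmap insub t2), (Leaf None).
  by apply: IH; apply: (lowerA t3 [:: (true, Node t1 t2)]).
have leafE t : (weight t <= 1)%N -> exists a : A, t = Leaf a.
  case: t => [a|l r]; first by exists a.
  by rewrite /= size_cat; have := weight_gt0 l; have := weight_gt0 r; lia.
have [[a aE] [b bE] [c cE]] := And3 (leafE _ w1) (leafE _ w2) (leafE _ w3).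
apply: (subvP (RJ A)); rewrite aE bE cE; apply/memv_span/mapP.
by exists ((a, b), c); rewrite ?mem_enum.
Qed.

(** The relator at the root is the upper factor of a composition whose root factor is the context,
    and J is closed under such compositions. *)
Lemma context_relator_ideal (A : finType) c (t1 t2 t3 : btree A) :
  labelled (plug c (Node (Node t1 t2) t3)) -> context_relator c t1 t2 t3 \in J A.
Proof.
move=> L; set B := [set a in leaves (Node (Node t1 t2) t3)].
have L2 := L; rewrite (perm_labelled (perm_plug c (perm_leaves_rot _ _ _))) in L2.
have L3 := L; rewrite (perm_labelled (perm_plug c (perm_leaves_swap _ _ _))) in L3.
have L4 := L; rewrite (perm_labelled (perm_plug c (perm_leaves_rot_swap _ _ _))) in L4.
have BE t : perm_eq (leaves (Node (Node t1 t2) t3)) (leaves t) -> B = [set a in leaves t].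
  by move=> P; apply/setP => a; rewrite !inE (perm_mem P).
have [r1 [u1 [uE1 rE1 g1]]] := exists_graft L (erefl B).
have [r2 [u2 [uE2 rE2 g2]]] := exists_graft L2 (BE _ (perm_leaves_rot _ _ _)).
have [r3 [u3 [uE3 rE3 g3]]] := exists_graft L3 (BE _ (perm_leaves_swap _ _ _)).
have [r4 [u4 [uE4 rE4 g4]]] := exists_graft L4 (BE _ (perm_leaves_rot_swap _ _ _)).
have rI r : tree_of r = hole_context B c -> r = r1 by move=> rE; apply: val_inj; rewrite /= rE rE1.
rewrite /context_relator g1 g2 g3 g4 (rI _ rE2) (rI _ rE3) (rI _ rE4) -!fcomp_tvec.
rewrite -(@linear_relator _ _ (fun y : freeS k (upper B) => fcomp (tvec k r1) y)); last exact: fcomp_linear_r.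
have [_ _ +] := JI; apply.
have [s1 [s2 [s3 [u1E [sE1 sE2 sE3]]]]] : exists s1 s2 s3, tree_of u1 = Node (Node s1 s2) s3 /\
    [/\ tmap val s1 = t1, tmap val s2 = t2 & tmap val s3 = t3].
  case: (tree_of u1) uE1 => [//|[//|s1 s2] s3] [E1 E2 E3].
  by exists s1, s2, s3.
have u2E : tree_of u2 = Node s1 (Node s2 s3).
  by apply: (tmap_inj val_inj); rewrite uE2 -sE1 -sE2 -sE3.
have u3E : tree_of u3 = Node (Node s1 s3) s2.
  by apply: (tmap_inj val_inj); rewrite uE3 -sE1 -sE2 -sE3.
have u4E : tree_of u4 = Node s1 (Node s3 s2).
  by apply: (tmap_inj val_inj); rewrite uE4 -sE1 -sE2 -sE3.
rewrite u1E u2E u3E u4E.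
by apply: root_relator_ideal; rewrite -u1E; apply: ltreeP.
Qed.

End Ideals.
End Composition.

Section LinearFunctions.
Variables (k : fieldType) (V W : lmodType k) (f : V -> W).
Hypothesis fL : linear f.

Lemma linear_fun0 : f 0 = 0.
Proof. by have := fL (-1) 0 0; rewrite scaler0 addr0 scaleN1r addNr. Qed.
Lemma linear_funD x y : f (x + y) = f x + f y.
Proof. by have := fL 1 x y; rewrite !scale1r. Qed.
Lemma linear_funZ a x : f (a *: x) = a *: f x.
Proof. by have := fL a x 0; rewrite linear_fun0 !addr0. Qed.
Lemma linear_funN x : f (- x) = - f x.
Proof. by rewrite -scaleN1r linear_funZ scaleN1r. Qed.
Lemma linear_fun_sum (I : finType) (P : pred I) (F : I -> V) :
  f (\sum_(i | P i) F i) = \sum_(i | P i) f (F i).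
Proof. by apply: (big_morph _ linear_funD linear_fun0). Qed.

End LinearFunctions.

(** * Pre-Lie functions on the operad *)

Section Pairing.
Variables (k : fieldType) (W : lmodType k).

Definition pair_with (A : finType) (f : btree A -> W) (x : freeS k A) : W :=
  \sum_(t : ltree A) x t *: f t.

Lemma pair_linear (A : finType) (f : btree A -> W) : linear (pair_with f).
Proof.
move=> a x y; rewrite /pair_with scaler_sumr -big_split /=; apply: eq_bigr => t _.
by rewrite !ffunE scalerDl scalerA.
Qed.

Lemma pair_tvec (A : finType) (f : btree A -> W) (t : ltree A) :
  pair_with f (tvec k t) = f t.
Proof.
rewrite /pair_with (bigD1 t) //= big1 ?addr0 ?tvecE ?eqxx ?scale1r // => s st.
by rewrite tvecE (negbTE st) scale0r.
Qed.

Lemma pair_relabel (A A' : finType) (g : A -> A') (gB : bijective g) f x :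
  pair_with f (relabel g x) = pair_with (fun t => f (tmap g t)) x.
Proof.
rewrite /relabel (linear_fun_sum (pair_linear f)); apply: eq_bigr => t _.
rewrite (linear_funZ (pair_linear f)).
by rewrite -[tmap g t]/(tree_of (lmap gB t)) pair_tvec.
Qed.

Lemma pair_fcomp (A : finType) (B : {set A}) f (x : freeS k (lower B)) (y : freeS k (upper B)) :
  pair_with f (fcomp x y) =
  \sum_(r : ltree (lower B)) \sum_(u : ltree (upper B)) (x r * y u) *: f (graft r u).
Proof.
rewrite /fcomp (linear_fun_sum (pair_linear f)); apply: eq_bigr => r _.
rewrite (linear_fun_sum (pair_linear f)); apply: eq_bigr => u _.
rewrite (linear_funZ (pair_linear f)).
by rewrite -[graft r u]/(tree_of (lgraft r u)) pair_tvec.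
Qed.

Lemma preLie_fun_tmap (A A' : Type) (e : k) (g : A -> A') (f : btree A' -> W) :
  preLie_fun e f -> preLie_fun e (fun t => f (tmap g t)).
Proof.
move=> fP c t1 t2 t3; have := fP (map_context g c) (tmap g t1) (tmap g t2) (tmap g t3).
by rewrite /assoc !tmap_plug !leaves_tmap !size_map.
Qed.

Lemma tbind_plug (A A' : Type) (g : A -> btree A') (c : context A) t :
  tbind g (plug c t) = plug [seq (p.1, tbind g p.2) | p <- c] (tbind g t).
Proof. by elim: c => [|[[] s] c IH] //=; rewrite IH. Qed.

Lemma preLie_fun_tbind (A A' : Type) (g : A -> btree A') (f : btree A' -> W) :
  preLie_fun 1 f -> preLie_fun 1 (fun t => f (tbind g t)).
Proof.
move=> fP c t1 t2 t3.
have := fP [seq (p.1, tbind g p.2) | p <- c] (tbind g t1) (tbind g t2) (tbind g t3).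
by rewrite /assoc !tbind_plug /= !expr1n.
Qed.

Lemma graft_context (A : finType) (B : {set A}) (r : btree (lower B)) :
  None \in leaves r -> uniq (leaves r) ->
  exists c, r = hole_context B c /\ forall u, graft r u = plug c (tmap val u).
Proof.
elim: r => [[x|]|l IHl r IHr] //=; first by exists [::].
rewrite cat_uniq mem_cat => H /and3P[Ul /hasPn lr Ur].
have const (s : btree (lower B)) : None \notin leaves s ->
    exists t, s = tmap insub t /\ forall u, graft s u = t.
  elim: s => [[x|]|s1 IH1 s2 IH2] //=.
    by exists (Leaf (val x)); split=> //; rewrite /tmap /= valK.
  rewrite mem_cat negb_or => /andP[/IH1 [t1 [-> E1]] /IH2 [t2 [-> E2]]].
  by exists (Node t1 t2); split=> // u; rewrite -{2}(E1 u) -{2}(E2 u).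
have [Nl|Nl] := boolP (None \in leaves l).
  have [|t [-> tE]] := const r; first by apply/negP => /lr; rewrite /= Nl.
  have [c [-> cE]] := IHl Nl Ul; exists ((false, t) :: c); split=> // u.
  by rewrite /= -cE -{2}(tE u).
have Nr : None \in leaves r by case/orP: H => // H; rewrite H in Nl.
have [t [-> tE]] := const l Nl; have [c [-> cE]] := IHr Nr Ur.
exists ((true, t) :: c); split=> // u.
by rewrite /= -cE -{2}(tE u).
Qed.

Lemma annihilator_exists (A : finType) : exists U : {vspace freeS k A}, forall x,
  x \in U <-> forall f : btree A -> W, preLie_fun 1 f -> pair_with f x = 0.
Proof.
apply: vspace_of_closed => [f _|a x y xP yP f fP]; first exact: linear_fun0 (pair_linear f).
by rewrite pair_linear xP // yP // scaler0 addr0.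
Qed.

Definition annihilator : subfamily k := fun A => projT1 (cid (annihilator_exists A)).

Lemma annihilatorP (A : finType) (x : freeS k A) : x \in annihilator A <->
  forall f : btree A -> W, preLie_fun 1 f -> pair_with f x = 0.
Proof. by rewrite /annihilator; case: (cid _). Qed.

(** Precomposing a pre-Lie function with a relabelling, with grafting a fixed tree into the hole, or
    with a fixed context gives again a pre-Lie function. *)
Lemma annihilator_ideal : operadic_ideal annihilator.
Proof.
split=> [A A' g gB x /annihilatorP xK|A B x y /annihilatorP xK|A B x y /annihilatorP yK];
  apply/annihilatorP => f fP.
- by rewrite (pair_relabel gB); apply/xK/preLie_fun_tmap.
- rewrite pair_fcomp exchange_big big1 //= => u _.
  have := xK _ (preLie_fun_tbind (fill u) fP); rewrite /pair_with => xf.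
  transitivity (y u *: \sum_(r : ltree (lower B)) x r *: f (graft r u)).
    by rewrite scaler_sumr; apply: eq_bigr => r _; rewrite scalerA mulrC.
  by rewrite xf scaler0.
- rewrite pair_fcomp big1 //= => r _; have /andP[Ur _] := ltreeP r.
  have [c [_ cE]] := graft_context (leaves_lower r) Ur.
  have := yK _ (preLie_fun_tmap val (preLie_fun_plug c fP)); rewrite /pair_with => yf.
  transitivity (x r *: \sum_(u : ltree (upper B)) y u *: f (plug c (tmap val u))).
    by rewrite scaler_sumr; apply: eq_bigr => u _; rewrite scalerA cE.
  by rewrite yf scaler0.
Qed.

Lemma annihilator_relators (A : finType) : (preLie_rel k A <= annihilator A)%VS.
Proof.
apply/span_subvP => v /mapP[[[a b] c] _ ->]; apply/annihilatorP => f fP.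
have [L|L] := boolP (labelled (Node (Node (Leaf a) (Leaf b)) (Leaf c))); last first.
  have T t : perm_eq (leaves t) [:: a; b; c] -> tvec k t = 0.
    by move=> P; apply: tvec_unlabelled; move: L; rewrite !labelled_perm -(permPl P).
  have acb : perm_eq [:: a; c; b] [:: a; b; c] by rewrite perm_cons (perm_catC [:: c] [:: b]).
  by rewrite /preLie_relator !T ?subrr ?(linear_fun0 (pair_linear f)).
have H t : labelled t -> pair_with f (tvec k t) = f t.
  by move=> tL; rewrite -[t]/(tree_of (LTree tL)) pair_tvec.
have L2 := L; rewrite (perm_labelled (perm_leaves_rot _ _ _)) in L2.
have L3 := L; rewrite (perm_labelled (perm_leaves_swap _ _ _)) in L3.
have L4 := L; rewrite (perm_labelled (perm_leaves_rot_swap _ _ _)) in L4.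
rewrite /preLie_relator (linear_relator _ _ _ _ (pair_linear f)) !H //.
have := fP [::] (Leaf a) (Leaf b) (Leaf c).
by rewrite /assoc /= expr1n scale1r => ->; rewrite subrr.
Qed.

End Pairing.

Section PreLieOperad.
Variable k : fieldType.
Notation R := (@preLie_rel k).

Lemma ideal_genP (A : finType) (x : freeS k A) : x \in ideal_gen R A <->
  forall J : subfamily k, operadic_ideal J -> (forall A', (R A' <= J A')%VS) -> x \in J A.
Proof.
split=> [xI J JI RJ|H]; last exact: spannedE.
by apply: subvP xI; apply: spanned_subv => y; apply.
Qed.

Lemma ideal_gen_ideal : operadic_ideal (ideal_gen R).
Proof.
split=> [A A' f fB x /ideal_genP xI|A B x y /ideal_genP xI|A B x y /ideal_genP yI];
  apply/ideal_genP => J JI RJ; have [J1 J2 J3] := JI.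
- exact/J1/xI.
- exact/J2/xI.
- exact/J3/yI.
Qed.

Lemma ideal_gen_relators A : (R A <= ideal_gen R A)%VS.
Proof. by apply/subvP => x xR; apply/ideal_genP => J JI RJ; apply: (subvP (RJ A)). Qed.

(** The annihilator is an ideal containing the relators, hence contains the ideal they generate; so
    pre-Lie functions descend to the operad. *)
Lemma pair_ideal (W : lmodType k) (A : finType) (f : btree A -> W) x :
  preLie_fun 1 f -> x \in ideal_gen R A -> pair_with f x = 0.
Proof.
move=> fP /ideal_genP /(_ (annihilator W) (annihilator_ideal W) (annihilator_relators W)).
by move/annihilatorP; apply.
Qed.

Lemma opclass_linear (A : finType) : linear (@opclass k R A).
Proof. by move=> a x y; rewrite /opclass /classv !linearP. Qed.

Lemma opclass_eq (A : finType) (x y : freeS k A) :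
  x - y \in ideal_gen R A -> opclass R x = opclass R y.
Proof.
rewrite -classv_eq0 -/(opclass R _) => /eqP E.
have := linear_funD (@opclass_linear A) (x - y) y.
by rewrite subrK E add0r.
Qed.

Lemma opclass_repr (A : finType) (y : operad R A) : opclass R (reprv y) = y.
Proof. exact: reprvK. Qed.

Lemma repr_opclass (A : finType) (x : freeS k A) :
  reprv (opclass R x) - x \in ideal_gen R A.
Proof.
rewrite -classv_eq0 -/(opclass R _) (linear_funD (@opclass_linear A)).
by rewrite (linear_funN (@opclass_linear A)) opclass_repr subrr.
Qed.

Lemma opcomp_opclass (A : finType) (B : {set A}) (x : freeS k (lower B)) (y : freeS k (upper B)) :
  opcomp (opclass R x) (opclass R y) = opclass R (fcomp x y).
Proof.
have [_ I2 I3] := ideal_gen_ideal; apply: opclass_eq.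
set x' := reprv _; set y' := reprv _.
have -> : fcomp x' y' - fcomp x y = fcomp (x' - x) y' + fcomp x (y' - y).
  rewrite (linear_funD (fcomp_linear_l y')) (linear_funN (fcomp_linear_l y')).
  rewrite (linear_funD (fcomp_linear_r x)) (linear_funN (fcomp_linear_r x)).
  by rewrite addrA subrK.
by apply: rpredD; [apply: I2 | apply: I3]; apply: repr_opclass.
Qed.

Lemma oprelabel_opclass (A A' : finType) (f : A -> A') (x : freeS k A) :
  bijective f -> oprelabel f (opclass R x) = opclass R (relabel f x).
Proof.
move=> fB; have [I1 _ _] := ideal_gen_ideal; apply: opclass_eq.
rewrite -(linear_funN (relabel_linear f)) -(linear_funD (relabel_linear f)).
exact/I1/repr_opclass.
Qed.

Lemma pair_repr (W : lmodType k) (A : finType) (f : btree A -> W) x :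
  preLie_fun 1 f -> pair_with f (reprv (opclass R x)) = pair_with f x.
Proof.
move=> fP; have := pair_ideal fP (repr_opclass x).
rewrite (linear_funD (pair_linear f)) (linear_funN (pair_linear f)) => /eqP.
by rewrite subr_eq0 => /eqP.
Qed.

End PreLieOperad.

(** * Alternating elements of the operad and words *)

Definition mark (A : eqType) (a : A) (t : btree A) : btree bool := tmap (fun b => b == a) t.

(** A tree is determined by its shape and its word of leaves; the common image under f and g records
    that the shapes agree. *)
Lemma tree_eq_of_leaves (A B C : Type) (f : A -> C) (g : B -> C) (s : A -> B)
    (u : btree A) (v : btree B) :
  tmap f u = tmap g v -> map s (leaves u) = leaves v -> tmap s u = v.
Proof.
elim: u v => [a|l IHl r IHr] [b|l' r'] //=; first by move=> _ [<-].
case=> El Er; rewrite map_cat => E.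
have w : size (map s (leaves l)) = size (leaves l').
  by have := congr1 (fun t => weight t) El; rewrite -!/(tmap _ _) !leaves_tmap !size_map.
have := congr1 (take (size (map s (leaves l)))) E; rewrite take_size_cat // w take_size_cat // => E1.
have := congr1 (drop (size (map s (leaves l)))) E; rewrite drop_size_cat // w drop_size_cat // => E2.
by rewrite /tmap /= -!/(tmap _ _) (IHl l') ?(IHr r').
Qed.

Lemma tree_of_word (A B : Type) (t : btree B) (w : seq A) : size w = weight t ->
  exists u : btree A, leaves u = w /\ tmap (fun _ => tt) u = tmap (fun _ => tt) t.
Proof.
elim: t w => [b|l IHl r IHr] w /=.
  by case: w => [|a [|]] // _; exists (Leaf a).
rewrite size_cat => E.
have [|u1 [E1 S1]] := IHl (take (weight l) w); first by rewrite size_take E; case: ltnP => //; have := weight_gt0 r; lia.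
have [|u2 [E2 S2]] := IHr (drop (weight l) w); first by rewrite size_drop E addKn.
by exists (Node u1 u2); rewrite /= E1 E2 cat_take_drop; split=> //; congr Node.
Qed.

Lemma tmap_plug_inv (A B : Type) (f : A -> B) (u : btree A) c t :
  tmap f u = plug c t -> exists c' u', [/\ u = plug c' u', map_context f c' = c & tmap f u' = t].
Proof.
elim: c u t => [|[b s] c IH] u t /=; first by move=> <-; exists [::], u.
case: b; case: u => [//|l r]; rewrite /tmap /= -!/(tmap _ _) => -[El Er].
  have [c' [u' [-> cE uE]]] := IH _ _ Er.
  by exists ((true, l) :: c'), u'; split; rewrite //= cE El.
have [c' [u' [-> cE uE]]] := IH _ _ El.
by exists ((false, r) :: c'), u'; split; rewrite //= cE Er.
Qed.

Section Realization.
Variable k : fieldType.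
Notation R := (@preLie_rel k).
Notation Q := (@freeMod k boolC (-1)).
Notation cls := (@cls k boolC (-1)).

Definition map_sign (A A' : finType) (f : A -> A') : k :=
  wsign k (map f (enum A)) * wsign k (enum A).

Lemma map_sign_sqr (A A' : finType) (f : A -> A') : bijective f -> map_sign f * map_sign f = 1.
Proof.
move=> fB; have U : uniq (map f (enum A)) by rewrite map_inj_uniq ?enum_uniq //; apply: bij_inj.
by rewrite /map_sign mulrACA !wsign_sqr ?mulr1 ?enum_uniq.
Qed.

Lemma wsign_tmap (A A' : finType) (f : A -> A') (t : ltree A) : bijective f ->
  wsign k (leaves (tmap f t)) = map_sign f * wsign k (leaves t).
Proof.
move=> fB; rewrite leaves_tmap; apply: wsign_map => //.
by have := ltreeP t; rewrite labelled_perm.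
Qed.

Lemma orient_tmapE (A A' : finType) (f : A -> A') (t : ltree A) : bijective f ->
  orient k (tmap f t) = map_sign f * orient k t.
Proof.
by move=> fB; rewrite orient.unlock shape_sign_tmap wsign_tmap // mulrCA.
Qed.

Section Alphabet.
Variables (A : finType) (a : A).

(** The alternating sum of all labellings of t in which x receives a and the letters y receive the
    other labels. *)
Definition lift_tree (t : btree bool) : freeS k A :=
  [ffun u : ltree A => if mark a u == t then wsign k (leaves u) else 0].

Lemma mark_one_X (u : ltree A) : one_X #|A| (mark a u).
Proof.
have := ltreeP u; rewrite labelled_perm => P.
rewrite /one_X leaves_tmap size_map (perm_size P) -cardE eqxx /=.
rewrite count_map (eq_count (a2 := pred1 a)); last by move=> x /=; rewrite eqb_id.
by rewrite (seq.permP P) (count_uniq_mem a (enum_uniq A)) mem_enum.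
Qed.

Lemma exists_mark t : one_X #|A| t -> exists u : ltree A, mark a u = t.
Proof.
case/andP=> /eqP wt /eqP ct.
have : true \in leaves t by rewrite -has_pred1 has_count ct.
move=> tT; have [p [q E]] : exists p q : seq bool, leaves t = p ++ true :: q.
  by case/splitPr: tT => p q; exists p, q.
rewrite E count_cat /= in ct.
move/eqP: ct; rewrite addnCA add1n eqSS addn_eq0 => /andP[/eqP cp /eqP cq].
have nF s : count_mem true s = 0%N -> s = nseq (size s) false.
  move=> cs; apply/all_pred1P/allP => -[] //= sT.
  by move/count_memPn: cs; rewrite sT.
have aA : a \in enum A by rewrite mem_enum.
pose s := rem a (enum A).
have ss : size s = (size p + size q)%N.
  by rewrite size_rem // -cardE -wt E size_cat /= addnS.
have as_ : a \notin s by rewrite mem_rem_uniqF // enum_uniq.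
have [|u [uE uS]] := @tree_of_word A bool t (take (size p) s ++ a :: drop (size p) s).
  rewrite E !size_cat /= size_drop size_take ss; case: ltnP; lia.
have uP : perm_eq (leaves u) (enum A).
  rewrite uE perm_sym; apply: perm_trans (perm_to_rem aA) _; rewrite -/s.
  by rewrite perm_sym -cat1s perm_catCA cat_take_drop.
have uL : labelled u by rewrite labelled_perm.
exists (LTree uL) => /=.
have mF w : {subset w <= s} -> map (fun b => b == a) w = nseq (size w) false.
  move=> ws; elim: w ws => [//|b w IH] ws /=; rewrite IH; last by move=> x xw; apply: ws; rewrite inE xw orbT.
  by case: eqP => // ba; move: as_; rewrite -ba ws ?mem_head.
apply: (tree_eq_of_leaves (f := fun=> tt) (g := fun=> tt)) => //.
rewrite uE E map_cat /= eqxx !mF; try by move=> x /mem_take || move=> x /mem_drop.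
rewrite (nF p cp) (nF q cq) !size_nseq size_drop size_take ss.
have -> : (if size p < size p + size q then size p else size p + size q)%N = size p.
  by case: ltnP; lia.
by rewrite addKn.
Qed.

Lemma lift_tree0 t : ~~ one_X #|A| t -> lift_tree t = 0.
Proof.
move=> tN; apply/ffunP => u; rewrite !ffunE; case: eqP => // uE.
by move: (mark_one_X u); rewrite uE (negbTE tN).
Qed.

Definition symmetrize (x : freeS k A) : freeS k A :=
  \sum_(s : {perm A} | s a == a) map_sign s *: relabel s x.

Lemma perm_bij (s : {perm A}) : bijective s.
Proof. by exists (s^-1)%g; [apply: permK | apply: permKV]. Qed.

(* The trees with the marked shape of [u] form its orbit under the            *)
(* permutations fixing [a].                                                   *)
Lemma lift_tree_mark (u : ltree A) :
  lift_tree (mark a u) = wsign k (leaves u) *: symmetrize (tvec k u).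
Proof.
have /andP[Uu _] := ltreeP u; have Pu := ltreeP u; rewrite labelled_perm in Pu.
have E v : (symmetrize (tvec k u)) v = \sum_(s : {perm A} | s a == a) map_sign s * (tree_of v == tmap s u)%:R.
  rewrite /symmetrize sum_ffunE; apply: eq_bigr => s _.
  by rewrite !ffunE relabel_tvec ffunE.
apply/ffunP => v; rewrite !ffunE E scale_regularE; case: eqP => [vE|vE]; last first.
  rewrite big1 ?mulr0 // => s /eqP sa; case: eqP => [vs|]; rewrite ?mulr0 //.
  case: vE; rewrite vs /mark tmap_comp; apply: eq_tmap => x /=.
  by rewrite -{1}sa (inj_eq perm_inj).
have /andP[Uv _] := ltreeP v; have Pv := ltreeP v; rewrite labelled_perm in Pv.
have szE : size (leaves v) = size (leaves u) by rewrite (perm_size Pv) (perm_size Pu).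
pose f x := nth a (leaves v) (index x (leaves u)).
have memu x : x \in leaves u by rewrite (perm_mem Pu) mem_enum.
have fI : injective f.
  move=> x y /eqP; rewrite /f nth_uniq ?szE ?index_mem // => /eqP E'.
  by rewrite -[x](nth_index a (memu x)) E' nth_index.
pose s := perm fI.
have sv : map s (leaves u) = leaves v.
  apply: (@eq_from_nth _ a); rewrite size_map ?szE // => i lt_i.
  by rewrite (nth_map a) // permE /f index_uniq.
have vs : tree_of v = tmap s u by apply/esym/(tree_eq_of_leaves (esym vE)).
have sa : s a = a.
  have := congr1 (fun t => leaves t) vE; rewrite !leaves_tmap => /(congr1 (fun w => nth false w (index a (leaves u)))).
  rewrite !(nth_map a) ?szE ?index_mem // nth_index // eqxx => /eqP.
  by rewrite permE.
rewrite (bigD1 s) ?sa //= big1 ?addr0.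
  by rewrite vs eqxx mulr1 (wsign_tmap u (perm_bij s)) [RHS]mulrC.
move=> s' /andP[_ ss']; case: eqP => [vs'|]; rewrite ?mulr0 //.
case/eqP: ss'; apply/permP => x.
have : map s' (leaves u) = map s (leaves u) by rewrite sv vs' leaves_tmap.
by move/eq_in_map; apply; apply: memu.
Qed.

End Alphabet.
End Realization.

Lemma one_X_perm n t t' : perm_eq (leaves t) (leaves t') -> one_X n t = one_X n t'.
Proof. by move=> P; rewrite /one_X (perm_size P) (seq.permP P). Qed.

Section Realize.
Variable k : fieldType.
Notation R := (@preLie_rel k).
Notation Q := (@freeMod k boolC (-1)).
Notation cls := (@cls k boolC (-1)).

Section Alphabet.
Variables (A : finType) (a : A).

Lemma symmetrize_linear : linear (@symmetrize k A a).
Proof.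
move=> b x y; rewrite /symmetrize scaler_sumr -big_split; apply: eq_bigr => s _ /=.
by rewrite relabel_linear scalerDr !scalerA mulrC.
Qed.

Lemma symmetrize_ideal x : x \in ideal_gen R A -> symmetrize a x \in ideal_gen R A.
Proof.
have [I _ _] := ideal_gen_ideal k; move=> xI; apply: rpred_sum => s _.
by apply/rpredZ/I => //; apply: perm_bij.
Qed.

Definition realize_tree (t : btree bool) : operad R A := opclass R (lift_tree k a t).

Lemma realize_tree0 t : ~~ one_X #|A| t -> realize_tree t = 0.
Proof. by move=> /lift_tree0 -/(_ k a) E; rewrite /realize_tree E (linear_fun0 (@opclass_linear k A)). Qed.

Lemma realize_tree_mark (u : ltree A) :
  realize_tree (mark a u) = wsign k (leaves u) *: opclass R (symmetrize a (tvec k u)).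
Proof. by rewrite /realize_tree lift_tree_mark (linear_funZ (@opclass_linear k A)). Qed.

Lemma wsign_swap_subtrees (B : finType) c (t1 t2 t3 : btree B) :
  wsign k (leaves (plug c (Node (Node t1 t2) t3))) =
  (-1) ^+ (weight t2 * weight t3) * wsign k (leaves (plug c (Node (Node t1 t3) t2))).
Proof.
have [p [q pq]] := leaves_plug c; rewrite !pq /= -!catA !(catA p).
exact: wsign_block.
Qed.

Lemma leaves_rot (B : Type) c (t1 t2 t3 : btree B) :
  leaves (plug c (Node t1 (Node t2 t3))) = leaves (plug c (Node (Node t1 t2) t3)).
Proof. by have [p [q pq]] := leaves_plug c; rewrite !pq /= -!catA. Qed.

(** Exchanging two subtrees exchanges two blocks of the word of labels, and the sign of this
    exchange turns the ordinary pre-Lie relation into the super one. *)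
Lemma realize_preLie : preLie_fun (-1 : k) realize_tree.
Proof.
move=> c t1 t2 t3; rewrite /assoc.
have P2 := perm_plug c (perm_leaves_rot t1 t2 t3).
have P3 := perm_plug c (perm_leaves_swap t1 t2 t3).
have P4 := perm_plug c (perm_leaves_rot_swap t1 t2 t3).
have [H|H] := boolP (one_X #|A| (plug c (Node (Node t1 t2) t3))); last first.
  rewrite (realize_tree0 H) !realize_tree0 ?subrr ?scaler0 //.
  - by rewrite -(one_X_perm _ P4).
  - by rewrite -(one_X_perm _ P3).
  - by rewrite -(one_X_perm _ P2).
have [u uE] := exists_mark a H.
have [d [u' [uE' dE]]] := tmap_plug_inv uE.
case: u' uE' => [//|[//|s1 s2] s3] uE'; rewrite /tmap /= -!/(tmap _ _) => -[E1 E2 E3].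
have L : labelled (plug d (Node (Node s1 s2) s3)) by rewrite -uE'; apply: ltreeP.
have L2 := L; rewrite (perm_labelled (perm_plug d (perm_leaves_rot _ _ _))) in L2.
have L3 := L; rewrite (perm_labelled (perm_plug d (perm_leaves_swap _ _ _))) in L3.
have L4 := L; rewrite (perm_labelled (perm_plug d (perm_leaves_rot_swap _ _ _))) in L4.
rewrite -dE -E1 -E2 -E3.
rewrite -[Node _ _]/(tmap (fun b => b == a) (Node (Node s1 s2) s3)) -[Node (tmap _ s1) (Node (tmap _ s2) _)]/(tmap (fun b => b == a) (Node s1 (Node s2 s3))).
rewrite -[Node (Node _ (tmap _ s3)) _]/(tmap (fun b => b == a) (Node (Node s1 s3) s2)) -[Node (tmap _ s1) (Node (tmap _ s3) _)]/(tmap (fun b => b == a) (Node s1 (Node s3 s2))).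
rewrite -!tmap_plug -!/(mark _ _).
rewrite (realize_tree_mark (LTree L)) (realize_tree_mark (LTree L2)) (realize_tree_mark (LTree L3)) (realize_tree_mark (LTree L4)) /=.
rewrite !leaves_rot (wsign_swap_subtrees d s1 s2 s3) !leaves_tmap !size_map.
rewrite -!scalerA -!scalerBr; congr (_ *: (_ *: _)).
have oL := @opclass_linear k A; have sL := symmetrize_linear.
rewrite -!(linear_funN oL) -!(linear_funD oL) -!(linear_funN sL) -!(linear_funD sL).
apply: opclass_eq; rewrite -(linear_funN sL) -(linear_funD sL).
by apply/symmetrize_ideal/context_relator_ideal => //; [apply: ideal_gen_ideal | apply: ideal_gen_relators].
Qed.

Definition realize : {linear Q -> operad R A} := lin_ext realize_preLie.

Lemma realize_cls t : realize (cls t) = opclass R (lift_tree k a t).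
Proof. exact: lin_extE. Qed.

Lemma realize0 n z : spanned_by (one_X n) z -> n != #|A| -> realize z = 0.
Proof.
move=> + nA; move: z; apply: spanned_ind => [|b t z t1 IH]; first exact: linear0.
rewrite linearP IH addr0 realize_cls lift_tree0 ?(linear_fun0 (@opclass_linear k A)) ?scaler0 //.
by case/andP: t1 => /eqP <- _ in nA *; rewrite /one_X negb_and nA.
Qed.

(* Reads off a marked word from a labelled one.                               *)
Definition unrealize_tree (u : btree A) : Q := wsign k (leaves u) *: cls (mark a u).

(** The sign of exchanging two blocks of labels cancels the sign of the super relation. *)
Lemma unrealize_preLie : preLie_fun 1 unrealize_tree.
Proof.
move=> c t1 t2 t3; rewrite expr1n scale1r /assoc /unrealize_tree.
rewrite !leaves_rot (wsign_swap_subtrees c t1 t2 t3).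
have := @cls_preLie k boolC (-1) (map_context (fun b => b == a) c) (mark a t1) (mark a t2) (mark a t3).
rewrite /assoc /mark !tmap_plug !leaves_tmap !size_map -!scalerBr => ->.
rewrite scalerA mulrAC -exprD addnn -mul2n exprM sqrrN !expr1n mul1r //.
Qed.

Definition unrealize (y : operad R A) : Q := pair_with unrealize_tree (reprv y).

Definition stabilizer_size : nat := #|[pred s : {perm A} | s a == a]|.

(** The labellings of a monomial form one orbit of the stabilizer of a, and each of them is read
    back as the same monomial, its sign occurring twice. *)
Lemma unrealizeK z : spanned_by (one_X #|A|) z ->
  unrealize (realize z) = stabilizer_size%:R *: z.
Proof.
pose H := pair_linear unrealize_tree.
have uE x : unrealize (opclass R x) = pair_with unrealize_tree x.
  exact: pair_repr unrealize_preLie.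
have uL (y y' : operad R A) b : unrealize (b *: y + y') = b *: unrealize y + unrealize y'.
  by rewrite -[y]opclass_repr -[y']opclass_repr -(@opclass_linear k A) !uE H.
have u0 : unrealize 0 = 0 by rewrite -(linear_fun0 (@opclass_linear k A)) uE (linear_fun0 H).
move: z; apply: spanned_ind => [|b t z t1 IH].
  by rewrite linear0 u0 scaler0.
rewrite linearP uL IH scalerDr scalerA [_ * b]mulrC -scalerA; congr (_ *: _ + _).
have [u uE'] := exists_mark a t1.
rewrite realize_cls uE -uE' lift_tree_mark (linear_funZ H) /symmetrize (linear_fun_sum H).
rewrite /stabilizer_size -sum1_card scaler_sumr natr_sum scaler_suml; apply: eq_bigr => s /eqP sa.
rewrite (linear_funZ H) (pair_relabel (perm_bij s)) pair_tvec /unrealize_tree.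
rewrite (wsign_tmap k u (perm_bij s)) !scalerA.
have /andP[Uu _] := ltreeP u.
have -> : mark a (tmap s u) = mark a u.
  by rewrite /mark tmap_comp; apply: eq_tmap => x /=; rewrite -{1}sa (inj_eq perm_inj).
congr (_ *: _); have S := map_sign_sqr k (perm_bij s); have W := wsign_sqr k Uu.
set w := wsign k _ in W *; set m := map_sign k s in S *.
have -> : w * m * (m * w) = (m * m) * (w * w) by ring.
by rewrite S W mulr1.
Qed.

(** The composite is the alternating sum over the stabilizer of a, which multiplies an alternating
    element by the order of that group. *)
Lemma realizeK (y : operad R A) :
  (forall s : {perm A}, s a = a -> oprelabel s y = map_sign k s *: y) ->
  realize (unrealize y) = stabilizer_size%:R *: y.
Proof.
move=> yS; have sL := symmetrize_linear; have oL := @opclass_linear k A.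
transitivity (opclass R (symmetrize a (reprv y))).
  rewrite /unrealize /pair_with linear_sum {2}[reprv y]freeS_sum (linear_fun_sum sL) (linear_fun_sum oL).
  apply: eq_bigr => u _; rewrite linearZ /unrealize_tree /= linearZ /= realize_cls lift_tree_mark.
  rewrite (linear_funZ sL) !(linear_funZ oL); congr (_ *: _); rewrite scalerA.
  by have /andP[Uu _] := ltreeP u; rewrite wsign_sqr // scale1r.
rewrite /symmetrize (linear_fun_sum oL) /stabilizer_size -sum1_card natr_sum scaler_suml.
apply: eq_bigr => s /eqP sa; rewrite (linear_funZ oL).
have := yS s sa; rewrite /oprelabel => ->.
by rewrite scalerA map_sign_sqr ?scale1r //; apply: perm_bij.
Qed.

Lemma unrealize_spanned y : spanned_by (one_X #|A|) (unrealize y).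
Proof.
rewrite /unrealize /pair_with; apply: (big_ind (spanned_by (one_X #|A|))).
- exact: spanned0.
- by move=> x x'; apply: spannedD.
- by move=> u _; apply/spannedZ/spannedZ/spanned_cls/mark_one_X.
Qed.

Lemma stabilizer_gt0 : (0 < stabilizer_size)%N.
Proof. by rewrite lt0n; apply/pred0Pn; exists 1%g; rewrite /= perm1 eqxx. Qed.

End Alphabet.

Lemma relabel_lift_tree (A A' : finType) (f : A -> A') a t (fB : bijective f) :
  relabel f (lift_tree k a t) = map_sign k f *: lift_tree k (f a) t.
Proof.
apply/ffunP => v; have [u ->] := lmap_surj fB v.
rewrite (relabelE fB) !ffunE scale_regularE.
have -> : mark (f a) (lmap fB u) = mark a u.
  by rewrite /mark tmap_comp; apply: eq_tmap => x /=; rewrite (inj_eq (bij_inj fB)).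
case: eqP => _; last by rewrite mulr0.
by rewrite (wsign_tmap k u fB) mulrA map_sign_sqr ?mul1r.
Qed.

Lemma oprelabel_linear (A A' : finType) (f : A -> A') :
  linear (oprelabel f : operad R A -> operad R A').
Proof.
by move=> c x y; rewrite /oprelabel /reprv linearP (relabel_linear f) (@opclass_linear k A').
Qed.

Lemma oprelabel_realize (A A' : finType) (f : A -> A') a z (fB : bijective f) :
  oprelabel f (realize a z) = map_sign k f *: realize (f a) z.
Proof.
have oL := @opclass_linear k A'; have rL := oprelabel_linear f.
elim/freePL_ind: z => [|b t z IH].
  by rewrite !linear0 (linear_fun0 rL).
rewrite [realize a _]linearP [realize (f a) _]linearP rL IH.
rewrite scalerDr (scalerA (map_sign k f)) [map_sign k f * b]mulrC -(scalerA b); congr (_ *: _ + _).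
rewrite !realize_cls (oprelabel_opclass _ fB) (relabel_lift_tree _ _ fB).
by rewrite (linear_funZ oL).
Qed.

End Realize.

(** * The product of cochains *)

Fixpoint splits (A : Type) (v : btree A) : seq (context A * btree A) :=
  ([::], v) :: match v with
  | Leaf _ => [::]
  | Node l r => [seq ((false, r) :: p.1, p.2) | p <- splits l]
             ++ [seq ((true, l) :: p.1, p.2) | p <- splits r]
  end.

Section Contexts.
Variable A : eqType.
Implicit Types (c : context A) (u v : btree A).

Lemma mem_map_splits (x y : bool * btree A) c u (S : seq (context A * btree A)) :
  ((x :: c, u) \in [seq (y :: p.1, p.2) | p <- S]) = (x == y) && ((c, u) \in S).
Proof.
apply/mapP/andP => [[[c' u'] pS [-> -> ->]]|[/eqP -> cS]]; first by rewrite eqxx.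
by exists (c, u).
Qed.

Lemma mem_splits v c u : ((c, u) \in splits v) = (plug c u == v).
Proof.
elim: v c u => [a|l IHl r IHr] c u /=; rewrite inE.
  by case: c => [|[[] s] c] //=; rewrite xpair_eqE eqxx.
rewrite mem_cat; case: c => [|[b s] c].
  rewrite xpair_eqE eqxx /=; case: eqP => //= _.
  by apply/negP => /orP[] /mapP[[]].
rewrite !mem_map_splits IHl IHr xpair_eqE /=.
by rewrite !xpair_eqE; case: b; rewrite node_eq /= ?orbF // andbC.
Qed.

Lemma uniq_splits v : uniq (splits v).
Proof.
elim: v => [//|l IHl r IHr] /=; rewrite cat_uniq !map_inj_uniq ?IHl ?IHr /= ?andbT;
  try by move=> [c u] [c' u'] [-> ->].
rewrite mem_cat negb_or -andbA; apply/and3P; split.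
- by apply/negP => /mapP[[]].
- by apply/negP => /mapP[[]].
by apply/hasPn => p /mapP[q _ ->]; apply/negP => /mapP[[]].
Qed.

(** With distinct leaves, a subtree is located by its set of leaves: disjoint subtrees share none,
    and a strictly larger one has more. *)
Lemma plug_inj c c' u u' : uniq (leaves (plug c u)) -> plug c u = plug c' u' ->
  leaves u =i leaves u' -> c = c' /\ u = u'.
Proof.
have aux d (w w' : btree A) b s : plug ((b, s) :: d) w = w' -> uniq (leaves w') -> leaves w' =i leaves w -> False.
  move=> <- /= U E; have [p [q pq]] := leaves_plug d.
  have ls : lmost s \in leaves s := lmost_in s.
  case: b U E => /=; rewrite cat_uniq pq => /and3P[_ /hasPn H _] E.
    have : lmost s \in leaves w by rewrite -E mem_cat ls.
    by move=> sw; have := H (lmost s); rewrite /= !mem_cat sw ls orbT => /(_ isT).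
  have : lmost s \in leaves w by rewrite -E mem_cat ls orbT.
  by move=> sw; have := H (lmost s) ls; rewrite /= !mem_cat sw orbT.
elim: c c' u u' => [|[b s] c IH] [|[b' s'] c'] u u' /= U E L.
- by [].
- by case: (aux c' u' u b' s').
- by case: (aux c u u' b s E) => [|x]; [rewrite -E | rewrite L].
case: b b' U E => [] [] /= + [E1 E2].
- by rewrite cat_uniq => /and3P[_ _ U]; have [//|-> ->] := IH c' u u' U _ L; rewrite E1.
- rewrite cat_uniq => /and3P[_ /hasPn H _].
  have [p [q pq]] := leaves_plug c; have [p' [q' pq']] := leaves_plug c'.
  have := H (lmost u); rewrite pq !mem_cat lmost_in orbT E1 pq' !mem_cat -L lmost_in orbT.
  by move=> /(_ isT).
- rewrite cat_uniq => /and3P[_ /hasPn H _].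
  have [p [q pq]] := leaves_plug c; have [p' [q' pq']] := leaves_plug c'.
  have := H (lmost u); rewrite pq !mem_cat lmost_in orbT E2 pq' !mem_cat -L lmost_in orbT.
  by move=> /(_ isT).
- by rewrite cat_uniq => /and3P[U _ _]; have [//|-> ->] := IH c' u u' U _ L; rewrite E2.
Qed.

End Contexts.

Fixpoint before (A : Type) (c : context A) : nat :=
  match c with
  | [::] => 0
  | (true, l) :: c' => weight l + before c'
  | (false, _) :: c' => before c'
  end.

Lemma leaves_plug_before (A : Type) (c : context A) : exists p q,
  size p = before c /\ forall t, leaves (plug c t) = p ++ leaves t ++ q.
Proof.
elim: c => [|[b s] c [p [q [sp pq]]]] /=; first by exists [::], [::]; split=> // t; rewrite cats0.
case: b; first by exists (leaves s ++ p), q; rewrite size_cat sp; split=> // t /=; rewrite pq catA.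
by exists p, (q ++ leaves s); split=> // t /=; rewrite pq -!catA.
Qed.

Lemma before_map (A B : Type) (f : A -> B) c : before (map_context f c) = before c.
Proof. by elim: c => [|[[] s] c IH] //=; rewrite IH ?leaves_tmap ?size_map. Qed.

Section Star.
Variable k : fieldType.
Notation R := (@preLie_rel k).
Notation Q := (@freeMod k boolC (-1)).
Notation cls := (@cls k boolC (-1)).
Notation "a ** b" := (plmul a b) (at level 40, left associativity).

(* The sum over the leaves of [t1] of the results of replacing a leaf [x] by  *)
(* [t2], or a leaf [y] by [erase t2].                                         *)
Fixpoint star_list (t1 t2 : btree bool) : seq (k * btree bool) :=
  match t1 with
  | Leaf b => [:: (1, if b then t2 else erase t2)]
  | Node l r => [seq (p.1, Node p.2 r) | p <- star_list l t2]
      ++ [seq ((-1) ^+ (weight l * (weight t2).+1) * p.1, Node l p.2) | p <- star_list r t2]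
  end.

(** A term of the insertion whose monomial is the marked v corresponds to a subtree of v that reads
    as [t2], or as [erase t2] when a lies outside it, the rest of v reading as [t1] with the
    matching letter at the hole. *)
Lemma star_splits (A : finType) (a : A) (t1 t2 : btree bool) (v : btree A) : true \in leaves t2 ->
  \sum_(p <- star_list t1 t2) p.1 * (mark a v == p.2)%:R =
  \sum_(p <- splits v) (-1) ^+ (before p.1 * (weight p.2).+1)
    * ((plug (map_context (fun b => b == a) p.1) (Leaf (a \in leaves p.2)) == t1)%:R
    * (mark a p.2 == (if a \in leaves p.2 then t2 else erase t2))%:R) :> k.
Proof.
move=> t2X; elim: t1 v => [b|l1 IHl r1 IHr] v.
  rewrite /= big_seq1 mul1r.
  have -> : splits v = ([::], v) :: behead (splits v) by case: v.
  rewrite big_cons big1_seq ?addr0 /= ?mul0n ?mul1r; last first.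
    move=> p pv.
    have : p.1 != [::].
      by case: v pv => //= l r; rewrite mem_cat => /orP[] /mapP[q _ ->].
    by case: p.1 => [//|[[] s] c] _; rewrite /= mul0r mulr0.
  rewrite ?expr0 ?mul1r.
  have aE : (a \in leaves v) = (true \in leaves (mark a v)).
    by rewrite leaves_tmap; apply/idP/mapP => [av|[x xv /esym/eqP <-]//]; exists a; rewrite ?eqxx.
  have tE : true \in leaves (erase t2) = false.
    by rewrite leaves_tmap; apply/negP => /mapP[].
  rewrite -natrM mulnb; congr (_ %:R); congr nat_of_bool.
  apply/idP/andP => [/eqP vE|[/eqP [<-] //]].
  rewrite aE vE; case: (b); rewrite ?t2X ?tE; split=> //; exact/eqP.
case: v => [x|lv rv].
  rewrite /= big_seq1 /= mul0r mulr0.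
  rewrite big_cat !big_map /= !big1 ?addr0 // => p _; rewrite mulr0 //.
rewrite /= big_cons /= mul0r mulr0 add0r !big_cat !big_map /=; congr (_ + _).
  transitivity ((\sum_(p <- star_list l1 t2) p.1 * (mark a lv == p.2)%:R) * (mark a rv == r1)%:R : k).
    rewrite mulr_suml; apply: eq_bigr => p _; rewrite -mulrA -natrM mulnb.
    by rewrite /mark /tmap /= -!/(tmap _ _) node_eq.
  rewrite IHl mulr_suml; apply: eq_bigr => p _ /=.
  by rewrite node_eq -mulnb natrM; ring.
transitivity ((\sum_(p <- star_list r1 t2) p.1 * (mark a rv == p.2)%:R) *
   ((-1) ^+ (weight l1 * (weight t2).+1) * (mark a lv == l1)%:R) : k).
  rewrite mulr_suml; apply: eq_bigr => p _.
  rewrite {1}/mark /tmap /= -!/(tmap _ _) node_eq -mulnb natrM -!/(mark _ _); ring.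
rewrite IHr mulr_suml; apply: eq_bigr => p _ /=.
rewrite node_eq -mulnb natrM -/(mark a lv).
case: (mark a lv =P l1) => [<-|_]; last by rewrite !(mul0r, mulr0).
case: (mark a p.2 =P _) => [E|_]; last by rewrite !(mul0r, mulr0).
have -> : weight t2 = weight p.2.
  have := congr1 (fun t => weight t) E; rewrite !leaves_tmap size_map => ->.
  by case: ifP => // _; rewrite leaves_tmap size_map.
by rewrite !leaves_tmap size_map mulnDl exprD; ring.
Qed.

End Star.

Lemma eq_in_tmap (A : eqType) (B : Type) (f g : A -> B) (t : btree A) :
  {in leaves t, f =1 g} -> tmap f t = tmap g t.
Proof.
elim: t => [a|l IHl r IHr] H /=; first by rewrite /tmap /= H ?mem_head.
by rewrite /tmap /= -!/(tmap _ _) IHl ?IHr // => x xl; apply: H; rewrite mem_cat xl ?orbT.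
Qed.

Lemma map_context_comp (A B C : Type) (g : B -> C) (f : A -> B) (c : context A) :
  map_context g (map_context f c) = map_context (fun x => g (f x)) c.
Proof. by rewrite /map_context -map_comp; apply: eq_map => p /=; rewrite tmap_comp. Qed.

Lemma eq_in_map_context (A : eqType) (B : Type) (f g : A -> B) (c : context A) :
  (forall p, p \in c -> {in leaves p.2, f =1 g}) -> map_context f c = map_context g c.
Proof.
by move=> H; apply/eq_in_map => p pc; rewrite (eq_in_tmap (H _ pc)).
Qed.

Lemma mark_word (A : eqType) (w : seq A) (bs : seq bool) : uniq w ->
  size w = size bs -> count_mem true bs = 1%N ->
  exists2 x, x \in w & map (fun b => b == x) w = bs.
Proof.
elim: w bs => [|x w IH] [|b bs] //= /andP[xw Uw] [sz].
case: b => /= ct.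
  exists x; rewrite ?mem_head // eqxx; congr cons.
  have {ct} ct : count_mem true bs = 0%N by case: ct.
  elim: w bs {IH} xw Uw sz ct => [|y w IH] [|[] bs] //=.
  rewrite inE negb_or => /andP[xy xw] /andP[_ Uw] [sz] ct.
  by rewrite (IH bs) // eq_sym (negbTE xy).
have [|y yw <-] := IH bs Uw sz; first by case: (count_mem _ _) ct.
exists y; rewrite ?inE ?yw ?orbT //; congr cons.
by apply/negbTE; apply: contraNneq xw => ->.
Qed.

Section HoleContexts.
Variables (A : finType) (B : {set A}) (a : A).

Definition lower_label (x : A) : lower B := insub x.

Lemma lower_label_eq x : x \notin B -> (lower_label x == lower_label a) = (x == a).
Proof.
move=> xB; rewrite /lower_label insubT.
case: insubP => [y yB yE|]; first by rewrite -yE; apply/eqP/eqP => [[<-]|yx]; last by congr Some; apply: val_inj.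
by rewrite negbK => aB; apply/esym; apply: contraNF xB => /eqP ->.
Qed.

Lemma lower_label_None : (None == lower_label a) = (a \in B).
Proof. by rewrite /lower_label; case: insubP => [y yB _|]; [rewrite (negbTE yB) | rewrite negbK]. Qed.

Lemma mark_hole_context c : (forall p, p \in c -> {in leaves p.2, forall x, x \notin B}) ->
  mark (lower_label a) (hole_context B c) = plug (map_context (fun b => b == a) c) (Leaf (a \in B)).
Proof.
move=> cB; rewrite /mark /hole_context tmap_plug -/(map_context _ _) map_context_comp /tmap /=.
rewrite lower_label_None; congr plug; apply: eq_in_map_context => p pc x xp.
exact/lower_label_eq/(cB _ pc).
Qed.

(** If a is in B, only c = a is admissible. Otherwise the single x of t sits at one position of u,
    whose label is the unique possible c, and only the shape is a condition. *)
Lemma count_marks (t : btree bool) (u : ltree (upper B)) : count_mem true (leaves t) = 1%N ->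
  #|[pred c : upper B | ((a \in B) ==> (val c == a)) && (mark c u == t)]| =
  (mark a (tmap val u) == (if a \in B then t else erase t)).
Proof.
move=> ct; have mE c : mark (val c) (tmap val u) = mark c u.
  by rewrite /mark tmap_comp; apply: eq_tmap => x; exact: (inj_eq val_inj).
have [aB|aB] := boolP (a \in B).
  pose c0 : upper B := Sub a aB.
  rewrite -[a]/(val c0) mE /=; case: eqP => [E|E].
    rewrite -[RHS]/1%N -(card1 c0); apply: eq_card => c; rewrite !inE -(inj_eq val_inj) /=.
    by case: eqP => //= cE; rewrite (_ : c = c0) ?E ?eqxx //; apply: val_inj.
  apply: eq_card0 => c; rewrite !inE; case: eqP => //= cE.
  by apply/eqP; rewrite (_ : c = c0) //; apply: val_inj.
have -> : mark a (tmap val u) = tmap (fun=> false) u.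
  rewrite /mark tmap_comp; apply: eq_tmap => x /=.
  by apply/eqP => xa; move: (valP x); rewrite /= xa (negbTE aB).
have /andP[Uu _] := ltreeP u.
case: eqP => [E|E]; last first.
  apply: eq_card0 => c; rewrite !inE /=; apply/eqP => tE; apply: E.
  by rewrite -tE /erase /mark tmap_comp.
have sz : weight u = weight t.
  by have := congr1 (fun t => weight t) E; rewrite !leaves_tmap !size_map.
have [c cu cE] := mark_word Uu sz ct.
rewrite -[RHS]/1%N -(card1 c); apply: eq_card => c'; rewrite !inE /=.
apply/eqP/eqP => [c'E|->]; last exact: (tree_eq_of_leaves E).
have : map (fun b => b == c') (leaves u) = map (fun b => b == c) (leaves u).
  by rewrite cE -c'E leaves_tmap.
by move/eq_in_map/(_ c cu); rewrite eqxx => /eqP.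
Qed.

End HoleContexts.

Section ProductFormula.
Variable k : fieldType.
Notation R := (@preLie_rel k).
Notation Q := (@freeMod k boolC (-1)).
Notation cls := (@cls k boolC (-1)).

(** Subtrees of v correspond bijectively to its presentations as a graft, B being the set of labels
    of the subtree. *)
Lemma sum_splits (A : finType) (v : ltree A) (G : context A * btree A -> k)
    (H : forall B : {set A}, ltree (lower B) -> ltree (upper B) -> k) :
  (forall (B : {set A}) c (r : ltree (lower B)) (u : ltree (upper B)), plug c (tmap val u) = v -> tree_of r = hole_context B c ->
     B = [set a in leaves (tmap val u)] ->
     G (c, tmap val u) = H B r u) ->
  \sum_(p <- splits v) G p =
  \sum_(B : {set A}) \sum_(r : ltree (lower B)) \sum_(u : ltree (upper B))
     (tree_of v == graft r u)%:R * H B r u.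
Proof.
move=> GH; have /andP[Uv _] := ltreeP v.
transitivity (\sum_(B : {set A}) \sum_(p <- splits v | B == [set a in leaves p.2]) G p).
  rewrite (exchange_big_dep predT) //=; apply: eq_bigr => p _.
  by rewrite big_pred1_eq.
have setU (B : {set A}) (u : ltree (upper B)) : B = [set a in leaves (tmap val u)].
  apply/setP => x; rewrite inE leaves_tmap; have /andP[_ /forallP Au] := ltreeP u.
  apply/idP/mapP => [xB|[y _ ->]]; last exact: valP.
  by exists (Sub x xB); rewrite ?Au.
apply: eq_bigr => B _.
have inv (r : ltree (lower B)) (u : ltree (upper B)) : tree_of v = graft r u ->
    exists2 c, tree_of r = hole_context B c & plug c (tmap val u) = v.
  move=> vE; have /andP[Ur _] := ltreeP r.
  have [c [rE cE]] := graft_context (leaves_lower r) Ur.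
  by exists c; rewrite // vE cE.
have [/hasP[[c0 w0] p0 /eqP /= BE]|N] := boolP (has (fun p => B == [set a in leaves p.2]) (splits v)); last first.
  rewrite big_hasC // big1 // => r _; rewrite big1 // => u _.
  case: eqP => [/inv [c _ cE]|]; rewrite ?mul0r //.
  case/hasP: N; exists (c, tmap val u); first by rewrite mem_splits cE.
  by apply/eqP; apply: setU.
have vE : plug c0 w0 = v by apply/eqP; rewrite -mem_splits.
have L : labelled (plug c0 w0) by rewrite vE; apply: ltreeP.
have [r0 [u0 [uE rE gE]]] := exists_graft L BE.
have uniqp c u : plug c u = v -> B = [set a in leaves u] -> c = c0 /\ u = w0.
  move=> cE Bu; apply: plug_inj; rewrite ?cE ?vE // => x.
  by have := congr1 (fun S : {set A} => x \in S) BE; rewrite Bu !inE.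
rewrite big_mkcond (bigD1_seq (c0, w0)) ?uniq_splits //= -BE eqxx.
rewrite big1_seq ?addr0 => [|[c u] /= /andP[cu]]; last first.
  rewrite mem_splits => /eqP cE; case: eqP => // Bu.
  by case/eqP: cu; have [-> ->] := uniqp c u cE Bu.
rewrite (bigD1 r0) //= (bigD1 u0) //= -vE gE eqxx mul1r -uE (GH _ _ r0) ?uE //.
rewrite !big1 ?addr0 // => [r rN|u uN].
  rewrite big1 // => u _; case: eqP => [|_]; rewrite ?mul0r // -gE vE => /inv [c rc cE].
  case/eqP: rN; apply: val_inj; rewrite /= rc rE.
  by have [->] := uniqp c (tmap val u) cE (setU B u).
case: eqP => [|_]; rewrite ?mul0r // -gE vE => /inv [c rc cE].
case/eqP: uN; apply/val_inj/(tmap_inj val_inj); rewrite uE.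
by have [_ ->] := uniqp c (tmap val u) cE (setU B u).
Qed.

(** Both sides are compared at each labelled tree v, as sums over its subtrees. The inner sum over c
    reflects the decomposition of [omega a]: for a outside B the hole is a letter y, and marking
    each label of B in turn amounts to inserting [erase t2]. *)
Lemma product_formula (A : finType) (a : A) (t1 t2 : btree bool) : count_mem true (leaves t2) = 1%N ->
  \sum_(B : {set A}) shuffle_sign k B *: fcomp (lift_tree k (lower_label B a) t1)
     (\sum_(c : upper B | (a \in B) ==> (val c == a)) lift_tree k c t2)
  = \sum_(p <- star_list k t1 t2) p.1 *: lift_tree k a p.2.
Proof.
move=> ct; have t2X : true \in leaves t2 by rewrite -has_pred1 has_count ct.
apply/ffunP => v; rewrite !sum_ffunE.
transitivity (wsign k (leaves v) * \sum_(p <- star_list k t1 t2) p.1 * (mark a v == p.2)%:R); last first.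
  rewrite mulr_sumr; apply: eq_bigr => p _; rewrite !ffunE scale_regularE.
  by case: eqP => _; rewrite ?mulr1 ?mulr0 // mulrC.
rewrite (star_splits k a t1 v t2X) mulr_sumr.
rewrite (sum_splits (H := fun B r u => shuffle_sign k B * (lift_tree k (lower_label B a) t1 r *
   (\sum_(c : upper B | (a \in B) ==> (val c == a)) lift_tree k c t2) u))).
  apply: eq_bigr => B _; rewrite ffunE scale_regularE /fcomp sum_ffunE mulr_sumr; apply: eq_bigr => r _.
  rewrite sum_ffunE mulr_sumr; apply: eq_bigr => u _.
  rewrite ffunE [tvec _ _ _]ffunE scale_regularE.
  by ring.
move=> B c r u vE rE BE /=.
have /andP[Ur _] := ltreeP r; have /andP[Uv _] := ltreeP v.
have BP x : (x \in B) = (x \in leaves (tmap val u)).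
  by have := congr1 (fun S : {set A} => x \in S) BE; rewrite inE.
have cB p : p \in c -> {in leaves p.2, forall x, x \notin B}.
  move=> pc x xp; have [p1 [q1 [E1 _ E3]]] := leaves_plug_map c.
  move: Uv; rewrite -vE E1 uniq_catCA cat_uniq => /and3P[_ /hasPn H _].
  by rewrite BP; apply: H; apply: E3 pc _ xp.
rewrite -BP -(count_marks a u ct) -(mark_hole_context a cB) -rE.
rewrite [lift_tree _ _ _ r]ffunE.
have [E1|_] := eqVneq; last by rewrite !(mul0r, mulr0).
have -> : (\sum_(c : upper B | (a \in B) ==> (val c == a)) lift_tree k c t2) u =
    wsign k (leaves u) * #|[pred c : upper B | ((a \in B) ==> (val c == a)) && (mark c u == t2)]|%:R.
  rewrite sum_ffunE -sum1_card natr_sum mulr_sumr big_mkcondr /=; apply: eq_bigr => c' _.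
  by rewrite ffunE; case: ifP; rewrite ?mulr1.
(* The number of leaves of r before the hole is [before c], so [wsign_shuffle] yields exactly the
   sign attached to this insertion. *)
have -> : wsign k (leaves v) = shuffle_sign k B * (-1) ^+ (before c * (weight (tmap val u)).+1)
    * wsign k (leaves r) * wsign k (leaves u).
  have [p [q [Er Eg _ _]]] := graft_hole k u Ur (leaves_lower r).
  have -> : before c = size p.
    have [p' [q' [+ pq']]] := leaves_plug_before (map_context insub c : context (lower B)).
    rewrite before_map => <-.
    have rE' : leaves r = p' ++ None :: q' by rewrite rE pq'.
    have Np' : None \notin p'.
      by move: Ur; rewrite rE' cat_uniq /= negb_or => /and3P[_ /andP[]].
    have Np : None \notin map (@Some (outer B)) p by apply/negP => /mapP[].
    have := congr1 (index None) rE'; rewrite Er !index_cat (negbTE Np) (negbTE Np') /= !addn0.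
    by rewrite size_map.
  have -> : leaves v = map val p ++ map val (leaves u) ++ map val q.
    rewrite -Eg; congr leaves; rewrite -vE rE graft_hole_context //.
  rewrite wsign_shuffle ?leaves_tmap ?size_map -?Er //.
    by have := ltreeP u; rewrite labelled_perm.
  exact: perm_outer Er.
rewrite mul1r; set s := (-1) ^+ _; have ss : s * s = 1 by rewrite -expr2 sqrr_sign.
set N := _%:R; transitivity ((s * s) * (shuffle_sign k B * (wsign k (leaves r) * (wsign k (leaves u) * N)))); first by ring.
by rewrite ss mul1r.
Qed.

End ProductFormula.

Section MapSign.
Variable k : fieldType.

Lemma map_sign_comp (A B C : finType) (g : B -> C) (f : A -> B) : bijective f -> bijective g ->
  map_sign k (g \o f) = map_sign k g * map_sign k f.
Proof.
move=> fB gB; rewrite /map_sign map_comp (wsign_map k gB); first by rewrite !mulrA.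
apply: uniq_perm; rewrite ?enum_uniq //.
  by rewrite map_inj_uniq ?enum_uniq //; apply: bij_inj.
move=> x; rewrite mem_enum; have [f' _ fK] := fB; apply/mapP; exists (f' x) => //.
by rewrite mem_enum.
Qed.

Lemma map_sign_id (A : finType) (f : A -> A) : f =1 id -> map_sign k f = 1.
Proof.
by move=> fE; rewrite /map_sign (eq_map fE) map_id wsign_sqr // enum_uniq.
Qed.

Lemma relabel_omegaE (A A' : finType) (f : A -> A') a : bijective f ->
  relabel f (omega k a) = map_sign k f *: omega k (f a).
Proof.
move=> fB; rewrite -(relabel_omega a fB (fun t => orient_tmapE k t fB)) scalerA.
by rewrite map_sign_sqr ?scale1r.
Qed.

End MapSign.

Section Composition.
Variable k : fieldType.
Notation R := (@preLie_rel k).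

Lemma opcomp_linear_l (A : finType) (B : {set A}) (y : operad R (upper B)) :
  linear (fun x : operad R (lower B) => opcomp x y).
Proof.
by move=> b x x'; rewrite /opcomp /reprv linearP (fcomp_linear_l (vsval y)) (@opclass_linear k A).
Qed.

Lemma opcomp_linear_r (A : finType) (B : {set A}) (x : operad R (lower B)) :
  linear (fun y : operad R (upper B) => opcomp x y).
Proof.
by move=> b y y'; rewrite /opcomp /reprv linearP (fcomp_linear_r (vsval x)) (@opclass_linear k A).
Qed.

End Composition.

(** * Cochains represented by elements of the superalgebra *)

Section Products.
Variable k : fieldType.
Notation R := (@preLie_rel k).
Notation Q := (@freeMod k boolC (-1)).
Notation cls := (@cls k boolC (-1)).
Notation "a ** b" := (plmul a b) (at level 40, left associativity).
Notation X := (cls (Leaf true)).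
Notation Y := (cls (Leaf false)).
Notation kdual A := (kdual R A).
Notation cochain := (cochain R).

(** The value at [omega a] of the product of the cochains represented by z1 and z2, without the sign
    that depends on degrees. *)
Definition star_sum (A : finType) (a : A) (z1 z2 : Q) : operad R A :=
  \sum_(B : {set A}) shuffle_sign k B *:
    opcomp (realize k (lower_label B a) z1)
           (\sum_(c : upper B | (a \in B) ==> (val c == a)) realize k c z2).

Lemma star_sum_linear_l (A : finType) (a : A) z2 : linear (star_sum a ^~ z2).
Proof.
move=> b x y; rewrite /star_sum scaler_sumr -big_split; apply: eq_bigr => B _ /=.
by rewrite linearP opcomp_linear_l scalerDr !scalerA mulrC.
Qed.

Lemma star_sum_linear_r (A : finType) (a : A) z1 : linear (star_sum a z1).
Proof.
move=> b x y; rewrite /star_sum scaler_sumr -big_split; apply: eq_bigr => B _ /=.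
under eq_bigr do rewrite linearP.
by rewrite big_split -scaler_sumr opcomp_linear_r scalerDr !scalerA mulrC.
Qed.

Lemma star_sum_cls (A : finType) (a : A) t1 t2 : count_mem true (leaves t2) = 1%N ->
  star_sum a (cls t1) (cls t2) = realize k a (\sum_(p <- star_list k t1 t2) p.1 *: cls p.2).
Proof.
move=> ct; have oL := @opclass_linear k A.
transitivity (opclass R (\sum_(B : {set A}) shuffle_sign k B *: fcomp (lift_tree k (lower_label B a) t1)
     (\sum_(c : upper B | (a \in B) ==> (val c == a)) lift_tree k c t2))).
  rewrite /star_sum (linear_fun_sum oL); apply: eq_bigr => B _; rewrite (linear_funZ oL).
  under [X in opcomp _ X]eq_bigr do rewrite realize_cls.
  rewrite realize_cls -(linear_fun_sum (@opclass_linear k (upper B))).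
  by rewrite opcomp_opclass.
rewrite product_formula // linear_sum.
rewrite (big_morph _ (linear_funD oL) (linear_fun0 oL)); apply: eq_bigr => p _.
by rewrite (linear_funZ oL) linearZ /= realize_cls.
Qed.

(** Inserting z into x y: at x it gives the product of z and y, at y the product of x and [subst z]
    with a Koszul sign. *)
Lemma star_sum_xy_l (A : finType) (a : A) n z : spanned_by (one_X n) z ->
  star_sum a (X ** Y) z = realize k a (z ** Y - X ** subst k (parity k z)).
Proof.
move: z; apply: spanned_ind => [|b t z /andP[_ /eqP ct] IH].
  rewrite (linear_fun0 (star_sum_linear_r a _)).
  by rewrite !linear0 plmul0l plmul0r subr0 linear0.
rewrite star_sum_linear_r IH mul_cls star_sum_cls //=.
rewrite big_cons big_seq1 /= scale1r.
rewrite -linearP; congr (realize _ _ _).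
rewrite -mul_cls -[cls (Node (Leaf true) _)]mul_cls mul1n mulr1 exprS.
rewrite !linearP /= parity_cls linearZ /= subst_cls.
rewrite !(plmulDl, plmulDr, plmulZl, plmulZr).
by change (Choice.sort boolC) with bool; lmod k (@freeMod k boolC (-1)).
Qed.

(** Inserting x y at a leaf multiplies this leaf by y on the right, both for x and for y, which is
    the derivation [deriv]. *)
Lemma star_sum_xy_r (A : finType) (a : A) z :
  star_sum a z (X ** Y) = realize k a (deriv k z).
Proof.
elim/freePL_ind: z => [|b t z IH].
  by rewrite (linear_fun0 (star_sum_linear_l a _)) !linear0.
rewrite star_sum_linear_l IH !linearP mul_cls star_sum_cls //; congr (_ *: realize _ _ _ + _).
rewrite deriv_cls {IH}; elim: t => [v|l IHl r IHr] /=.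
  by rewrite big_seq1 scale1r; case: v.
rewrite big_cat !big_map -IHl -IHr /=; congr (_ + _).
  rewrite -rmulE linear_sum; apply: eq_bigr => p _.
  by rewrite linearZ /= rmulE mul_cls.
have mL := @mul_linear_r k (cls l).
rewrite (big_morph _ (linear_funD mL) (linear_fun0 mL)) scaler_sumr; apply: eq_bigr => p _.
rewrite (linear_funZ mL) mul_cls scalerA exprM.
by case: (sign_cases k (weight l)) => ->; rewrite ?expr1n // exprS sqrrN expr1n mulr1.
Qed.

Lemma kdproj_linear (A : finType) : linear (@kdproj k R A).
Proof. by move=> b x y; rewrite /kdproj linearP. Qed.

Lemma kdprojK (A : finType) (a : A) : vsval (kdproj R (omega k a)) = omega k a.
Proof. by rewrite /kdproj vsprojK // quadratic_cooperad_omega omega_mem. Qed.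

Lemma kdual_ind (A : finType) (W : lmodType k) (f g : kdual A -> W) : linear f -> linear g ->
  (forall a, f (kdproj R (omega k a)) = g (kdproj R (omega k a))) -> f =1 g.
Proof.
move=> fL gL H x; have pL := @kdproj_linear A.
have : vsval x \in omega_span k A by rewrite -quadratic_cooperad_omega subvsP.
rewrite -[x in f x]vsvalK -[x in g x]vsvalK -/(kdproj R _); move: (vsval x).
apply: span_ind => [|b v w /mapP[a _ ->] IH].
  by rewrite (linear_fun0 pL) (linear_fun0 fL) (linear_fun0 gL).
by rewrite pL fL gL H IH.
Qed.

Lemma kdrelabel_omega (A A' : finType) (f : A -> A') (a : A) : bijective f ->
  kdrelabel f (kdproj R (omega k a)) = map_sign k f *: kdproj R (omega k (f a)).
Proof.
by move=> fB; rewrite /kdrelabel kdprojK relabel_omegaE // (linear_funZ (@kdproj_linear A')).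
Qed.

(** One z serves all arities, as [realize] only sees the part of z of the weight given by the number
    of labels. *)
Definition represents (phi : cochain) (z : Q) : Prop :=
  forall n (a : 'I_n), phi n (kdproj R (omega k a)) = realize k a z.

Lemma kdrelabel_linear (A A' : finType) (f : A -> A') :
  linear (kdrelabel f : kdual A -> kdual A').
Proof. by move=> b x y; rewrite /kdrelabel linearP relabel_linear kdproj_linear. Qed.

Lemma extend_linear (phi : cochain) (A : finType) : (forall n, linear (phi n)) ->
  linear (@extend k R phi A).
Proof. by move=> L b x y; rewrite /extend kdrelabel_linear L oprelabel_linear. Qed.

Lemma extend_represents (phi : cochain) z (A : finType) (a : A) : (forall n, linear (phi n)) ->
  represents phi z -> extend phi (kdproj R (omega k a)) = realize k a z.
Proof.
move=> L H; rewrite /extend (kdrelabel_omega a (@enum_rank_bij A)) (linear_funZ (L _)) H.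
have vB : bijective (@enum_val A predT) by exact: enum_val_bij.
rewrite (linear_funZ (oprelabel_linear enum_val)) (oprelabel_realize _ _ vB) enum_rankK scalerA.
rewrite mulrC -map_sign_comp //; last exact: enum_rank_bij.
by rewrite map_sign_id ?scale1r // => x /=; rewrite enum_rankK.
Qed.

Lemma preLie_prod_linear e (phi psi : cochain) n : linear (@preLie_prod k R e phi psi n).
Proof.
move=> b x y; rewrite /preLie_prod scaler_sumr -big_split; apply: eq_bigr => B _ /=.
rewrite scaler_sumr -big_split; apply: eq_bigr => p _ /=.
rewrite !ffunE scalerA -scalerDl; congr (_ *: _).
rewrite scale_regularE.
set s := (-1) ^+ _; set s' := (-1) ^+ _; ring.
Qed.

Lemma omega_tvec (A : finType) (a : A) :
  omega k a = \sum_(t : ltree A | lmost t == a) orient k t *: tvec k t.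
Proof.
rewrite [LHS]freeS_sum [RHS]big_mkcond; apply: eq_bigr => t _; rewrite ffunE.
by case: ifP; rewrite ?scale0r.
Qed.

Lemma lmost_graft_eq (A : finType) (B : {set A}) (a : A) (r : ltree (lower B)) (u : ltree (upper B)) :
  (lmost (graft r u) == a) =
  (lmost r == lower_label B a) && ((a \in B) ==> (val (lmost u) == a)).
Proof.
rewrite lmost_graft; case: (lmost r) => [x|].
  have xB : val x \notin B := valP x.
  rewrite -(lower_label_eq a xB) {1}/lower_label valK.
  case: eqP => //= E; move: (lower_label_None B a); rewrite -E => /esym.
  by case: (a \in B).
by rewrite lower_label_None; case: eqP => [<-|]; rewrite ?(valP (lmost u)) //; case: (a \in B).
Qed.

(** Expanding each [omega] over trees identifies the decomposition of [omega a] with tensors of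
    generators, up to a sign depending on B. *)
Lemma preLie_prod_represents (e : int) (phi psi : cochain) z1 z2 w n (a : 'I_n) :
  (forall n, linear (phi n)) -> (forall n, linear (psi n)) ->
  represents phi z1 -> represents psi z2 -> spanned_by (one_X w) z2 -> odd (absz e + w) ->
  preLie_prod e phi psi (kdproj R (omega k a)) = star_sum a z1 z2.
Proof.
move=> phiL psiL H1 H2 z2w ew; apply: eq_bigr => B _.
have eL := extend_linear (A := lower B) phiL; have eL' := extend_linear (A := upper B) psiL.
have pL := @kdproj_linear (lower B); have pL' := @kdproj_linear (upper B).
transitivity ((shuffle_sign k B * (-1) ^+ ((n - #|B|) * (absz e + #|B|.-1))) *:
  opcomp (extend phi (kdproj R (omega k (lower_label B a))))
    (\sum_(c : upper B | (a \in B) ==> (val c == a)) extend psi (kdproj R (omega k c)))).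
  have -> : extend phi (kdproj R (omega k (lower_label B a))) =
      \sum_(r : ltree (lower B) | lmost r == lower_label B a) orient k r *: extend phi (kdproj R (tvec k r)).
    rewrite omega_tvec (linear_fun_sum pL) (linear_fun_sum eL); apply: eq_bigr => r _.
    by rewrite (linear_funZ pL) (linear_funZ eL).
  have -> : \sum_(c : upper B | (a \in B) ==> (val c == a)) extend psi (kdproj R (omega k c)) =
      \sum_(u : ltree (upper B) | (a \in B) ==> (val (lmost u) == a)) orient k u *: extend psi (kdproj R (tvec k u)).
    rewrite (partition_big (fun u : ltree (upper B) => lmost u) (fun c => (a \in B) ==> (val c == a))) //=.
    apply: eq_bigr => c cP; rewrite omega_tvec (linear_fun_sum pL') (linear_fun_sum eL').
    apply: eq_big => [u|u _]; last by rewrite (linear_funZ pL') (linear_funZ eL').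
    by case: eqP => [->|]; rewrite ?andbT ?andbF ?cP.
  rewrite (linear_fun_sum (opcomp_linear_l _)) scaler_sumr.
  transitivity (\sum_(r : ltree (lower B)) \sum_(u : ltree (upper B)) ((-1) ^+ (absz e * vertices r) * (fdec B (omega k a) (r, u))) *:
     opcomp (extend phi (kdproj R (tvec k r))) (extend psi (kdproj R (tvec k u)))).
    by rewrite pair_bigA /= kdprojK; apply: eq_bigr => -[r u].
  rewrite [RHS]big_mkcond; apply: eq_bigr => r _.
  case: ifP => rP; last first.
    by apply: big1 => u _; rewrite fdec_omega lmost_graft_eq rP /= !mulr0 scale0r.
  rewrite (linear_funZ (opcomp_linear_l _)) (linear_fun_sum (opcomp_linear_r _)) !scaler_sumr.
  rewrite [RHS]big_mkcond; apply: eq_bigr => u _.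
  rewrite fdec_omega lmost_graft_eq rP /=; case: ifP => _; last by rewrite !mulr0 scale0r.
  rewrite (linear_funZ (opcomp_linear_r _)) !scalerA; congr (_ *: _).
  rewrite vertices_lower card_ord [(absz e * _)%N]mulnC mulnDr exprD.
  set s1 := (-1) ^+ _; set s2 := (-1) ^+ _; ring.
rewrite (extend_represents _ phiL H1) -scalerA; congr (_ *: _).
under eq_bigr do rewrite (extend_represents _ psiL H2).
(* Only sets B of cardinal w contribute, and for them the parity hypothesis makes the exponent of
   the remaining sign even. *)
have [Bw|Bw] := eqVneq w #|B|; last first.
  rewrite big1 ?(linear_fun0 (opcomp_linear_r _)) ?scaler0 // => c _.
  by apply: (realize0 c z2w); rewrite card_sig (eq_card (B := mem B)) // => x; rewrite inE.
have [B0|B0] := eqVneq #|B| 0%N.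
  rewrite big_pred0 ?(linear_fun0 (opcomp_linear_r _)) ?scaler0 // => c.
  have /card0_eq BE := B0.
  by have := valP c; rewrite [val c \in B]BE.
have -> : (-1) ^+ ((n - #|B|) * (absz e + #|B|.-1)) = 1 :> k.
  rewrite -signr_odd oddM (_ : odd (absz e + #|B|.-1) = false) ?andbF //.
  by move: ew; rewrite Bw -{1}[#|B|]prednK ?lt0n // addnS /= => /negbTE.
by rewrite scale1r.
Qed.

Lemma MC_represents : represents (@MC_elt k R) (X ** Y).
Proof.
move=> n a; rewrite /MC_elt kdprojK mul_cls realize_cls; congr opclass.
apply/ffunP => u; rewrite !ffunE; have /andP[Uu _] := ltreeP u.
case: eqP => [|N]; last first.
  case: eqP => // E; case: N.
  by have := congr1 vertices E; rewrite vertices_tmap.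
rewrite orient.unlock; case: (tree_of u) Uu => [//|[b|//] [c|//]] /=; rewrite inE => /andP[bc _] _.
rewrite expr0 !mul1r /mark /tmap /= node_eq.
rewrite !leaf_eq eqb_id; case: eqP => //= ba.
by have -> : (c == a) = false by rewrite -ba eq_sym (negbTE bc).
Qed.

(** The bracket with x y combines the two insertions. The parity of w makes [parity z] a scalar
    multiple of z, which collects the terms into [diff]. *)
Lemma Def_diff_represents (d : int) (phi : cochain) z w n (a : 'I_n) :
  (forall n, linear (phi n)) -> represents phi z -> spanned_by (one_X w) z -> odd (absz d + w) ->
  Def_diff d phi (kdproj R (omega k a)) = realize k a (- (-1) ^+ absz d *: diff k z).
Proof.
move=> phiL H zw dw; have MCL n' : linear (@MC_elt k R n').
  by move=> b x y; rewrite /MC_elt linearP weight_part_linear (@opclass_linear k 'I_n').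
rewrite /Def_diff /bracket.
rewrite (preLie_prod_represents _ MCL phiL MC_represents H zw dw).
have XY : spanned_by (one_X 2) (X ** Y) by rewrite mul_cls; apply: spanned_cls.
rewrite (preLie_prod_represents _ phiL MCL H MC_represents XY) //.
rewrite (star_sum_xy_l _ zw) star_sum_xy_r -linearZ -linearB; congr (realize _ _ _).
have pz : parity k z = - (-1) ^+ absz d *: z.
  have -> : - (-1) ^+ absz d = (-1) ^+ w :> k.
    rewrite -[RHS]signr_odd -[in LHS]signr_odd; move: dw; rewrite oddD.
    by case: (odd w); case: (odd (absz d)) => // _; rewrite ?expr0 ?expr1 ?opprK.
  move: z zw {H}; apply: spanned_ind => [|b t z /andP[/eqP tw _] IH]; first by rewrite !linear0.
  by rewrite linearP IH parity_cls tw scalerDr !scalerA mulrC.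
rewrite diffE delE pz linearZ /= mulN1r abszN !(plmulZl, plmulZr).
by case: (sign_cases k (absz d)) => ->; change (Choice.sort boolC) with bool; lmod k (@freeMod k boolC (-1)).
Qed.

End Products.

(** * Acyclicity *)

Section Degrees.
Variable k : fieldType.
Notation cls := (@cls k boolC (-1)).

Lemma deriv_tree_spanned t : spanned_by (fun u => (weight u == (weight t).+1) &&
  (count_mem true (leaves u) == count_mem true (leaves t))) (deriv_tree k t).
Proof.
elim: t => [v|l IHl r IHr] /=; first by apply: spanned_cls; rewrite /= addn0 !eqxx.
apply: spannedD; last apply: spannedZ.
  apply: spanned_mul IHl (spanned_cls _ (P := pred1 r) (eqxx r)).
  move=> t u /andP[/eqP Et /eqP Ct] /eqP ->.
  by rewrite /= !size_cat Et !count_cat Ct !eqxx.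
apply: spanned_mul (spanned_cls _ (P := pred1 l) (eqxx l)) IHr.
move=> t u /eqP -> /andP[/eqP Et /eqP Ct].
by rewrite /= !size_cat Et addnS !count_cat Ct !eqxx.
Qed.

Lemma diff_one_X n z : spanned_by (one_X n) z -> spanned_by (one_X n.+1) (diff k z).
Proof.
apply: spanned_linear => t /andP[/eqP tn /eqP ct].
rewrite diffE delE deriv_cls parity_cls subst_cls plmulZl !mul_cls.
apply: spannedB; first apply: spannedD.
- apply: spanned_sub (deriv_tree_spanned t) => u /andP[/eqP un /eqP cu].
  by rewrite /one_X un cu tn ct !eqxx.
- by apply/spannedZ/spanned_cls; rewrite /one_X /= size_cat count_cat tn ct addn1 !eqxx.
apply: spanned_cls; rewrite /one_X /= leaves_tmap size_map tn eqxx count_map.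
by rewrite (eq_count (a2 := pred0)) // count_pred0.
Qed.

End Degrees.

Section Cochains.
Variable k : fieldType.
Notation R := (@preLie_rel k).
Notation Q := (@freeMod k boolC (-1)).
Notation cochain := (cochain R).

Lemma Def_diff_linear d (phi : cochain) n : linear (@Def_diff k R d phi n).
Proof.
move=> b x y; rewrite /Def_diff /bracket !preLie_prod_linear.
by rewrite scalerDr !scalerA [_ * b]mulrC -scalerA opprD addrACA -scalerBr.
Qed.

Section Comb.
Variables (A : finType) (a : A).

Lemma comb_labelled : labelled (comb (Leaf a) (rem a (enum A))).
Proof.
rewrite labelled_perm perm_sym.
have lE t s : leaves (comb t s) = leaves t ++ s.
  by elim: s t => [|b s IH] t; rewrite /= ?cats0 // IH /= -catA.
by rewrite lE /=; apply: perm_to_rem; rewrite mem_enum.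
Qed.

Definition comb_tree := LTree comb_labelled.
Arguments comb_tree : simpl never.

Lemma lmost_comb : lmost comb_tree = a.
Proof.
have lE t (s : seq A) : lmost (comb t s) = lmost t by elim: s t => [|b s IH] t //=; rewrite IH.
by rewrite lE.
Qed.

End Comb.
Arguments comb_tree : simpl never.

(* The coefficient of [omega k a] in [x] is read off a tree with leftmost     *)
(* leaf [a].                                                                  *)
Definition cochain_of (z : Q) : cochain := fun n x =>
  \sum_(a : 'I_n) (orient k (comb_tree a) * vsval x (comb_tree a)) *: realize k a z.

Lemma cochain_of_linear z n : linear (cochain_of z (n := n)).
Proof.
move=> b x y; rewrite /cochain_of scaler_sumr -big_split; apply: eq_bigr => a _ /=.
rewrite scalerA -scalerDl !ffunE scale_regularE; congr (_ *: _); ring.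
Qed.

Lemma cochain_of_represents z : represents (cochain_of z) z.
Proof.
move=> n a; rewrite /cochain_of kdprojK (bigD1 a) //= big1 ?addr0 => [|b ba].
  by rewrite ffunE lmost_comb eqxx; have := orient_sqr k (comb_tree a) => ->; rewrite scale1r.
by rewrite ffunE lmost_comb (negbTE ba) mulr0 scale0r.
Qed.

Lemma cochain_of_Hom_S d z :
  (forall n, - d != n%:Z - 1 -> forall a : 'I_n, realize k a z = 0) -> Hom_S d (cochain_of z).
Proof.
move=> zd; have L := cochain_of_linear z; split; first exact: L.
  move=> n s; have sB := perm_bij s.
  apply: (@kdual_ind k 'I_n _ (fun x => cochain_of z (kdrelabel s x)) (fun x => oprelabel s (cochain_of z x))) => [b x y|b x y|a].
  - by rewrite kdrelabel_linear L.
  - by rewrite L oprelabel_linear.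
  - rewrite kdrelabel_omega // (linear_funZ (L n)) !cochain_of_represents.
    by rewrite (oprelabel_realize _ _ sB).
by move=> n /zd z0 x; apply: big1 => a _; rewrite z0 scaler0.
Qed.

(** The value at one [omega] is alternating under its stabilizer by equivariance, so it is realized
    after division by the order of that group. A transposition carries the identity to the other
    labels. *)
Lemma Hom_S_represents (char0 : [pchar k] =i pred0) d n (phi : cochain) : Hom_S d phi -> - d = n%:Z - 1 -> (0 < n)%N ->
  exists2 z, spanned_by (one_X n) z & represents phi z.
Proof.
case: n => [//|n] [L E D] dn _; pose a0 : 'I_n.+1 := ord0.
pose N := stabilizer_size a0.
pose y := phi n.+1 (kdproj R (omega k a0)).
have N0 : N%:R != 0 :> k by rewrite (pcharf0P k).1 // -lt0n stabilizer_gt0.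
pose z := N%:R^-1 *: unrealize a0 y.
have zw : spanned_by (one_X n.+1) z.
  by apply: spannedZ; have := unrealize_spanned a0 y; rewrite card_ord.
exists z => // m a.
have [mn|mn] := eqVneq m n.+1; last first.
  rewrite (realize0 a zw) ?card_ord 1?eq_sym //; apply: D.
  by apply: contra mn => /eqP; rewrite dn => E'; apply/eqP; lia.
subst m.
have y0 : realize k a0 z = y.
  rewrite /z linearZ /= realizeK ?scalerA ?mulVf ?scale1r // => s sa.
  rewrite -E kdrelabel_omega ?(linear_funZ (L _)) ?sa //; exact: perm_bij.
pose s := tperm a0 a; have sB := perm_bij s.
have sa : s a0 = a by rewrite /s tpermL.
have := congr1 (oprelabel s) y0; rewrite (oprelabel_realize _ _ sB) sa -E kdrelabel_omega // sa.
rewrite (linear_funZ (L _)) => /(congr1 (fun x => map_sign k s *: x)).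
by rewrite !scalerA map_sign_sqr // !scale1r.
Qed.

Lemma realize_inj (char0 : [pchar k] =i pred0) n z : spanned_by (one_X n) z ->
  (forall m (a : 'I_m), realize k a z = 0) -> z = 0.
Proof.
case: n => [|n] zn H.
  move: z zn {H}; apply: spanned_ind => // b t z /andP[+ _].
  by rewrite size_eq0 => /eqP t0; have := weight_gt0 t; rewrite t0.
have := @unrealizeK k 'I_n.+1 ord0 z; rewrite card_ord H => /(_ zn) /esym/eqP.
have -> : unrealize ord0 (0 : operad R 'I_n.+1) = 0.
  have := @unrealizeK k 'I_n.+1 ord0 0 (spanned0 _ _); rewrite linear0 scaler0 //.
by rewrite scaler_eq0 (pcharf0P k).1 // eqn0Ngt stabilizer_gt0 => /eqP.
Qed.

End Cochains.

Theorem theorem4p1 (k : fieldType) (char0 : [pchar k] =i pred0) :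
  forall (d : int) (phi : cochain (preLie_rel k)),
    Def_cycle d phi -> Def_boundary d phi.
Proof.
move=> d phi [phiH dphi]; have [phiL phiE phiD] := phiH.
(* The scalar c is the sign of [Def_diff_represents] in degree d + 1; its square being 1, the
   cochain of c z has differential phi. *)
have boundary w z : spanned_by (one_X w) z -> odd (absz (d + 1) + w) ->
    (forall n, - (d + 1) != n%:Z - 1 -> forall a : 'I_n, realize k a z = 0) ->
    represents phi (diff k z) -> Def_boundary d phi.
  move=> zw dw zd phiz; pose c : k := - (-1) ^+ absz (d + 1).
  have cL := cochain_of_linear (c *: z).
  exists (cochain_of (c *: z)) => [|n].
    by apply: cochain_of_Hom_S => n dn a; rewrite linearZ /= zd ?scaler0.
  apply: kdual_ind => // [|a]; first exact: Def_diff_linear.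
  rewrite phiz (Def_diff_represents a cL (cochain_of_represents _) _ dw); last exact: spannedZ.
  rewrite [diff k (c *: z)]linearZ /= scalerA /c mulrNN -expr2 sqrr_sign scale1r //.
(* In positive degree there are no nonzero cochains, since arity n lies in degree 1 - n. *)
have [d1|d0] : (0 < d) \/ (d <= 0) by lia.
  apply: (boundary (absz (d + 1)).+1 0); first exact: spanned0.
  - by rewrite addnS addnn /= odd_double.
  - by move=> n _ a; rewrite linear0.
  move=> n a; rewrite !linear0; apply: phiD.
  by apply/eqP; have := ltn_ord a; lia.
have dn : - d = (absz d).+1%:Z - 1 by lia.
have [z zn phiz] := Hom_S_represents char0 phiH dn isT.
have odn : odd (absz d + (absz d).+1) by rewrite addnS addnn /= odd_double.
have dz : diff k z = 0.
  apply: (realize_inj char0 (diff_one_X zn)) => m a.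
  have := Def_diff_represents a phiL phiz zn odn; rewrite dphi linearZ /= => /esym/eqP.
  by rewrite scaler_eq0 oppr_eq0 signr_eq0 => /eqP.
have [z' zn' zE] := diff_exact char0 zn dz.
apply: (boundary (absz d) z') => //; last by rewrite -zE.
  (* In degree zero, [absz (d + 1)] exceeds [absz d] by one instead of falling short by one; the sum
     is odd in both cases. *)
  have [->|<-] // : d = 0 \/ (absz (d + 1)).+1 = absz d by lia.
  by rewrite addnS addnn /= odd_double.
move=> m dm a; rewrite (realize0 a zn') // card_ord; apply/eqP => /= E; case/eqP: dm; lia.
Qed.
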